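(* Let $\nu$ be a probability measure on $(\mathcal{X},\mathcal{B})$. Assume that a Borel set $\mathcal{X}_0\subset\mathcal{X}$ and a mapping $T:\mathcal{X}_0\to\mathcal{X}$ satisfy the conditions 1) $\nu(\mathcal{X}_0)=1$; 2) $T$ is measurable and injective; 3) $\nu\circ T^{-1}=\mu$. Then the mapping $\widehat{T}f=f\circ T$ is an isometry between the spaces $L^2(\mathcal{X},\mu)$ and $L^2(\mathcal{X},\nu)$ (i.e. of $L^2(\mathcal{X},\mu)$ onto $L^2(\mathcal{X},\nu)$). In particular, the mappings $I^\nu_n=\widehat{T}\circ I^\mu_n$, $n\ge0$, satisfy the following properties: 1) $\frac{1}{\sqrt{n!}}I^\nu_n:\mathcal{L}^{(n)}_{HS}(\mathcal{H})\to L^2(\mathcal{X},\nu)$ is an isometrical embedding; 2) the spaces $\mathcal{K}_n(\mathcal{X},\nu)=I^\nu_n(\mathcal{L}^{(n)}_{HS}(\mathcal{H}))$ are mutually orthogonal; 3) $L^2(\mathcal{X},\nu)=\bigoplus_{n=0}^\infty\mathcal{K}_n(\mathcal{X},\nu)$ (Hilbert sum). Equivalently, for each $f\in L^2(\mathcal{X},\nu)$ there exists a unique sequence $(A_n)_{n\ge0}$ of forms $A_n\in\mathcal{L}^{(n)}_{HS}(\mathcal{H})$ such that $$f=\sum_{n=0}^\infty I^\nu_nA_n\quad\text{in }L^2(\mathcal{X},\nu).$$ Moreover, this equality holds if and only if $f\circ T^{-1}=\sum_{n=0}^\infty I^\mu_nA_n$ in $L^2(\mathcal{X},\mu)$.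
   Context: $\mathcal{X}$ is a real separable Banach space with Borel $\sigma$-field $\mathcal{B}$; $\mu$ is a centered Gaussian measure on $(\mathcal{X},\mathcal{B})$ with $\operatorname{supp}\mu=\mathcal{X}$; $\mathcal{H}$ is its Cameron–Martin space, i.e. the real separable Hilbert space densely and compactly embedded in $\mathcal{X}$ with $\int_{\mathcal{X}}e^{il(x)}\mu(dx)=e^{-\frac12|l|^2_{\mathcal{H}}}$ for $l\in\mathcal{X}^*$ (with $\mathcal{X}^*$ regarded as a subset of $\mathcal{H}$ by restriction and the Riesz identification). $L^2(\mathcal{X},\cdot)$ denotes real-valued square integrable functions. $\mathcal{L}^{(n)}_{HS}(\mathcal{H})$ is the Hilbert space of $n$-linear symmetric Hilbert–Schmidt forms $A_n:\mathcal{H}^n\to\mathbb{R}$ with the Hilbert–Schmidt norm (for $n=0$: $\mathbb{R}$). $\mathcal{L}^{(n)}_{HS,fin}(\mathcal{H})$ is the set of $A_n\in\mathcal{L}^{(n)}_{HS}(\mathcal{H})$ with $A_n(h,\ldots,h)=\prod_{i=1}^d(h,e_i)^{k_i}$, $h\in\mathcal{H}$, for some system $e_1,\dots,e_d\in\mathcal{X}^*$ orthonormal in $\mathcal{H}$ (and $k_1+\dots+k_d=n$); its span is dense in $\mathcal{L}^{(n)}_{HS}(\mathcal{H})$. $H_k(t)=(-1)^ke^{t^2/2}(e^{-t^2/2})^{(k)}$ is the $k$-th Hermite polynomial. $I^\mu_n:\mathcal{L}^{(n)}_{HS}(\mathcal{H})\to L^2(\mathcal{X},\mu)$ is the unique bounded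 linear map such that for such $A_n\in\mathcal{L}^{(n)}_{HS,fin}(\mathcal{H})$, $I^\mu_nA_n(x)=\prod_{i=1}^dH_{k_i}(e_i(x))$. It is known that $\frac{1}{\sqrt{n!}}I^\mu_n$ is an isometry onto its image $\mathcal{K}_n(\mathcal{X},\mu)$, that these images are mutually orthogonal, and that $L^2(\mathcal{X},\mu)=\bigoplus_{n=0}^\infty\mathcal{K}_n(\mathcal{X},\mu)$ (Itô–Wiener expansion). The function $f\circ T^{-1}$ is defined on $T(\mathcal{X}_0)$, a set of full $\mu$-measure. *)

(* Defs.v *)
From HB Require Import structures.
From mathcomp Require Import all_boot all_order all_algebra all_fingroup.
From mathcomp Require Import all_classical all_reals all_analysis.
Set Implicit Arguments.
Unset Strict Implicit.
Unset Printing Implicit Defensive.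
Import Order.TTheory GRing.Theory Num.Theory.
Import numFieldNormedType.Exports.
Local Open Scope classical_set_scope.
Local Open Scope ring_scope.

(** ** Real L^2 spaces

An element of [L^2(mu)] is represented by a function [f \in Lfun mu 2%:E];
two such functions represent the same element when [f = g %[ae mu]]. *)

Definition L2norm d (T : measurableType d) (R : realType)
    (mu : {measure set T -> \bar R}) (f : T -> R) : \bar R :=
  Lnorm mu 2%:E (EFin \o f).

Definition L2dot d (T : measurableType d) (R : realType)
    (mu : {measure set T -> \bar R}) (f g : T -> R) : R :=
  Rintegral mu setT (fun x => f x * g x).

Definition L2cvg d (T : measurableType d) (R : realType)
    (mu : {measure set T -> \bar R}) (u : nat -> T -> R) (f : T -> R) : Prop :=
  L2norm mu (fun x => u N x - f x) @[N --> \oo] --> 0%E.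

Definition L2sum d (T : measurableType d) (R : realType)
    (mu : {measure set T -> \bar R}) (u : nat -> T -> R) (f : T -> R) : Prop :=
  L2cvg mu (fun N x => \sum_(n < N) u n x) f.

Definition L2_closed_subspace d (T : measurableType d) (R : realType)
    (mu : {measure set T -> \bar R}) (K : set (T -> R)) : Prop :=
  [/\ forall f, K f -> f \in Lfun mu 2%:E,
      K (cst 0),
      forall a f g, K f -> K g -> K (fun x => a * f x + g x)
    & forall (u : nat -> T -> R) f, (forall N, K (u N)) ->
        f \in Lfun mu 2%:E -> L2cvg mu u f -> K f].

Definition L2_mutually_orthogonal d (T : measurableType d) (R : realType)
    (mu : {measure set T -> \bar R}) (K : nat -> set (T -> R)) : Prop :=
  forall m n, m != n -> forall f g, K m f -> K n g -> L2dot mu f g = 0.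

Definition L2_hilbert_sum d (T : measurableType d) (R : realType)
    (mu : {measure set T -> \bar R}) (K : nat -> set (T -> R)) : Prop :=
  [/\ forall n, L2_closed_subspace mu (K n),
      L2_mutually_orthogonal mu K
    & forall f, f \in Lfun mu 2%:E -> forall e : R, 0 < e ->
        exists N (g : nat -> T -> R), (forall n, K n (g n)) /\
          (L2norm mu (fun x => f x - \sum_(n < N) g n x)%R < e%:E)%E].

(** [U] sends representatives to representatives; the second clause says that
it descends to a map on classes. *)
Definition L2_isometry_onto d d' (T : measurableType d)
    (T' : measurableType d') (R : realType) (mu : {measure set T -> \bar R})
    (nu : {measure set T' -> \bar R}) (U : (T -> R) -> (T' -> R)) : Prop :=
  [/\ forall f, f \in Lfun mu 2%:E -> U f \in Lfun nu 2%:E,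
      forall f g, f \in Lfun mu 2%:E -> g \in Lfun mu 2%:E ->
        f = g %[ae mu] -> U f = U g %[ae nu],
      forall a f g, f \in Lfun mu 2%:E -> g \in Lfun mu 2%:E ->
        U (fun x => a * f x + g x) = (fun y => a * U f y + U g y) %[ae nu],
      forall f, f \in Lfun mu 2%:E -> L2norm nu (U f) = L2norm mu f
    & forall g, g \in Lfun nu 2%:E ->
        exists2 f, f \in Lfun mu 2%:E & U f = g %[ae nu]].

(** ** Gaussian measures and the Cameron-Martin space *)

Definition borel (R : realType) (X : normedModType R) :=
  g_sigma_algebraType (@open X).

Definition separable (X : topologicalType) : Prop :=
  exists2 D : set X, countable D & dense D.

(** The law of a functional may be degenerate, i.e. the Dirac mass at 0. *)
Definition centered_gaussian (R : realType) (X : normedModType R)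
    (mu : probability (borel X) R) : Prop :=
  forall l : {scalar X}, continuous l ->
    exists2 s : R, 0 <= s &
      forall B : set (measurableTypeR R), measurable B ->
        mu (l @^-1` B) =
          if s == 0 then dirac (0 : measurableTypeR R) B else normal_prob 0 s B.

Definition full_support (R : realType) (X : normedModType R)
    (mu : probability (borel X) R) : Prop :=
  forall U : set X, open U -> U !=set0 -> (0 < mu U)%E.

(** [u : H] is the element of [H] identified with the functional [l] on [X]:
the Riesz representative of the restriction of [l] to [H]. *)
Definition represents (R : realType) (X H : normedModType R)
    (ip : {dot H for idfun}) (iota : {linear H -> X})
    (l : {scalar X}) (u : H) : Prop :=
  forall h, ip u h = l (iota h).

(** [H], with scalar product [ip] inducing its norm, is embedded in [X] by
[iota]. The characteristic functional of [mu] is split into its real and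
imaginary parts. *)
Definition cameron_martin (R : realType) (X H : completeNormedModType R)
    (mu : probability (borel X) R) (ip : {dot H for idfun})
    (iota : {linear H -> X}) : Prop :=
  [/\ (forall h, `|h| ^+ 2 = ip h h) /\ separable H,
      injective iota,
      dense (range iota),
      compact (closure (iota @` [set h | `|h| <= 1]))
    & forall l : {scalar X}, continuous l ->
        exists u : H,
          [/\ represents ip iota l u,
              Rintegral mu setT (fun x => cos (l x)) =
                expR (- (`|u| ^+ 2 / 2))
            & Rintegral mu setT (fun x => sin (l x)) = 0]].

(** ** Symmetric Hilbert-Schmidt forms

An [n]-linear form is a function on [H ^ n], i.e. on [{ffun 'I_n -> H}]. *)

Definition orthonormal_set (R : realType) (H : normedModType R)
    (ip : {dot H for idfun}) (E : set H) : Prop :=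
  forall e e', E e -> E e' -> ip e e' = (e == e')%:R.

Definition orthonormal_basis (R : realType) (H : normedModType R)
    (ip : {dot H for idfun}) (E : set H) : Prop :=
  orthonormal_set ip E /\
  dense [set h | exists d (e : 'I_d -> H) (c : 'I_d -> R),
    (forall i, E (e i)) /\ h = \sum_i c i *: e i].

Definition multilinear (R : realType) (H : lmodType R) n
    (A : H ^ n -> R) : Prop :=
  forall (i : 'I_n) (h : H ^ n) (a : R) (x y : H),
    A [ffun j => if j == i then a *: x + y else h j] =
    a * A [ffun j => if j == i then x else h j] +
    A [ffun j => if j == i then y else h j].

Definition symmetric_form (R : realType) (H : lmodType R) n
    (A : H ^ n -> R) : Prop :=
  forall (s : 'S_n) (h : H ^ n), A [ffun i => h (s i)] = A h.

Definition bounded_form (R : realType) (H : normedModType R) n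
    (A : H ^ n -> R) : Prop :=
  exists C : R, forall h : H ^ n, `|A h| <= C * \prod_i `|h i|.

(** Squared Hilbert-Schmidt norm, computed in the orthonormal basis [E]. *)
Definition HS_sqnorm (R : realType) (H : normedModType R) (E : set H) n
    (A : H ^ n -> R) : \bar R :=
  \esum_(f in [set f : H ^ n | forall i, E (f i)]) ((A f) ^+ 2)%:E.

Definition HS_norm (R : realType) (H : normedModType R) (E : set H) n
    (A : H ^ n -> R) : R := Num.sqrt (fine (HS_sqnorm E A)).

Definition HS_form (R : realType) (H : normedModType R) (E : set H) n
    (A : H ^ n -> R) : Prop :=
  [/\ multilinear A, symmetric_form A, bounded_form A
    & (HS_sqnorm E A < +oo)%E].

(** ** Multiple Wiener-Ito integrals *)

Definition hermite (R : realType) (k : nat) (t : R) : R :=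
  (-1) ^+ k * expR (t ^+ 2 / 2) *
  derive1n k (fun s : R => expR (- (s ^+ 2 / 2))) t.

Definition HS_linear d (T : measurableType d) (R : realType)
    (H : normedModType R) (E : set H) n (mu : {measure set T -> \bar R})
    (J : (H ^ n -> R) -> T -> R) : Prop :=
  (forall A, HS_form E A -> J A \in Lfun mu 2%:E) /\
  (forall a A B, HS_form E A -> HS_form E B ->
     J (fun h => a * A h + B h) = (fun x => a * J A x + J B x) %[ae mu]).

(** [J] is the map I^mu_n; [u] is the image in [H] of the system [l] of
elements of the dual of [X]. *)
Definition multiple_integral (R : realType) (X H : completeNormedModType R)
    (mu : probability (borel X) R) (ip : {dot H for idfun})
    (iota : {linear H -> X}) (E : set H) n
    (J : (H ^ n -> R) -> borel X -> R) : Prop :=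
  [/\ HS_linear E mu J,
      exists C : R, forall A, HS_form E A ->
        (L2norm mu (J A) <= (C * HS_norm E A)%:E)%E
    & forall d (l : 'I_d -> {scalar X}) (u : 'I_d -> H) (k : 'I_d -> nat) A,
        (forall i, continuous (l i)) ->
        (forall i, represents ip iota (l i) (u i)) ->
        (forall i j, ip (u i) (u j) = (i == j)%:R) ->
        (\sum_i k i = n)%N ->
        HS_form E A ->
        (forall h : H, A [ffun=> h] = \prod_i ip h (u i) ^+ k i) ->
        J A = (fun x => \prod_i hermite (k i) (l i x)) %[ae mu]].

Definition HS_isometric_embedding d (T : measurableType d) (R : realType)
    (H : normedModType R) (E : set H) n (mu : {measure set T -> \bar R})
    (J : (H ^ n -> R) -> T -> R) : Prop :=
  HS_linear E mu J /\
  forall A, HS_form E A -> L2norm mu (J A) = (HS_norm E A)%:E.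

Definition chaos d (T : measurableType d) (R : realType)
    (H : normedModType R) (E : set H) (mu : {measure set T -> \bar R})
    (I : forall n, (H ^ n -> R) -> T -> R) (n : nat) : set (T -> R) :=
  [set f | f \in Lfun mu 2%:E /\
           exists2 A, HS_form E A & f = I n A %[ae mu]].

(** ** The transport map

[T] is only meaningful on [X0], so [f \o T] is extended by 0 outside [X0]. *)
Definition pullback (V : Type) (R : realType) (X0 : set V) (T : V -> V)
    (f : V -> R) : V -> R := (f \o T) \_ X0.

(** [g] represents the class of [f \o T^-1], a function on [T @` X0]; this
includes that [T @` X0] has full measure. *)
Definition is_pushforward d (V : measurableType d) (R : realType)
    (mu : {measure set V -> \bar R}) (X0 : set V) (T : V -> V)
    (f g : V -> R) : Prop :=
  g \in Lfun mu 2%:E /\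
  {ae mu, forall y, exists x, [/\ X0 x, T x = y & g y = f x]}.

(* Main.v *)
Require Import Defs.
From HB Require Import structures.
From mathcomp Require Import all_boot all_order all_algebra all_fingroup.
From mathcomp Require Import all_classical all_reals all_analysis.
From mathcomp Require Import measurable_realfun.
From mathcomp Require Import zify ring lra.
Set Implicit Arguments.
Unset Strict Implicit.
Unset Printing Implicit Defensive.
Import Order.TTheory GRing.Theory Num.Theory.
Import numFieldNormedType.Exports.
Local Open Scope classical_set_scope.
Local Open Scope ring_scope.

(* Chaos on the Gaussian side. Integration by parts for the normal law gives the
   moments of continuous functionals, and expanding E (l + t m)^n in t turns them
   into Wick's formula for two functionals. It makes homogeneous Hermite
   polynomials orthogonal, which is the isometry on the tensor powers of the
   vectors of H represented by functionals. Those are dense in H by Hahn-Banach,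
   so by polarization their tensor powers span a dense set of forms. The chaoses
   exhaust L^2(mu): the closure of their span contains the powers of each
   functional, hence its cosines, hence the indicators of all Borel sets.

   Transport. Composition with T is isometric by change of variables; the point is
   that it is onto. By regularity, tightness and Lusin's theorem, X0 is, up to a
   null set, a countable union of compact sets on which T is continuous. As T is
   injective, it maps the Borel subsets of these compact sets to Borel sets, so
   T^-1 is Borel on a Borel set of full mu-measure. *)

(** * Norming functionals *)

(** The hypotheses give the law of each functional separately, and the integrals only on products
    over orthonormal systems, with boundedness but without the isometry. Joint moments can be
    recovered because the laws of all combinations l + t m are known.

    That injective Borel maps send Borel sets to Borel sets is in general the Lusin-Souslin theorem,
    which rests on analytic sets. Here a Borel set of full measure is enough, and where T is
    continuous on a compact set, the images of closed subsets are compact.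

    Elements of L^2 are functions up to almost everywhere equality, and the integrals are linear
    only in that sense; so the Hilbert space arguments are made for semi-inner products. *)

Section HahnBanach.
Variables (R : realType) (X : normedModType R).
Implicit Types (x y z : X) (r s : R) (G : set (X * R)).

(* Graphs of linear functionals defined on a subspace and dominated by the norm. *)
Let dominated_graph (x0 : X) G :=
  [/\ forall a p q, G p -> G q -> G (a *: p.1 + q.1, a * p.2 + q.2),
      forall p, G p -> p.2 <= `|p.1|
    & forall p, G p -> G (x0, `|x0|)].

Let extend_graph G z c : set (X * R) :=
  [set p | exists q a, G q /\ p = (q.1 + a *: z, q.2 + a * c)].

(** The two conditions are the cases a = 1 and a = -1 of domination on G + R z. Homogeneity gives
    the others, after division by |a|. *)
Let extend_dominated x0 G z c : dominated_graph x0 G ->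
  (forall p, G p -> p.2 + c <= `|p.1 + z|) ->
  (forall p, G p -> p.2 - c <= `|p.1 - z|) ->
  dominated_graph x0 (extend_graph G z c).
Proof.
move=> [Glin Gdom G0] hp hm.
have scal p b : G p -> G (b *: p.1, b * p.2).
  move=> Gp; have Gz : G (0, 0).
    have := Glin (-1) p p Gp Gp.
    by rewrite scaleN1r addNr mulN1r addNr.
  by have := Glin b p _ Gp Gz; rewrite /= !addr0.
split.
- move=> b _ _ [p [a [Gp ->]]] [q [a' [Gq ->]]].
  exists (b *: p.1 + q.1, b * p.2 + q.2), (b * a + a'); split.
    exact: Glin.
  congr (_, _) => /=; last by ring.
  by rewrite scalerDr scalerDl scalerA addrACA.
- move=> _ [p [a [Gp ->]]] /=.
  have [a0|a0|a0] := ltrgt0P a.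
  + have E : `|p.1 + a *: z| = a * `|a^-1 *: p.1 + z|.
      by rewrite -[a in a * _]gtr0_norm// -normrZ scalerDr scalerA divff ?gt_eqF// scale1r.
    rewrite E -ler_pdivrMl//; apply: le_trans (hp _ (scal p a^-1 Gp)).
    by rewrite /= mulrDr mulrA mulVf ?gt_eqF// mul1r.
  + have b0 : 0 < - a by rewrite oppr_gt0.
    have E : `|p.1 + a *: z| = - a * `|(- a)^-1 *: p.1 - z|.
      rewrite -{1}(gtr0_norm b0) -normrZ scalerBr scalerA divff ?gt_eqF//.
      by rewrite scale1r scaleNr opprK.
    rewrite E -ler_pdivrMl//; apply: le_trans (hm _ (scal p (- a)^-1 Gp)).
    rewrite /= mulrDr -[a in a * c]opprK mulNr mulrN mulrA mulVf ?gt_eqF//.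
    by rewrite mul1r.
  + by rewrite a0 mul0r scale0r !addr0; exact: Gdom.
- move=> _ [p [a [Gp _]]]; exists (x0, `|x0|), 0; split; first exact: G0 Gp.
  by rewrite scale0r mul0r !addr0.
Qed.

(** An admissible value at z lies above every p.2 - |p.1 - z| and below every |q.1 + z| - q.2;
    domination at p + q makes these bounds compatible. The supremum of the lower ones is taken, and
    maximality puts z into the domain. *)
Let total_graph x0 G : G !=set0 -> dominated_graph x0 G ->
  (forall G', G `<` G' -> ~ dominated_graph x0 G') ->
  forall z, exists c, G (z, c).
Proof.
move=> [p0 Gp0] domG maxG z; have [Glin Gdom G0] := domG.
pose S := [set p.2 - `|p.1 - z| | p in G].
have ubS q : G q -> ubound S (`|q.1 + z| - q.2).
  move=> Gq _ [p Gp <-].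
  have := Gdom _ (Glin 1 p q Gp Gq); rewrite /= scale1r mul1r.
  have -> : p.1 + q.1 = (p.1 - z) + (q.1 + z) by rewrite addrACA addNr addr0.
  have := ler_normD (p.1 - z) (q.1 + z); lra.
have supS : has_sup S.
  split; first by exists (p0.2 - `|p0.1 - z|); exists p0.
  by exists (`|p0.1 + z| - p0.2); exact: ubS.
exists (sup S).
have domE : dominated_graph x0 (extend_graph G z (sup S)).
  apply: extend_dominated => // p Gp.
    by rewrite addrC -lerBrDr; apply: ge_sup; [exact: supS.1 | exact: ubS].
  by rewrite lerBlDr -lerBlDl; apply: ub_le_sup; [exact: supS.2 | exists p].
have GE : G `<=` extend_graph G z (sup S).
  move=> p Gp; exists p, 0; split=> //.
  by rewrite scale0r mul0r !addr0; case: p Gp.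
apply: contrapT => nGz; apply: (maxG _ _ domE); split=> // EG.
apply: nGz; apply: EG; exists (0, 0), 1; split; last first.
  by rewrite /= scale1r mul1r !add0r.
by have := Glin (-1) p0 p0 Gp0 Gp0; rewrite scaleN1r addNr mulN1r addNr.
Qed.

Lemma norming_functional x0 : exists l : {scalar X},
  [/\ continuous l, forall x, `|l x| <= `|x| & l x0 = `|x0|].
Proof.
have [|G [domG maxG]] := @Zorn_bigcup _ (dominated_graph x0).
  move=> F FP totF; split.
  - move=> a p q [G1 FG1 G1p] [G2 FG2 G2q].
    have [s12|s21] := totF _ _ FG1 FG2.
      by have [lin _ _] := FP _ FG2; exists G2 => //; apply: lin => //; exact: s12.
    by have [lin _ _] := FP _ FG1; exists G1 => //; apply: lin => //; exact: s21.
  - by move=> p [G1 FG1 G1p]; have [_ dom _] := FP _ FG1; exact: dom.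
  - move=> p [G1 FG1 G1p]; have [_ _ d0] := FP _ FG1.
    by exists G1 => //; exact: d0 G1p.
have G0 : G !=set0.
  (* Zorn's lemma also asks for the union of the empty chain, so the last clause of
     [dominated_graph] holds vacuously for the empty graph. The graph over the line through x0 shows
     that the empty one is not maximal. *)
  apply/set0P/negP => /eqP G0.
  pose L : set (X * R) := [set (a *: x0, a * `|x0|) | a in [set: R]].
  apply: (maxG L).
    by rewrite G0; split=> // /(_ (1 *: x0, 1 * `|x0|)); apply; exists 1.
  split.
  - move=> a _ _ [b _ <-] [c _ <-]; exists (a * b + c) => //=.
    by rewrite scalerDl scalerA mulrDl mulrA.
  - by move=> _ [b _ <-] /=; rewrite normrZ ler_wpM2r// ler_norm.
  - by move=> _ _; exists 1 => //; rewrite scale1r mul1r.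
have /choice[f Gf] := total_graph G0 domG maxG.
have [Glin Gdom Gx0] := domG.
(* Two values over the same x differ by a value over 0, which domination bounds by 0. *)
have uniqG x r s : G (x, r) -> G (x, s) -> r <= s.
  move=> xr xs; have := Gdom _ (Glin (-1) _ _ xs xr).
  by rewrite /= scaleN1r addNr normr0 mulN1r addrC subr_le0.
have uG x r : G (x, r) -> r = f x.
  by move=> xr; apply/eqP; rewrite eq_le !(uniqG x).
have flin : scalar f by move=> a x y; rewrite -(uG _ _ (Glin a _ _ (Gf x) (Gf y))).
pose l : {scalar X} := HB.pack f (GRing.isLinear.Build _ _ _ _ f flin).
have lbd x : `|l x| <= `|x|.
  rewrite ler_norml; apply/andP; split; last exact: (Gdom _ (Gf x)).
  by rewrite lerNl -(raddfN l) -normrN; exact: (Gdom _ (Gf (- x))).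
exists l; split=> //; last by case: G0 => p Gp; rewrite [RHS](uG _ _ (Gx0 p Gp)).
apply: bounded_linear_continuous; apply/linear_boundedP.
near=> r => x; apply: (le_trans (lbd x)); rewrite ler_peMl//.
Unshelve. all: by end_near. Qed.

End HahnBanach.

(** * Moments of Gaussian functionals *)

Section Density.
Context d (T : measurableType d) (R : realType).
Variables (m p : {measure set T -> \bar R}) (phi : T -> R).
Hypothesis mphi : measurable_fun setT phi.
Hypothesis phi0 : forall x, 0 <= phi x.
Hypothesis pE : forall A, measurable A -> p A = (\int[m]_(x in A) (phi x)%:E)%E.
Local Open Scope ereal_scope.
Import HBNNSimple.

Let ge0_integral_density_nnsfun (h : {nnsfun T >-> R}) :
  \int[p]_x (h x)%:E = \int[m]_x ((h x)%:E * (phi x)%:E).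
Proof.
under [LHS]eq_integral do rewrite fimfunE -fsumEFin//.
rewrite [LHS]ge0_integral_fsum//; last 2 first.
  - by move=> r; exact/measurable_EFinP/measurableT_comp.
  - by move=> n x _; rewrite EFinM nnfun_muleindic_ge0.
under [RHS]eq_integral.
  move=> x xD; rewrite fimfunE -fsumEFin// ge0_mule_fsuml; last first.
    by move=> r; rewrite EFinM nnfun_muleindic_ge0.
  over.
rewrite [RHS]ge0_integral_fsum//; last 2 first.
  - move=> r; apply: emeasurable_funM; last exact/measurable_EFinP.
    by apply/measurable_EFinP; do 2 apply/measurableT_comp => //.
  - move=> n x _; apply: mule_ge0; last by rewrite lee_fin.
    by rewrite EFinM nnfun_muleindic_ge0.
apply: eq_fsbigr => r _; have [r0|r0] := ltP r 0%R.
  have E x : (r * \1_(h @^-1` [set r]) x = 0)%R.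
    rewrite indicE memNset ?mulr0// => /= hx.
    by have : (0 <= h x)%R by []; rewrite hx leNgt r0.
  by under eq_integral do rewrite E; under [RHS]eq_integral do rewrite E mul0e;
    rewrite !integral0.
have mh : measurable (h @^-1` [set r]) by exact: measurable_funPTI.
under eq_integral do rewrite EFinM.
rewrite ge0_integralZl//; last by apply/measurable_EFinP; exact: measurable_indic.
under [RHS]eq_integral do rewrite EFinM -muleA.
rewrite [RHS]ge0_integralZl//; last 2 first.
  apply: emeasurable_funM; last exact/measurable_EFinP.
  by apply/measurable_EFinP; exact: measurable_indic.
  by move=> x _; rewrite mule_ge0// lee_fin.
congr *%E; rewrite integral_indic// setIT pE// integral_mkcond.
by apply: eq_integral => x _; rewrite patchE indicE; case: ifP; rewrite ?mul1e ?mul0e.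
Qed.

Lemma ge0_integral_density (f : T -> \bar R) : measurable_fun setT f ->
  (forall x, 0 <= f x) -> \int[p]_x f x = \int[m]_x (f x * (phi x)%:E).
Proof.
move=> mf f0; pose f_ := nnsfun_approx measurableT mf.
have fcvg x : (f_ n x)%:E @[n --> \oo] --> f x by exact: cvg_nnsfun_approx.
transitivity (limn (fun n => \int[p]_x (f_ n x)%:E)).
  rewrite -monotone_convergence//=.
  - by apply: eq_integral => x _; apply/esym/cvg_lim => //=; exact: fcvg.
  - by move=> n; exact/measurable_EFinP.
  - by move=> n x _; rewrite lee_fin.
  - by move=> x _ a b ab; rewrite lee_fin//; exact/lefP/nd_nnsfun_approx.
under eq_fun do rewrite ge0_integral_density_nnsfun.
rewrite -monotone_convergence//=.
- apply: eq_integral => x _; apply/cvg_lim => //=.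
  by apply: cvgeZr => //; exact: fcvg.
- move=> n; apply: emeasurable_funM; exact/measurable_EFinP.
- by move=> n x _; rewrite mule_ge0// lee_fin.
- move=> x _ a b ab; rewrite lee_wpmul2r ?lee_fin//.
  exact/lefP/nd_nnsfun_approx.
Qed.

Lemma integrable_density (f : T -> R) : p.-integrable setT (EFin \o f) ->
  m.-integrable setT (fun x => (f x * phi x)%:E) /\
  \int[p]_x (f x)%:E = \int[m]_x (f x * phi x)%:E.
Proof.
move=> /integrableP[/measurable_EFinP mf fi].
have mn : measurable_fun setT (fun x => `|f x|%:E).
  by apply/measurable_EFinP/measurableT_comp.
have I : m.-integrable setT (fun x => (f x * phi x)%:E).
  apply/integrableP; split.
    by apply/measurable_EFinP/measurable_funM.
  rewrite (_ : \int[m]_x _ = \int[p]_x `|(f x)%:E|)//.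
  rewrite ge0_integral_density//.
  by apply: eq_integral => x _; rewrite /= normrM (ger0_norm (phi0 x)).
split=> //; rewrite integralE [RHS]integralE; congr (_ - _).
  rewrite ge0_integral_density//; last exact/measurable_funepos/measurable_EFinP.
  apply: eq_integral => x _; rewrite !funeposE -!EFin_max -EFinM.
  by rewrite maxr_pMl// mul0r.
rewrite ge0_integral_density//; last exact/measurable_funeneg/measurable_EFinP.
apply: eq_integral => x _; rewrite !funenegE -!EFinN -!EFin_max -EFinM.
by rewrite maxr_pMl// mul0r mulNr.
Qed.

End Density.

Lemma normr_le_expR (R : realType) (x : R) : expR `|x| <= expR x + expR (- x).
Proof.
by have [x0|x0] := ger0P x; rewrite ?lerDl ?lerDr expR_ge0.
Qed.

(** A single term of the exponential series. The right side is symmetrized because the integrals of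
    expR (t x) are the ones computed explicitly; it is an integrable majorant for every power. *)
Lemma exprn_le_expR (R : realType) n (x : R) :
  `|x| ^+ n <= n`!%:R * (expR x + expR (- x)).
Proof.
apply: (@le_trans _ _ (n`!%:R * expR `|x|)); last first.
  by rewrite ler_wpM2l// normr_le_expR.
rewrite -ler_pdivrMl ?ltr0n ?fact_gt0// mulrC.
case: n => [|n]; first by rewrite expr0 divr1 -[leLHS]expR0 ler_expR.
by apply: le_trans (expR_ge1Dxn n (normr_ge0 x)); rewrite lerDr.
Qed.

(** * Moment recursion for the normal law *)

Section NormalMoments.
Variables (R : realType) (s : R).
Hypothesis s0 : s != 0.
Let P := normal_prob 0 s.
Let phi := normal_pdf 0 s.
Let leb := @lebesgue_measure R.

Let mphi : measurable_fun setT phi. Proof. exact: measurable_normal_pdf. Qed.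
Let phi0 x : 0 <= phi x. Proof. exact: normal_pdf_ge0. Qed.

(** Completing the square: the exponential weight moves the mean from 0 to t s^2. *)
Let expR_phi t x : expR (t * x) * phi x =
  expR (t ^+ 2 * s ^+ 2 / 2) * normal_pdf (t * s ^+ 2) s x.
Proof.
rewrite /phi !normal_pdfE// /normal_fun mulrCA [RHS]mulrCA; congr (_ * _).
rewrite -!expRD; congr expR; by rewrite -mulr_natr; field.
Qed.

Lemma integral_normal_expR t :
  (\int[P]_x (expR (t * x))%:E = (expR (t ^+ 2 * s ^+ 2 / 2))%:E)%E.
Proof.
have PE A : measurable A -> P A = (\int[leb]_(x in A) (phi x)%:E)%E by [].
rewrite (@ge0_integral_density _ (measurableTypeR R) R leb P phi mphi phi0 PE); last 2 first.
- by apply/measurable_EFinP; apply: measurableT_comp.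
- by move=> x; rewrite lee_fin expR_ge0.
under eq_integral do rewrite -EFinM expR_phi EFinM.
rewrite integralZl//; last exact: integrable_normal_pdf.
by rewrite integral_normal_pdf mule1.
Qed.

Lemma integrable_normal_expR t : P.-integrable setT (fun x => (expR (t * x))%:E).
Proof.
apply/integrableP; split.
  by apply/measurable_EFinP; apply: measurableT_comp.
under eq_integral do rewrite gee0_abs ?lee_fin ?expR_ge0//.
by rewrite integral_normal_expR ltry.
Qed.

Lemma integrable_normal_exprn n : P.-integrable setT (fun x => (x ^+ n)%:E).
Proof.
have I := integrableZl measurableT (n`!%:R)
  (integrableD measurableT (integrable_normal_expR 1) (integrable_normal_expR (-1))).
apply: le_integrable I => //.
  by apply/measurable_EFinP; exact: exprn_measurable.
move=> x _; rewrite /= lee_fin normrX mul1r mulN1r (le_trans (exprn_le_expR n x))//.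
exact: ler_norm.
Qed.

Let F n x := x ^+ n * phi x.
(* The derivative of [F n]; its integral vanishes, which is the moment recursion. *)
Let f n x := n%:R * (x ^+ n.-1 * phi x) - (s ^+ 2)^-1 * (x ^+ n.+1 * phi x).

Let is_derive_phi (x : R) : is_derive x 1 phi (- (s ^+ 2)^-1 * x * phi x).
Proof.
rewrite /phi normal_pdfE//.
pose g (y : R) := (- (s ^+ 2 *+ 2)^-1) * y ^+ 2.
have gE y : normal_fun 0 s y = expR (g y).
  by rewrite /normal_fun subr0 /g mulNr mulNr (mulrC (y ^+ 2)).
rewrite gE (_ : (fun x => _) = normal_peak s \*: (expR \o g)); last first.
  by apply/funext => y; rewrite gE.
have dg : is_derive x 1 g (- (s ^+ 2)^-1 * x).
  apply: is_derive_eq; rewrite /GRing.scale/= -(mulr_natr (s ^+ 2)).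
  by field.
have de := is_derive1_comp (is_derive_expR (g x)) dg.
by apply: is_derive_eq; rewrite /GRing.scale/=; ring.
Qed.

Let is_derive_F n (x : R) : is_derive x 1 (F n) (f n x).
Proof.
have dphi := is_derive_phi x.
have dX : is_derive x 1 (fun y : R => y ^+ n) (n%:R * x ^+ n.-1).
  have -> : (fun y : R => y ^+ n) = (id : R -> R) ^+ n.
    by rewrite exprfctE.
  by apply: is_derive_eq; rewrite /GRing.scale/= mulr1.
have dF := is_deriveM dX dphi.
apply: is_derive_eq dF _; rewrite /f /GRing.scale/=.
by rewrite (exprS x n); ring.
Qed.

(** The decay F n x = O(1/|x|), which removes the boundary terms of the integration by parts. The
    exponential majorant times the density is bounded, being a multiple of shifted densities. *)
Let F_le n : exists C, forall x, `|F n x| * `|x| <= C.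
Proof.
pose c := expR (1 ^+ 2 * s ^+ 2 / 2).
exists (n.+1`!%:R * (c * normal_peak s + c * normal_peak s)) => x.
have -> : `|F n x| * `|x| = `|x| ^+ n.+1 * phi x.
  by rewrite normrM (ger0_norm (phi0 x)) normrX [in RHS]exprSr mulrAC.
apply: (@le_trans _ _ (n.+1`!%:R * (expR x + expR (- x)) * phi x)).
  by rewrite ler_wpM2r// exprn_le_expR.
rewrite -mulrA ler_wpM2l// mulrDl lerD//.
  by rewrite -{1}[x]mul1r expR_phi ler_wpM2l ?expR_ge0// normal_pdf_ub.
rewrite -[- x]mulN1r expR_phi /c sqrrN ler_wpM2l ?expR_ge0//.
by rewrite normal_pdf_ub.
Qed.

Let cvg_F n : F n k%:R - F n (- k%:R) @[k --> \oo] --> (0 : R).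
Proof.
have [C HC] := F_le n.
apply/norm_cvg0P; apply: (@squeeze_cvgr _ _ _ _ (cst 0) (fun k => (C + C) / k%:R)).
- near=> k; rewrite normr_ge0/= ler_pdivlMr; last first.
    by rewrite ltr0n; near: k; exists 1%N.
  apply: (@le_trans _ _ ((`|F n k%:R| + `|F n (- k%:R)|) * k%:R)).
    by rewrite ler_wpM2r// ler_normB.
  rewrite mulrDl lerD//.
    by have := HC k%:R; rewrite normr_nat.
  by have := HC (- k%:R); rewrite normrN normr_nat.
- exact: cvg_cst.
- rewrite -[X in _ --> X](mulr0 (C + C)); apply: cvgM; first exact: cvg_cst.
  apply/gtr0_cvgV0; last exact: cvgr_idn.
  by near=> k; rewrite ltr0n; near: k; exists 1%N.
Unshelve. all: by end_near. Qed.

Let PE A : measurable A -> P A = (\int[leb]_(x in A) (phi x)%:E)%E.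
Proof. by []. Qed.

Let moment_density n :=
  @integrable_density _ (measurableTypeR R) R leb P phi mphi phi0 PE
    (fun x => x ^+ n) (integrable_normal_exprn n).

Let integrable_f n : leb.-integrable setT (fun x => (f n x)%:E).
Proof.
have I1 := integrableZl measurableT (n%:R) (moment_density n.-1).1.
have I2 := integrableZl measurableT ((s ^+ 2)^-1) (moment_density n.+1).1.
by have := integrableB measurableT I1 I2; apply: eq_integrable.
Qed.

(** Over [-k, k] the integral is the difference of the boundary values of [F n], which tends to 0;
    dominated convergence identifies the limit with the integral over the line. *)
Let integral_f n : (\int[leb]_x (f n x)%:E = 0)%E.
Proof.
have cphi : continuous (phi : R -> R) by exact: continuous_normal_pdf.
have cX k : continuous (fun x : R => x ^+ k * phi x).
  by move=> x; apply: cvgM; [exact: exprn_continuous | exact: cphi].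
have cf : continuous (f n).
  by move=> x; apply: cvgB; apply: cvgM; [exact: cvg_cst|exact: cX|exact: cvg_cst|exact: cX].
have FTC k : (0 < k)%N ->
    (\int[leb]_x (f n x * \1_`[- k%:R, k%:R] x)%:E = (F n k%:R - F n (- k%:R))%:E)%E.
  move=> k0; have k1 : - k%:R < k%:R :> R by rewrite gtrN// ltr0n.
  have -> : (\int[leb]_x (f n x * \1_`[- k%:R, k%:R] x)%:E =
      \int[leb]_(x in `[(- k%:R)%R, k%:R]) (f n x)%:E)%E.
    rewrite [RHS]integral_mkcond; apply: eq_integral => x _.
    by rewrite patchE indicE; case: ifP; rewrite ?mulr1 ?mulr0.
  have cF : continuous (F n : R -> R) by exact: cX.
  rewrite (@continuous_FTC2 _ (f n) (F n))//.
  - exact: continuous_subspaceT.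
  - split; [by move=> x _; case: (is_derive_F n x)| |].
      by apply: cvg_at_right_filter; exact: cF.
    by apply: cvg_at_left_filter; exact: cF.
  - by move=> x _; rewrite derive1E; apply: derive_val.
have mf : measurable_fun setT (f n) by exact: continuous_measurable_fun.
have [|||||_ _ L] := @dominated_convergence _ (measurableTypeR R) R leb setT measurableT
  (fun k x => (f n x * \1_`[- k%:R, k%:R] x)%:E) (fun x => (f n x)%:E)
  (fun x => `|f n x|%:E).
- by move=> k; apply/measurable_EFinP/measurable_funM.
- exact/measurable_EFinP.
- apply: aeW => x _; apply: cvg_EFin; first by near=> k.
  apply: cvg_near_cst.
  near=> k; rewrite /= indicE mem_set ?mulr1//= in_itv/= -ler_norml.
  by near: k; apply: nbhs_infty_ger.
- by have := integrable_abse (integrable_f n); apply: eq_integrable.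
- apply: aeW => x k _; rewrite lee_fin normrM indicE.
  by case: (_ \in _); rewrite ?normr1 ?normr0 ?mulr1 ?mulr0.
apply: (cvg_unique _ L) => //.
apply: (@cvg_trans _ ((F n k%:R - F n (- k%:R))%:E @[k --> \oo])); last first.
  by apply: cvg_EFin; [near=> k|exact: cvg_F].
apply: near_eq_cvg; near=> k; rewrite /= FTC//; near: k; exact: nbhs_infty_gt.
Unshelve. all: by end_near. Qed.

(** The vanishing integral of [f n], solved for the higher moment. At n = 0 the truncated
    predecessor is harmless since its coefficient is 0. *)
Lemma normal_moment n :
  (\int[P]_x (x ^+ n.+1)%:E = (n%:R * s ^+ 2)%:E * \int[P]_x (x ^+ n.-1)%:E)%E.
Proof.
have [I0 E0] := moment_density n.-1; have [I2 E2] := moment_density n.+1.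
rewrite E0 E2.
have : (\int[leb]_x (n%:R%:E * (x ^+ n.-1 * phi x)%:E -
    (s ^+ 2)^-1%:E * (x ^+ n.+1 * phi x)%:E) = 0)%E.
  by rewrite -[RHS](integral_f n); apply: eq_integral.
rewrite integralB//; [|exact: integrableZl|exact: integrableZl].
rewrite !integralZl//.
rewrite -(fineK (integrable_fin_num _ I0))// -(fineK (integrable_fin_num _ I2))//.
rewrite -!EFinM -EFinB => -[/eqP]; rewrite subr_eq0 => /eqP E; congr EFin.
by rewrite -mulrA mulrCA E mulrA divff ?mul1r// expf_neq0.
Qed.

End NormalMoments.

Lemma normr_sin_le (R : realType) (x : R) : `|sin x| <= `|x|.
Proof.
wlog x0 : x / 0 <= x => [hwlog|].
  have [/hwlog//|/ltW x0] := leP 0 x.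
  by rewrite -normrN -sinN -[leRHS]normrN hwlog// oppr_ge0.
have [c _] : exists2 c, c \in `[0, x] & sin x - sin 0 = cos c * (x - 0).
  apply: MVT_segment => //.
  by apply: continuous_subspaceT; exact: continuous_sin.
rewrite sin0 !subr0 => ->; rewrite normrM ler_piMl//; exact: cos_max.
Qed.

Lemma slope_cvg (R : realType) (f : R -> R) df (u : nat -> R) :
  is_derive (0 : R) 1 f df -> (forall k, u k != 0) -> u k @[k --> \oo] --> 0 ->
  (u k)^-1 * (f (u k) - f 0) @[k --> \oo] --> df.
Proof.
move=> dfP u0 cu; have dv := @derive_val _ _ _ _ _ _ _ dfP.
have /cvgr_dnbhsP/(_ u) : (fun h : R => h^-1 * (f h - f 0)) h @[h --> 0^'] --> df.
  rewrite -dv; have /= := @ex_derive _ _ _ _ _ _ _ dfP.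
  rewrite /derivable /derive => c; apply: cvg_trans c.
  apply: near_eq_cvg; near=> h; rewrite /= /GRing.scale/= mulr1 addr0.
  by [].
by apply.
Unshelve. all: by end_near. Qed.

Lemma borel_open (R : realType) (X : normedModType R) (U : set X) :
  open U -> measurable (U : set (borel X)).
Proof. by move=> oU; exact: sub_sigma_algebra. Qed.

Lemma borel_closed (R : realType) (X : normedModType R) (F : set X) :
  closed F -> measurable (F : set (borel X)).
Proof.
by move=> cF; rewrite -[F]setCK; apply: measurableC; apply: borel_open; exact: closed_openC.
Qed.

Lemma borel_continuous (R : realType) (X : normedModType R) (f : X -> R) :
  continuous f -> measurable_fun setT (f : borel X -> R).
Proof.
move=> cf; apply: (measurability _ (RGenOpens.measurableE R)).
move=> _ [_ [a [b ->] <-]]; rewrite setTI; apply: borel_open.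
by move/continuousP : cf; apply; exact: interval_open.
Qed.

(** * Moments and variance of a continuous functional *)

Section GaussianFunctional.
Variables (R : realType) (X : normedModType R) (mu : probability (borel X) R).
Hypothesis gauss_mu : centered_gaussian mu.

(** With v = 0 the same recursion describes the Dirac mass at 0, so the two cases of
    [centered_gaussian] are separated only in this proof. *)
Lemma gaussian_variance (l : {scalar X}) : continuous l ->
  exists2 v : R, 0 <= v &
    (forall t, mu.-integrable setT (fun x => (expR (t * l x))%:E)) /\
    (forall n, \int[mu]_x (l x ^+ n.+1)%:E =
               (n%:R * v)%:E * \int[mu]_x (l x ^+ n.-1)%:E)%E.
Proof.
move=> cl; have ml := borel_continuous cl.
have [s _ lawl] := gauss_mu cl.
pose P := pushforward mu (l : borel X -> measurableTypeR R).
have mexp t : measurable_fun setT (fun y : measurableTypeR R => (expR (t * y))%:E).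
  by apply/measurable_EFinP; apply: measurableT_comp => //; exact: measurable_funM.
have mX n : measurable_fun setT (fun y : measurableTypeR R => (y ^+ n)%:E).
  by apply/measurable_EFinP; exact: exprn_measurable.
exists (s ^+ 2); first exact: sqr_ge0.
(* The law enters the rest of the proof only through these three properties. *)
have [P' [PE Pexp Pmom]] : exists P' : probability (measurableTypeR R) R,
  [/\ forall B, measurable B -> mu (l @^-1` B) = P' B,
      forall t, P'.-integrable setT (fun y => (expR (t * y))%:E) &
      forall n, (\int[P']_y (y ^+ n.+1)%:E =
               (n%:R * s ^+ 2)%:E * \int[P']_y (y ^+ n.-1)%:E)%E].
  have [s0|s0] := eqVneq s 0; rewrite ?s0 ?eqxx ?(negbTE s0) in lawl.
    exists (dirac (0 : measurableTypeR R)); split => //.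
      move=> t; apply/integrableP; split => //.
      rewrite integral_dirac//; last exact: measurableT_comp.
      by rewrite diracT mul1e ltry.
    move=> n; rewrite !integral_dirac// s0.
    by rewrite !expr0n/= mulr0 mul0e mule0.
  exists (normal_prob 0 s); split => //.
    exact: integrable_normal_expR.
  exact: normal_moment.
have intE f : measurable_fun setT f -> (forall y, 0 <= f y)%E ->
    (\int[mu]_x f (l x) = \int[P']_y f y)%E.
  move=> mf f0.
  have := @ge0_integral_pushforward _ _ (borel X) (measurableTypeR R) R l ml mu setT f measurableT mf.
  rewrite preimage_setT => <-; last by move=> y _; exact: f0.
  by apply: eq_measure_integral => B mB _; exact: PE.
have Iexp t : mu.-integrable setT (fun x => (expR (t * l x))%:E).
  have /integrableP[_ fin] := Pexp t; apply/integrableP; split.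
    exact: measurableT_comp (mexp t) ml.
  rewrite (intE (fun y => `|(expR (t * y))%:E|%E))//.
  by apply: measurableT_comp => //; exact: mexp.
have IX n : mu.-integrable setT (fun x => (l x ^+ n)%:E).
  have := integrableZl measurableT (n`!%:R) (integrableD measurableT (Iexp 1) (Iexp (-1))).
  apply: le_integrable => //.
    exact: measurableT_comp (mX n) ml.
  move=> x _; rewrite /= lee_fin normrX mul1r mulN1r.
  by rewrite (le_trans (exprn_le_expR n (l x)))// ler_norm.
have intX n : (\int[mu]_x (l x ^+ n)%:E = \int[P']_y (y ^+ n)%:E)%E.
  have := @integral_pushforward _ _ (borel X) (measurableTypeR R) R l ml mu setT _ (mX n).
  rewrite preimage_setT => /(_ (IX n) measurableT) <-.
  by apply: eq_measure_integral => B mB _; exact: PE.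
by split=> // n; rewrite !intX.
Qed.

End GaussianFunctional.

Section CameronMartinVariance.
Variables (R : realType) (X H : completeNormedModType R).
Variables (mu : probability (borel X) R) (ip : {dot H for idfun}).
Variable iota : {linear H -> X}.
Hypothesis gauss_mu : centered_gaussian mu.
Hypothesis CM : cameron_martin mu ip iota.

Lemma represents_inj (l : {scalar X}) u v :
  represents ip iota l u -> represents ip iota l v -> u = v.
Proof.
move=> lu lv; apply/eqP; rewrite -subr_eq0; apply/negPn/negP => uv0.
have := neq0_dnorm_gt0 (s := ip) _ uv0; rewrite linearBl/=.
by rewrite lu lv subrr ltxx.
Qed.

Lemma ip_sqnorm (u : H) : ip u u = `|u| ^+ 2.
Proof. by have [[<-]] := CM. Qed.

Lemma gaussian_expR_integrable (l : {scalar X}) t : continuous l ->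
  mu.-integrable setT (fun x => (expR (t * l x))%:E).
Proof. by move=> cl; have [v _ [+ _]] := gaussian_variance gauss_mu cl. Qed.

Lemma gaussian_exprn_integrable (l : {scalar X}) n : continuous l ->
  mu.-integrable setT (fun x => (l x ^+ n)%:E).
Proof.
move=> cl; have Iexp t := gaussian_expR_integrable t cl.
have := integrableZl measurableT (n`!%:R) (integrableD measurableT (Iexp 1) (Iexp (-1))).
apply: le_integrable => //.
  apply/measurable_EFinP; apply: measurable_funX; exact: borel_continuous.
move=> x _; rewrite /= lee_fin normrX mul1r mulN1r.
by rewrite (le_trans (exprn_le_expR n (l x)))// ler_norm.
Qed.

Let represents_scale (l : {scalar X}) u t :
  represents ip iota l u -> represents ip iota (t \*: l) (t *: u).
Proof. by move=> lu h; rewrite linearZl_LR/= lu. Qed.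

Let cos_formula (l : {scalar X}) u t : continuous l -> represents ip iota l u ->
  \int[mu]_x cos (t * l x) = expR (- (t ^+ 2 * `|u| ^+ 2 / 2)).
Proof.
move=> cl lu; have [_ _ _ _ cmF] := CM.
have clt : continuous (t \*: l : X -> R).
  by move=> x; apply: cvgM; [exact: cvg_cst|exact: cl].
have [v [lv cosv _]] := cmF _ clt.
rewrite [LHS]cosv (represents_inj lv (represents_scale t lu)).
by rewrite normrZ exprMn real_normK ?num_real.
Qed.

Let integral1 : (\int[mu]_x (1 : R)%:E = 1)%E.
Proof. by rewrite (integral_cst mu measurableT) [X in (_ * X)%E](probability_setT mu) mul1e. Qed.

(** [cameron_martin] links l to the norm of u only through the characteristic functional; the
    variance is its second order term at 0. *)
Let gaussian_sqr_integral (l : {scalar X}) u : continuous l ->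
  represents ip iota l u -> (\int[mu]_x (l x ^+ 2)%:E = (`|u| ^+ 2)%:E)%E.
Proof.
move=> cl lu; have ml := borel_continuous cl.
(* The integral of [1 - cos (t l)] is known; divide by t^2 and let t tend to 0. *)
pose g k (x : borel X) : R := k.+1%:R ^+ 2 * (1 - cos (k.+1%:R^-1 * l x)).
(* The half-angle form of 1 - cos gives both the pointwise limit l^2 / 2 and, by |sin y| <= |y|,
   domination by this limit. *)
have gE k x : g k x = 2 * (k.+1%:R * sin (k.+1%:R^-1 * (l x / 2))) ^+ 2.
  rewrite /g (_ : k.+1%:R^-1 * l x = (k.+1%:R^-1 * (l x / 2)) *+ 2); last first.
    by rewrite -mulr_natr; field.
  by rewrite cos_mulr2n cos2sin2 -mulr_natr; ring.
have mcos k : measurable_fun setT (fun x : borel X => cos (k.+1%:R^-1 * l x)).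
  apply: measurableT_comp; first exact: continuous_measurable_fun (@continuous_cos R).
  exact: measurable_funM.
have mg k : measurable_fun setT (g k).
  by apply: measurable_funM => //; apply: measurable_funB.
have ci k : mu.-integrable setT (fun x => (cos (k.+1%:R^-1 * l x))%:E).
  apply: measurable_bounded_integrable => //; first by rewrite [ltLHS](probability_setT mu) ltry.
  exists 1; split; rewrite ?num_real// => r r1 x _.
  by apply: le_trans (cos_max _) _; exact: ltW.
have Eg k : (\int[mu]_x (g k x)%:E =
    (k.+1%:R ^+ 2 * (1 - expR (- (k.+1%:R^-1 ^+ 2 * `|u| ^+ 2 / 2))))%:E)%E.
  under eq_integral do rewrite EFinM.
  have I1 : mu.-integrable setT (EFin \o (cst 1 : borel X -> R)).
    by apply: finite_measure_integrable_cst.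
  rewrite integralZl//; last first.
    by have := integrableB measurableT I1 (ci k); apply: eq_integrable.
  rewrite -(cos_formula _ cl lu) [RHS]EFinM; congr *%E.
  rewrite EFinB.
  rewrite integralB_EFin//; last exact: ci.
  rewrite [X in (X - _)%E = _]integral1 /Rintegral fineK//.
  exact: integrable_fin_num (ci k).
have [|||||_ _ L] := @dominated_convergence _ (borel X) R mu setT measurableT
  (fun k x => (g k x)%:E) (fun x => (l x ^+ 2 / 2)%:E) (fun x => (l x ^+ 2 / 2)%:E).
- by move=> k; exact/measurable_EFinP.
- by apply/measurable_EFinP; apply: measurable_funM => //; exact: measurable_funX.
- apply: aeW => x _; apply: cvg_EFin; first by near=> k.
  rewrite [X in X @ _](_ : _ = (fun k => 2 * (k.+1%:R * sin (k.+1%:R^-1 * (l x / 2))) ^+ 2)); last first.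
    by apply/funext => k; rewrite /= gE.
  rewrite (_ : l x ^+ 2 / 2 = 2 * (l x / 2 * l x / 2)); last by field.
  apply: cvgM; first exact: cvg_cst.
  have dsin : is_derive (0 : R) 1 (fun t => sin (t * (l x / 2))) (l x / 2).
    have dm : is_derive (0 : R) 1 (fun t : R => t * (l x / 2)) (l x / 2).
      by apply: is_derive_eq; rewrite /GRing.scale/= mulr1 mulr0 add0r.
    apply: is_derive_eq (is_derive1_comp (is_derive_sin _) dm) _.
    by rewrite mul0r cos0 mul1r.
  have := slope_cvg dsin (fun k => _) (@cvg_harmonic R).
  rewrite mul0r sin0 => L.
  have {}L : k.+1%:R * sin (k.+1%:R^-1 * (l x / 2)) @[k --> \oo] --> l x / 2.
    apply: cvg_trans (L _) => [|k]; last by rewrite gt_eqF// harmonic_gt0.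
    by apply: near_eq_cvg; near=> k; rewrite /= subr0 invrK.
  by rewrite -mulrA; exact: cvgM.
- have := integrableZl measurableT (1 / 2) (gaussian_exprn_integrable 2 cl).
  apply: eq_integrable => // x _.
  by rewrite -EFinM; congr EFin; rewrite mulrC div1r.
- apply: aeW => x k _; rewrite lee_fin gE ger0_norm; last by rewrite mulr_ge0 ?sqr_ge0.
  have h : `|k.+1%:R * sin (k.+1%:R^-1 * (l x / 2))| <= `|l x / 2|.
    rewrite normrM gtr0_norm// -ler_pdivlMl// (le_trans (normr_sin_le _))//.
    by rewrite normrM gtr0_norm.
  have := ler_pM (normr_ge0 _) (normr_ge0 _) h h.
  rewrite -!expr2 !real_normK ?num_real//; lra.
have R0 : (k.+1%:R ^+ 2 * (1 - expR (- (k.+1%:R^-1 ^+ 2 * `|u| ^+ 2 / 2))))%:E @[k --> \oo]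
    --> (`|u| ^+ 2 / 2)%:E.
  apply: cvg_EFin; first by near=> k.
  pose c := `|u| ^+ 2 / 2.
  have dm : is_derive (0 : R) 1 (fun t : R => - c * t) (- c).
    by apply: is_derive_eq; rewrite /GRing.scale/= mulr1.
  have dexp : is_derive (0 : R) 1 (fun t => expR (- c * t)) (- c).
    apply: is_derive_eq (is_derive1_comp (is_derive_expR _) dm) _.
    by rewrite mulr0 expR0 mul1r.
  have c2 : k.+1%:R^-1 ^+ 2 @[k --> \oo] --> (0 : R).
    rewrite -[X in _ --> X](mulr0 0); under eq_fun do rewrite expr2.
    by apply: cvgM; exact: cvg_harmonic.
  have u0 k : k.+1%:R^-1 ^+ 2 != 0 :> R by rewrite expf_neq0// invr_neq0.
  have := slope_cvg dexp u0 c2.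
  rewrite mulr0 expR0 => /cvgN; rewrite opprK; apply: cvg_trans.
  apply: near_eq_cvg; near=> k; rewrite /= !fctE -mulrN opprB.
  by congr (_ * (_ - expR _)); [rewrite exprVn invrK|rewrite /c; field].
have E : (\int[mu]_x (l x ^+ 2 / 2)%:E = (`|u| ^+ 2 / 2)%:E)%E.
  apply: (cvg_unique _ L) => //; apply: cvg_trans R0.
  by apply: near_eq_cvg; near=> k; rewrite /= Eg.
have I2 := gaussian_exprn_integrable 2 cl.
move: E; under eq_integral do rewrite mulrC EFinM.
rewrite integralZl// -(fineK (integrable_fin_num _ I2))// -EFinM => -[E].
by congr EFin; lra.
Unshelve. all: by end_near. Qed.

Lemma gaussian_moment (l : {scalar X}) u n : continuous l ->
  represents ip iota l u ->
  \int[mu]_x (l x ^+ n.+1) = n%:R * `|u| ^+ 2 * \int[mu]_x (l x ^+ n.-1).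
Proof.
move=> cl lu; have [v _ [_ mom]] := gaussian_variance gauss_mu cl.
(* The recursion at n = 1 says that the second moment is v. *)
have vE : v = `|u| ^+ 2.
  have := mom 1; rewrite (gaussian_sqr_integral cl lu).
  under eq_integral do rewrite expr0.
  by rewrite integral1 mul1r mule1 => -[].
have I k := integrable_fin_num measurableT (gaussian_exprn_integrable k cl).
by apply: EFin_inj; rewrite EFinM !fineK// mom vE.
Qed.

End CameronMartinVariance.

Lemma Rintegral_lin d (T : measurableType d) (R : realType)
    (mu : {measure set T -> \bar R}) (a : R) (f g : T -> R) :
  mu.-integrable setT (fun x => (f x)%:E) -> mu.-integrable setT (fun x => (g x)%:E) ->
  \int[mu]_x (a * f x + g x) = a * \int[mu]_x f x + \int[mu]_x g x.
Proof.
move=> If Ig; rewrite RintegralD// ?RintegralZl//.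
by have := integrableZl measurableT a If; apply: eq_integrable.
Qed.

Lemma Rintegral_lin_sum d (T : measurableType d) (R : realType)
    (mu : {measure set T -> \bar R}) (J : Type) (r : seq J) (c : J -> R)
    (f : J -> T -> R) :
  (forall i, mu.-integrable setT (fun x => (f i x)%:E)) ->
  mu.-integrable setT (fun x => (\sum_(i <- r) c i * f i x)%:E) /\
  \int[mu]_x (\sum_(i <- r) c i * f i x) = \sum_(i <- r) c i * \int[mu]_x f i x.
Proof.
move=> If; elim: r => [|i r [IHi IHe]].
  split; first by under eq_fun do rewrite big_nil; exact: integrable0.
  by under eq_Rintegral do rewrite big_nil; rewrite big_nil Rintegral_cst// mul0r.
have Ii : mu.-integrable setT (fun x => (c i * f i x)%:E).
  by have := integrableZl measurableT (c i) (If i); apply: eq_integrable.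
split.
  have := integrableD measurableT Ii IHi; apply: eq_integrable => // x _.
  by rewrite big_cons.
under eq_Rintegral do rewrite big_cons.
by rewrite RintegralD// big_cons IHe RintegralZl//; exact: If.
Qed.

Lemma poly_ext (R : realFieldType) (p q : {poly R}) :
  (forall t, p.[t] = q.[t]) -> p = q.
Proof.
move=> pq; apply/eqP; rewrite -subr_eq0; apply/negPn/negP => pq0.
have := max_poly_roots pq0 (rs := [seq i%:R | i <- iota 0 (size (p - q))]).
rewrite size_map size_iota ltnn => h; suff: false by [].
apply: h; first by apply/allP => t _; rewrite /root hornerD hornerN pq subrr.
by rewrite map_inj_uniq ?iota_uniq// => i j /eqP; rewrite eqr_nat => /eqP.
Qed.

(** * Wick's formula for two functionals *)

Section Wick.
Variables (R : realType) (X H : completeNormedModType R).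
Variables (mu : probability (borel X) R) (ip : {dot H for idfun}).
Variable iota : {linear H -> X}.
Hypothesis gauss_mu : centered_gaussian mu.
Hypothesis CM : cameron_martin mu ip iota.
Variables (l m : {scalar X}) (u v : H).
Hypotheses (cl : continuous l) (cm : continuous m).
Hypotheses (lu : represents ip iota l u) (mv : represents ip iota m v).

Lemma ipC : ip u v = ip v u.
Proof. by rewrite hermC expr0 mul1r. Qed.

Let M a b := \int[mu]_x (l x ^+ a * m x ^+ b).

Lemma gaussian_monomial_integrable a b :
  mu.-integrable setT (fun x => (l x ^+ a * m x ^+ b)%:E).
Proof.
have := integrableD measurableT (gaussian_exprn_integrable gauss_mu (a * 2) cl)
  (gaussian_exprn_integrable gauss_mu (b * 2) cm).
apply: le_integrable => //.
  apply/measurable_EFinP; apply: measurable_funM; apply: measurable_funX;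
    exact: borel_continuous.
move=> x _; rewrite /= lee_fin !exprM normrM.
rewrite [leRHS]ger0_norm ?addr_ge0 ?sqr_ge0//.
rewrite -[l x ^+ a ^+ 2]real_normK ?num_real//.
rewrite -[m x ^+ b ^+ 2]real_normK ?num_real//.
have := sqr_ge0 (`|l x ^+ a| - `|m x ^+ b|).
have := normr_ge0 (l x ^+ a); have := normr_ge0 (m x ^+ b); nra.
Qed.

(* [P n] is the polynomial t |-> E (l + t m)^n and [q] is t |-> E (l + t m)^2; the
   moment recursion for [l + t m] links them, and the moments are read off the
   coefficients of [P n]. *)
Let P n := \poly_(k < n.+1) ('C(n, k)%:R * M (n - k) k).
Let q : {poly R} := (`|u| ^+ 2)%:P + (ip u v *+ 2) *: 'X + `|v| ^+ 2 *: 'X^2.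

Let represents_lin t : represents ip iota (l \+ t \*: m) (u + t *: v).
Proof. by move=> h; rewrite linearDl linearZl_LR/= lu mv. Qed.

Let PE n t : (P n).[t] = \int[mu]_x ((l x + t * m x) ^+ n).
Proof.
rewrite horner_poly.
have [_ E] := Rintegral_lin_sum (index_enum 'I_n.+1)
  (fun k => 'C(n, k)%:R * t ^+ k) (fun k => gaussian_monomial_integrable (n - k) k).
transitivity (\sum_(i < n.+1) 'C(n, i)%:R * t ^+ i * M (n - i) i).
  by apply: eq_bigr => i _; rewrite mulrAC.
rewrite -[LHS]E; apply: eq_Rintegral => x _; rewrite exprDn; apply: eq_bigr => i _.
by rewrite -mulr_natl exprMn; ring.
Qed.

Let q_recursion n : P n.+1 = n%:R *: (q * P n.-1).
Proof.
apply: poly_ext => t; rewrite hornerZ hornerM !PE.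
have clm : continuous (l \+ t \*: m : X -> R).
  by move=> x; apply: cvgD; [exact: cl|apply: cvgM; [exact: cvg_cst|exact: cm]].
have /= -> := gaussian_moment gauss_mu CM n clm (represents_lin t).
rewrite -mulrA; congr (_ * (_ * _)).
rewrite /q !hornerE -!(ip_sqnorm CM) linearDl/= !linearDr/= !linearZl_LR/=.
by rewrite !linearZr_LR/= -ipC /GRing.scale/=; ring.
Qed.

(** By the recursion [P n] is 0 for odd n and a constant multiple of q^(n/2) for even n; this is the
    differential equation of such a power, free of half-integer exponents. *)
Let deriv_q n : (P n)^`() * q = (n%:R / 2) *: (q^`() * P n).
Proof.
elim/ltn_ind: n => -[|n] IH.
  by rewrite /P poly_def big_ord_recl big_ord0 addr0 derivZ derivXn mulr0n scaler0 !mul0r scale0r.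
rewrite q_recursion; case: n IH => [|n] IH.
  by rewrite !scale0r deriv0 mul0r mulr0 scaler0.
rewrite /= derivZ derivM -!mul_polyC.
have -> : (n.+2%:R / 2)%:P = (n%:R / 2)%:P + 1 :> {poly R}.
  by rewrite -polyC1 -polyCD; congr _%:P; rewrite -addn2 natrD; field.
have := IH n (ltnW (ltnSn _)); rewrite -mul_polyC => IHn.
transitivity (n.+1%:R%:P * (q^`() * P n * q + q * ((P n)^`() * q))); first by ring.
by rewrite IHn; ring.
Qed.

Let coefP n k : (P n)`_k = 'C(n, k)%:R * M (n - k) k.
Proof.
rewrite coef_poly; case: ifP => // /negbT; rewrite -leqNgt => nk.
by rewrite bin_small// mul0r.
Qed.

(** The left side is the derivative at s = 1 of the expectation of (s l + t m)^(n+2), as a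
    polynomial in t. The right side comes from 2 q - X q' = 2 (|u|^2 + (u, v) X). *)
Let euler n : n.+2%:R *: P n.+2 - 'X * (P n.+2)^`() =
  (n.+2%:R * n.+1%:R) *: (((`|u| ^+ 2)%:P + ip u v *: 'X) * P n).
Proof.
rewrite q_recursion /= derivZ derivM -!mul_polyC.
have := deriv_q n; rewrite -mul_polyC => dq.
have dqE : q^`() = (ip u v *+ 2)%:P + (`|v| ^+ 2 *+ 2) *: 'X.
  by rewrite /q !derivD derivC !derivZ derivX derivXn -!mul_polyC !polyCMn /= expr1; ring.
transitivity (n.+2%:R%:P * (n.+1%:R%:P * (q * P n)) -
  'X * (n.+1%:R%:P * (q^`() * P n + (P n)^`() * q))); first by ring.
have n2 : n.+2%:R%:P = 2 * ((n%:R / 2)%:P + 1) :> {poly R}.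
  have -> : n.+2%:R = 2%:R * (n%:R / 2 + 1) :> R by rewrite -addn2 natrD; field.
  by rewrite polyCM polyC_natr; congr (_ * _); rewrite polyCD polyC1.
rewrite dq dqE polyCM n2 /q -!mul_polyC !polyCMn; ring.
Qed.

(** Compare the coefficients of t^b in [euler] with n + 2 = a + 1 + b. The case a = b = 0, below the
    range of [euler], is the vanishing of the mean. *)
Lemma wick a b : M a.+1 b =
  a%:R * `|u| ^+ 2 * M a.-1 b + b%:R * ip u v * M a b.-1.
Proof.
have [/eqP|] := posnP (a + b).
  rewrite addn_eq0 => /andP[/eqP -> /eqP ->]; rewrite !mul0r addr0.
  have := congr1 (fun p : {poly R} => p`_0) (q_recursion 0).
  by rewrite coefP scale0r coef0 bin0 mul1r.
case En : (a + b)%N => [//|n] _.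
have := congr1 (fun p : {poly R} => p`_b) (euler n).
have -> : ((n.+2%:R *: P n.+2 - 'X * (P n.+2)^`())`_b = (a.+1%:R * (P n.+2)`_b)).
  rewrite coefB coefZ coefXM coef_deriv.
  have -> : n.+2%:R = a.+1%:R + b%:R :> R by rewrite -natrD addSn En.
  by case: (b) => [|c] /=; rewrite ?subr0 ?addr0// -mulr_natl; ring.
have -> : ((n.+2%:R * n.+1%:R) *: (((`|u| ^+ 2)%:P + ip u v *: 'X) * P n))`_b =
    n.+2%:R * n.+1%:R * (`|u| ^+ 2 * (P n)`_b + ip u v * (if b == 0 then 0 else (P n)`_b.-1)).
  rewrite coefZ; congr (_ * _); rewrite mulrDl coefD coefCM; congr (_ + _).
  by rewrite -scalerAl coefZ coefXM.
rewrite !coefP.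
have nb1 : (n.+2 - b = a.+1)%N by rewrite -addn1 -En; lia.
(* All binomial coefficients are expressed through 'C(n+1, b), which is nonzero and is cancelled at
   the end. *)
have b1 : n.+1%:R * 'C(n, b)%:R = a%:R * 'C(n.+1, b)%:R :> R.
  by rewrite -!natrM (mul_bin_down n.+1) -En addnK.
have b2 : a.+1%:R * 'C(n.+2, b)%:R = n.+2%:R * 'C(n.+1, b)%:R :> R.
  by rewrite -!natrM -nb1 -mul_bin_down.
have b3 : (0 < b)%N -> n.+1%:R * 'C(n, b.-1)%:R = b%:R * 'C(n.+1, b)%:R :> R.
  by move=> b0; rewrite -!natrM (mul_bin_diag n.+1 b.-1) prednK.
have C0 : n.+2%:R * 'C(n.+1, b)%:R != 0 :> R.
  by rewrite -natrM pnatr_eq0 muln_eq0/= -lt0n bin_gt0 -En leq_addl.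
rewrite nb1 mulrA b2 => E; apply: (mulfI C0); rewrite E -mulrA -[RHS]mulrA; congr (_ * _).
transitivity (`|u| ^+ 2 * (a%:R * 'C(n.+1, b)%:R) * M a.-1 b +
   ip u v * (b%:R * 'C(n.+1, b)%:R) * M a b.-1); last by ring.
rewrite mulrDr; congr (_ + _).
  transitivity (`|u| ^+ 2 * (n.+1%:R * 'C(n, b)%:R) * M (n - b) b); first by ring.
  rewrite b1; case: a En {nb1 b1 b2 b3 E C0} => [|a] En; first by rewrite !(mul0r, mulr0).
  by have -> : (n - b = a)%N by lia.
case: b En nb1 b1 b2 b3 {E C0} => [|b] En nb1 b1 b2 b3.
  by rewrite eqxx !(mul0r, mulr0).
rewrite /= -b3//= (_ : (n - b = a)%N); last by lia.
by ring.
Qed.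

End Wick.

(** * Hermite polynomials *)

Lemma poly_linear_ext (R : comNzRingType) (f g : {poly R} -> R) :
  (forall a p q, f (a *: p + q) = a * f p + f q) ->
  (forall a p q, g (a *: p + q) = a * g p + g q) ->
  (forall n, f 'X^n = g 'X^n) -> f =1 g.
Proof.
move=> flin glin fg p; rewrite -[p]coefK poly_def.
elim/big_rec : _ => [|i q _ IH]; last by rewrite flin glin fg IH.
have f0 := flin 0 0 0; have g0 := glin 0 0 0.
rewrite scale0r addr0 mul0r add0r in f0; rewrite scale0r addr0 mul0r add0r in g0.
have := flin (-1) 0 0; have := glin (-1) 0 0.
by rewrite scaler0 addr0 !mulN1r !addNr => -> ->.
Qed.

(** Hermite polynomials of variance s, that is s^(n/2) H_n(t / sqrt s) for s > 0, built by the
    raising operator X - s d/dX. The recursion needs no square root and covers s = 0, where it gives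
    X^n. *)
Fixpoint hpoly (R : comNzRingType) (s : R) (n : nat) : {poly R} :=
  if n is k.+1 then 'X * hpoly s k - s *: (hpoly s k)^`() else 1.

Section HermitePolynomials.
Variable R : realType.
Implicit Types (s t c : R) (n : nat).

Lemma deriv_hpoly s n : (hpoly s n)^`() = n%:R *: hpoly s n.-1.
Proof.
elim: n => [|n IH]; first by rewrite /= -polyC1 derivC scale0r.
rewrite [hpoly s n.+1]/= derivB derivM derivX mul1r derivZ IH derivZ.
rewrite [n.+1.-1]/= -natr1 scalerDl scale1r.
case: n IH => [|n] IH.
  by rewrite !(scale0r, mulr0, deriv0, scaler0, addr0, subr0, add0r).
by rewrite /= -!mul_polyC; ring.
Qed.

Lemma hpolyS s n : hpoly s n.+1 = 'X * hpoly s n - (n%:R * s) *: hpoly s n.-1.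
Proof. by rewrite /= deriv_hpoly scalerA (mulrC s). Qed.

Lemma hpoly_homogeneous c n t : (hpoly (c ^+ 2) n).[c * t] = c ^+ n * (hpoly 1 n).[t].
Proof.
elim/ltn_ind: n => -[|n] IH; first by rewrite !hornerC expr0 mulr1.
rewrite !hpolyS !(hornerD, hornerN, hornerZ, hornerM, hornerX) IH//; case: n IH => [|n] IH.
  by rewrite !mul0r; ring.
by rewrite [n.+1.-1]/= (IH n)// (exprS c n.+1) (exprS c n); ring.
Qed.

Lemma hermite_hpoly n t : hermite n t = (hpoly 1 n).[t].
Proof.
pose G (s : R) := expR (- (s ^+ 2 / 2)).
have dG (s : R) : is_derive s 1 G (- s * G s).
  have dg : is_derive s 1 (fun y : R => - 2^-1 * y ^+ 2) (- s).
    have -> : (fun y : R => - 2^-1 * y ^+ 2) = - 2^-1 \*: ((id : R -> R) ^+ 2).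
      by rewrite exprfctE.
    by apply: is_derive_eq; rewrite /GRing.scale/=; field.
  have -> : G = expR \o (fun y : R => - 2^-1 * y ^+ 2).
    by apply/funext => y; rewrite /G /=; congr expR; field.
  apply: is_derive_eq (is_derive1_comp (is_derive_expR _) dg) _.
  by rewrite mulrC /=; congr (_ * expR _); field.
have E : derive1n n G = (fun s => (-1) ^+ n * (hpoly 1 n).[s] * G s).
  elim: n => [|n IH]; first by apply/funext => s; rewrite expr0 hornerC !mul1r.
  rewrite derive1nS IH; apply/funext => s; rewrite derive1E.
  have dM := is_deriveM (is_deriveZ ((-1) ^+ n) (is_derive_poly (hpoly 1 n) s)) (dG s).
  rewrite (@derive_val _ _ _ _ _ _ _ dM) /GRing.scale/=.
  by rewrite !(hornerD, hornerN, hornerZ, hornerM, hornerX) exprS /GRing.scale/=; ring.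
have s2 : (-1) ^+ n * (-1) ^+ n = 1 :> R.
  by rewrite -exprD addnn -mul2n exprM sqrrN !expr1n.
have G2 : expR (t ^+ 2 / 2) * G t = 1 by rewrite /G -expRD addrN expR0.
rewrite /hermite -/G E.
transitivity ((-1) ^+ n * (-1) ^+ n * (expR (t ^+ 2 / 2) * G t) * (hpoly 1 n).[t]); first by ring.
by rewrite s2 G2 !mul1r.
Qed.

End HermitePolynomials.

Section HermiteOrthogonality.
Variables (R : realType) (X H : completeNormedModType R).
Variables (mu : probability (borel X) R) (ip : {dot H for idfun}).
Variable iota : {linear H -> X}.
Hypothesis gauss_mu : centered_gaussian mu.
Hypothesis CM : cameron_martin mu ip iota.

Lemma gaussian_poly_integrable (l m : {scalar X}) (p r : {poly R}) :
  continuous l -> continuous m ->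
  mu.-integrable setT (fun x => (p.[l x] * r.[m x])%:E).
Proof.
move=> cl cm.
have I i j := gaussian_monomial_integrable gauss_mu cl cm i j.
have J i : mu.-integrable setT (fun x => (l x ^+ i * r.[m x])%:E).
  have [+ _] := Rintegral_lin_sum (index_enum 'I_(size r)) (fun j => r`_j) (I i).
  apply: eq_integrable => // x _; congr EFin.
  by rewrite (horner_coef r) mulr_sumr; apply: eq_bigr => j _; ring.
have [+ _] := Rintegral_lin_sum (index_enum 'I_(size p)) (fun i => p`_i) J.
apply: eq_integrable => // x _; congr EFin.
by rewrite (horner_coef p) mulr_suml; apply: eq_bigr => j _; ring.
Qed.

(** Both sides are bilinear in p and r, so this is [wick] on monomials: Gaussian integration by
    parts. *)
Lemma wick_poly (l m : {scalar X}) u v (p r : {poly R}) :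
  continuous l -> continuous m ->
  represents ip iota l u -> represents ip iota m v ->
  \int[mu]_x (('X * p).[l x] * r.[m x]) =
  `|u| ^+ 2 * \int[mu]_x (p^`().[l x] * r.[m x]) +
  ip u v * \int[mu]_x (p.[l x] * r^`().[m x]).
Proof.
move=> cl cm lu mv.
pose B p r := \int[mu]_x (p.[l x] * r.[m x]).
have I p' r' := gaussian_poly_integrable p' r' cl cm.
have Bl r' a p1 p2 : B (a *: p1 + p2) r' = a * B p1 r' + B p2 r'.
  rewrite /B -(Rintegral_lin a (I p1 r') (I p2 r')); apply: eq_Rintegral => x _.
  by rewrite !(hornerD, hornerZ); ring.
have Br p' a r1 r2 : B p' (a *: r1 + r2) = a * B p' r1 + B p' r2.
  rewrite /B -(Rintegral_lin a (I p' r1) (I p' r2)); apply: eq_Rintegral => x _.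
  by rewrite !(hornerD, hornerZ); ring.
rewrite -/(B _ _) -/(B p^`() r) -/(B p r^`()); move: p.
apply: poly_linear_ext => [a p q|a p q|n].
- by rewrite mulrDr -scalerAr Bl.
- by rewrite derivD derivZ !Bl; ring.
move: r; apply: poly_linear_ext => [a p q|a p q|k].
- by rewrite Br.
- by rewrite derivD derivZ !Br; ring.
have dX j : ('X^j)^`() = j%:R *: 'X^(j.-1) + 0 :> {poly R}.
  by rewrite derivXn addr0 scaler_nat.
rewrite -exprS !dX.
have B0l r' : B 0 r' = 0.
  by rewrite /B; under eq_Rintegral do rewrite horner0 mul0r; rewrite Rintegral_cst ?mul0r.
have B0r r' : B r' 0 = 0.
  by rewrite /B; under eq_Rintegral do rewrite horner0 mulr0; rewrite Rintegral_cst ?mul0r.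
rewrite Bl Br B0l B0r !addr0.
have BX a b : B 'X^a 'X^b = \int[mu]_x (l x ^+ a * m x ^+ b).
  by apply: eq_Rintegral => x _; rewrite !hornerXn.
rewrite !BX (wick gauss_mu CM cl cm lu mv); ring.
Qed.

(** The term - s p' in the raising operator cancels the |u|^2 term of the integration by parts. What
    is left differentiates the other Hermite polynomial, so both degrees drop by one with a factor k
    (u, v). *)
Lemma hpoly_orthogonal (l m : {scalar X}) u v n k :
  continuous l -> continuous m ->
  represents ip iota l u -> represents ip iota m v ->
  \int[mu]_x ((hpoly (`|u| ^+ 2) n).[l x] * (hpoly (`|v| ^+ 2) k).[m x]) =
  (n == k)%:R * (n`!%:R * ip u v ^+ n).
Proof.
move=> cl cm lu mv.
have step (l1 m1 : {scalar X}) u1 v1 n1 k1 : continuous l1 -> continuous m1 ->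
    represents ip iota l1 u1 -> represents ip iota m1 v1 ->
  \int[mu]_x ((hpoly (`|u1| ^+ 2) n1.+1).[l1 x] * (hpoly (`|v1| ^+ 2) k1).[m1 x]) =
  k1%:R * ip u1 v1 * \int[mu]_x ((hpoly (`|u1| ^+ 2) n1).[l1 x] * (hpoly (`|v1| ^+ 2) k1.-1).[m1 x]).
  move=> cl1 cm1 lu1 mv1.
  pose B p r := \int[mu]_x (p.[l1 x] * r.[m1 x]).
  have I p' r' := gaussian_poly_integrable p' r' cl1 cm1.
  have := wick_poly (hpoly (`|u1| ^+ 2) n1) (hpoly (`|v1| ^+ 2) k1) cl1 cm1 lu1 mv1.
  rewrite [X in _ = _ + _ * X](_ : _ = k1%:R * B (hpoly (`|u1| ^+ 2) n1) (hpoly (`|v1| ^+ 2) k1.-1)); last first.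
    rewrite /B -RintegralZl//; last exact: I.
    by apply: eq_Rintegral => x _; rewrite deriv_hpoly hornerZ; ring.
  pose p := hpoly (`|u1| ^+ 2) n1; pose r := hpoly (`|v1| ^+ 2) k1.
  move=> W; transitivity (\int[mu]_x (- `|u1| ^+ 2 * (p^`().[l1 x] * r.[m1 x]) +
      ('X * p).[l1 x] * r.[m1 x])).
    by apply: eq_Rintegral => x _; rewrite /= hornerD hornerN hornerZ; ring.
  by rewrite (Rintegral_lin _ (I _ _) (I _ _)) W /B; ring.
have one0 (l1 m1 : {scalar X}) u1 v1 k1 : continuous l1 -> continuous m1 ->
    represents ip iota l1 u1 -> represents ip iota m1 v1 -> 
  \int[mu]_x ((hpoly (`|u1| ^+ 2) 0).[l1 x] * (hpoly (`|v1| ^+ 2) k1).[m1 x]) = (k1 == 0)%:R.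
  move=> cl1 cm1 lu1 mv1; case: k1 => [|k1].
    under eq_Rintegral do rewrite !hornerC mulr1.
    by rewrite Rintegral_cst// mul1r [X in fine X](probability_setT mu).
  (* With the functionals exchanged the positive degree comes first, and the factor of the reduction
     is the other degree, 0. *)
  have := step m1 l1 v1 u1 k1 0 cm1 cl1 mv1 lu1; rewrite !mul0r => h.
  rewrite -[RHS]h.
  by apply: eq_Rintegral => x _; rewrite mulrC.
elim: n k => [|n IH] k.
  by rewrite (one0 _ _ _ _ _ cl cm lu mv) eq_sym fact0 expr0 !mulr1.
rewrite (step _ _ _ _ _ _ cl cm lu mv) IH; case: k => [|k]; first by rewrite !mul0r.
rewrite eqSS factS natrM exprS /=; case: eqP => [->|_]; last by rewrite !(mul0r, mulr0).
by ring.
Qed.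

End HermiteOrthogonality.

(** * Semi-inner products and square integrable functions *)

(* Forms and square integrable functions are predicates on function types rather
   than types of their own, hence the relativization to a subspace [D]. *)
Record semi_inner (R : realType) (V : lmodType R) (D : set V) (B : V -> V -> R) : Prop :=
  SemiInner {
    semi_space0 : D 0;
    semi_space_lin : forall a u v, D u -> D v -> D (a *: u + v);
    semi_form_lin : forall a u v w, D u -> D v -> D w ->
      B (a *: u + v) w = a * B u w + B v w;
    semi_formC : forall u v, D u -> D v -> B u v = B v u;
    semi_form_ge0 : forall u, D u -> 0 <= B u u }.

Section SemiInnerProduct.
Variables (R : realType) (V : lmodType R) (D : set V) (B : V -> V -> R).
Hypothesis SI : semi_inner D B.
Let D0 := semi_space0 SI.
Let Dlin := semi_space_lin SI.
Let Blin := semi_form_lin SI.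
Let Bsym := semi_formC SI.
Let Bpos := semi_form_ge0 SI.

Definition semi_norm (u : V) : R := Num.sqrt (B u u).
Local Notation N := semi_norm.

Lemma semi_subspaceB u v : D u -> D v -> D (u - v).
Proof. by move=> Du Dv; rewrite addrC -scaleN1r; exact: Dlin. Qed.

Lemma semi_subspaceZ a u : D u -> D (a *: u).
Proof. by move=> Du; rewrite -[_ *: _]addr0; exact: Dlin. Qed.

Lemma semi_subspaceD u v : D u -> D v -> D (u + v).
Proof. by move=> Du Dv; rewrite -[u]scale1r; exact: Dlin. Qed.

Lemma semi_form0 u : D u -> B 0 u = 0.
Proof. by move=> Du; have := Blin (-1) D0 D0 Du; rewrite scaleN1r addNr mulN1r addNr. Qed.

Lemma semi_formZ a u v : D u -> D v -> B (a *: u) v = a * B u v.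
Proof. by move=> Du Dv; have := Blin a Du D0 Dv; rewrite semi_form0// !addr0. Qed.

Lemma semi_formD u v w : D u -> D v -> D w -> B (u + v) w = B u w + B v w.
Proof. by move=> Du Dv Dw; have := Blin 1 Du Dv Dw; rewrite scale1r mul1r. Qed.

Lemma semi_form_sum (J : Type) (r : seq J) (f : J -> V) (v : V) :
  (forall i, D (f i)) -> D v ->
  D (\sum_(i <- r) f i) /\ B (\sum_(i <- r) f i) v = \sum_(i <- r) B (f i) v.
Proof.
move=> Df Dv; elim: r => [|i r [IHD IHB]].
  by rewrite !big_nil; split=> //; exact: semi_form0.
by rewrite !big_cons; split; [exact: semi_subspaceD|rewrite semi_formD// IHB].
Qed.

Lemma semi_sqr_lin a u v : D u -> D v ->
  B (a *: u + v) (a *: u + v) = a ^+ 2 * B u u + 2 * a * B u v + B v v.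
Proof.
move=> Du Dv; have Dw := Dlin a Du Dv.
rewrite Blin// (Bsym Du Dw) (Bsym Dv Dw) !Blin// (Bsym Dv Du); ring.
Qed.

Lemma semi_cauchy_schwarz u v : D u -> D v -> (B u v) ^+ 2 <= B u u * B v v.
Proof.
move=> Du Dv; have [v0|v0] := eqVneq (B v v) 0.
  (* If B v v = 0, the square of u + t v is affine in t and nonnegative, so its slope vanishes;
     otherwise the t chosen below would give it the value -1. *)
  have P t : 0 <= B u u + 2 * t * B u v.
    have := Bpos (Dlin t Dv Du); rewrite semi_sqr_lin// v0 (Bsym Dv Du); lra.
  rewrite v0 mulr0; have [->|b0] := eqVneq (B u v) 0; first by rewrite expr0n.
  have := P (- (B u u + 1) / (2 * B u v)).
  have -> : 2 * (- (B u u + 1) / (2 * B u v)) * B u v = - (B u u + 1) by field.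
  lra.
have vp : 0 < B v v by rewrite lt_def v0 Bpos.
have := Bpos (Dlin (- B u v / B v v) Dv Du); rewrite semi_sqr_lin// (Bsym Dv Du).
have -> : (- B u v / B v v) ^+ 2 * B v v + 2 * (- B u v / B v v) * B u v + B u u
  = B u u - (B u v) ^+ 2 / B v v by field.
by rewrite subr_ge0 ler_pdivrMr.
Qed.

Lemma semi_norm_ge0 u : 0 <= N u. Proof. exact: sqrtr_ge0. Qed.

Lemma sqr_semi_norm u : D u -> N u ^+ 2 = B u u.
Proof. by move=> Du; rewrite sqr_sqrtr ?Bpos. Qed.

Lemma normr_semi_form u v : D u -> D v -> `|B u v| <= N u * N v.
Proof.
move=> Du Dv; rewrite -(@ler_pXn2r _ 2)// ?nnegrE ?mulr_ge0 ?semi_norm_ge0//.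
by rewrite real_normK ?num_real// exprMn !sqr_semi_norm// semi_cauchy_schwarz.
Qed.

Lemma semi_norm0 : N 0 = 0. Proof. by rewrite /N semi_form0// sqrtr0. Qed.

Lemma semi_normZ a u : D u -> N (a *: u) = `|a| * N u.
Proof.
move=> Du; rewrite /N semi_formZ//; last exact: semi_subspaceZ.
rewrite Bsym//; last exact: semi_subspaceZ.
by rewrite semi_formZ// mulrA -expr2 sqrtrM ?sqr_ge0// sqrtr_sqr.
Qed.

Lemma ler_semi_normD u v : D u -> D v -> N (u + v) <= N u + N v.
Proof.
move=> Du Dv; rewrite -(@ler_pXn2r _ 2)// ?nnegrE ?addr_ge0 ?semi_norm_ge0//.
rewrite sqr_semi_norm; last exact: semi_subspaceD.
have := semi_sqr_lin 1 Du Dv; rewrite scale1r => ->.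
rewrite sqrrD !sqr_semi_norm// expr1n !(mul1r, mulr1) -[_ *+ 2]mulr_natl.
have := normr_semi_form Du Dv; have := ler_norm (B u v); lra.
Qed.

Lemma semi_normBC u v : D u -> D v -> N (u - v) = N (v - u).
Proof.
move=> Du Dv; have -> : u - v = (-1) *: (v - u) by rewrite scaleN1r opprB.
by rewrite semi_normZ ?normrN1 ?mul1r//; exact: semi_subspaceB.
Qed.

Lemma ler_semi_normB u v w : D u -> D v -> D w -> N (u - w) <= N (u - v) + N (v - w).
Proof.
move=> Du Dv Dw; have -> : u - w = (u - v) + (v - w) by rewrite addrA subrK.
by apply: ler_semi_normD; exact: semi_subspaceB.
Qed.

Lemma ler_semi_dist u v : D u -> D v -> N u - N v <= N (u - v).
Proof.
move=> Du Dv; rewrite lerBlDr -[u in N u](subrK v).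
by apply: ler_semi_normD => //; exact: semi_subspaceB.
Qed.

Lemma semi_sqr_sum_orthogonal (n : nat) (f : 'I_n -> V) : (forall i, D (f i)) ->
  (forall i j, i != j -> B (f i) (f j) = 0) ->
  B (\sum_i f i) (\sum_i f i) = \sum_i B (f i) (f i).
Proof.
move=> Df orth.
have [Ds _] := semi_form_sum (index_enum 'I_n) Df D0.
have [_ ->] := semi_form_sum (index_enum 'I_n) Df Ds.
apply: eq_bigr => i _; rewrite Bsym//.
have [_ ->] := semi_form_sum (index_enum 'I_n) Df (Df i).
by rewrite (bigD1 i)//= big1 ?addr0// => j ji; exact: orth.
Qed.

Definition semi_cauchy (u : nat -> V) := forall eps, 0 < eps ->
  exists M, forall m n, (M <= m)%N -> (M <= n)%N -> N (u m - u n) < eps.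

Lemma semi_cvg_cauchy (u : nat -> V) v : (forall n, D (u n)) -> D v ->
  N (u n - v) @[n --> \oo] --> 0 -> semi_cauchy u.
Proof.
move=> Du Dv uv e e0; have e2 : 0 < e / 2 by rewrite divr_gt0.
have [M _ HM] := cvgr0_norm_lt _ uv _ e2.
exists M => m n Mm Mn; apply: le_lt_trans (ler_semi_normB (Du m) Dv (Du n)) _.
rewrite (semi_normBC Dv (Du n)) (splitr e); apply: ltrD.
  by have := HM m Mm; rewrite /= ger0_norm// semi_norm_ge0.
by have := HM n Mn; rewrite /= ger0_norm// semi_norm_ge0.
Qed.

Hypothesis complete : forall u : nat -> V, (forall n, D (u n)) -> semi_cauchy u ->
  exists2 v, D v & N (u n - v) @[n --> \oo] --> 0.

(* The minimizing sequence of the distance to [S] is Cauchy by the parallelogram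
   identity, and its limit [w] makes [v - w] orthogonal to [S]. *)
Lemma semi_dense (S : set V) : S 0 -> (forall a u v, S u -> S v -> S (a *: u + v)) ->
  S `<=` D ->
  (forall v, D v -> (forall s, S s -> B v s = 0) -> B v v = 0) ->
  forall v, D v -> forall eps, 0 < eps -> exists2 s, S s & N (v - s) < eps.
Proof.
move=> S0 Slin SD orth v Dv eps eps0.
pose dist := [set B (v - s) (v - s) | s in S].
pose d := inf dist.
have dist0 : dist !=set0 by exists (B (v - 0) (v - 0)), 0.
have hlb : lbound dist 0 by move=> _ [s Ss <-]; apply: Bpos; exact: semi_subspaceB (SD _ Ss).
have dP s : S s -> d <= B (v - s) (v - s).
  by move=> Ss; apply: ge_inf; [exists 0 | exists s].
have /choice[s sP] : forall n, exists s, S s /\ B (v - s) (v - s) < d + n.+1%:R^-1.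
  move=> n; have [|_ [s Ss <-] lt] := @inf_adherent _ dist n.+1%:R^-1 _ (conj dist0 (ex_intro _ _ hlb)).
    by rewrite invr_gt0.
  by exists s.
have Dvs n : D (v - s n) by apply: semi_subspaceB => //; exact: SD (sP n).1.
have para m n : B (s m - s n) (s m - s n) <= 2 * m.+1%:R^-1 + 2 * n.+1%:R^-1.
  have Smid : S (2^-1 *: (s m + s n)).
    rewrite -[X in S X]addr0; apply: (Slin) => //; rewrite -[s m]scale1r.
    by apply: Slin; [exact: (sP m).1|exact: (sP n).1].
  have := dP _ Smid.
  have -> : v - 2^-1 *: (s m + s n) = 2^-1 *: ((v - s m) + (v - s n)).
    by rewrite addrACA -opprD [RHS]scalerDr scalerN -mulr2n -[v *+ 2]scaler_nat scalerA mulVf ?scale1r.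
  have -> : s m - s n = (-1) *: (v - s m) + (v - s n).
    by rewrite scaleN1r opprB addrA subrK.
  rewrite semi_sqr_lin// !semi_formZ; [|exact: semi_subspaceD|by apply: semi_subspaceZ; exact: semi_subspaceD].
  rewrite (Bsym (u := v - s m + (v - s n))); [|exact: semi_subspaceD|by apply: semi_subspaceZ; exact: semi_subspaceD].
  rewrite semi_formZ; [|exact: semi_subspaceD|exact: semi_subspaceD].
  have := semi_sqr_lin 1 (Dvs m) (Dvs n); rewrite scale1r => ->.
  have := (sP m).2; have := (sP n).2; rewrite !(expr1n, sqrrN, mulr1, mulrN1, mul1r).
  set x := B _ _; set y := B _ _; set z := B _ _; set hn := n.+1%:R^-1; set hm := m.+1%:R^-1; lra.
have cs : semi_cauchy s.
  move=> e e0.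
  have [M MP] : exists M : nat, M.+1%:R^-1 < e ^+ 2 / 4 :> R.
    have e4 : 0 < e ^+ 2 / 4 by rewrite divr_gt0// exprn_gt0.
    have [M _ HM] := cvgr0_norm_lt _ (@cvg_harmonic R) _ e4.
    by exists M; have := HM M (leqnn M); rewrite /= ger0_norm.
  exists M => m n Mm Mn; rewrite -(@ltr_pXn2r _ 2)// ?nnegrE ?semi_norm_ge0 ?(ltW e0)//.
  rewrite sqr_semi_norm; last by apply: semi_subspaceB; exact: SD (sP _).1.
  have hm : m.+1%:R^-1 <= M.+1%:R^-1 :> R by rewrite lef_pV2 ?posrE// ler_nat.
  have hn : n.+1%:R^-1 <= M.+1%:R^-1 :> R by rewrite lef_pV2 ?posrE// ler_nat.
  move: MP hm hn (para m n); set z := B _ _; set e2 := e ^+ 2.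
  set a := M.+1%:R^-1; set b := m.+1%:R^-1; set c := n.+1%:R^-1; lra.
have [w Dw sw] := complete (fun n => SD _ (sP n).1) cs.
have Dvw : D (v - w) by exact: semi_subspaceB.
have cvgN : N (v - s n) @[n --> \oo] --> N (v - w).
  apply/cvgrPdist_le => e e0; have [M _ HM] := cvgr0_norm_lt _ sw _ e0.
  exists M => // n Mn /=; have := HM n Mn; rewrite /= ger0_norm ?semi_norm_ge0// => lt.
  have Dsn := SD _ (sP n).1.
  rewrite (le_trans _ (ltW lt))// ler_norml; apply/andP; split.
    rewrite lerNl opprB (le_trans (ler_semi_dist (Dvs n) Dvw))//.
    by rewrite opprB addrC addrA subrK (semi_normBC Dw).
  rewrite (le_trans (ler_semi_dist Dvw (Dvs n)))//.
  by rewrite opprB addrC addrA subrK.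
(* [w] is only a limit of points of S, so minimality is checked at the points s M - t r of S and
   passed to the limit. *)
have lim_ge t r : S r -> d <= B (t *: r + (v - w)) (t *: r + (v - w)).
  move=> Sr; have Dr := SD _ Sr; have Dz : D (t *: r + (v - w)) by exact: Dlin.
  have [d0|/ltW d0] := leP d 0; first exact: le_trans (Bpos Dz).
  rewrite -sqr_semi_norm// -[d]sqr_sqrtr// ler_pXn2r ?nnegrE ?sqrtr_ge0//.
  apply/ler_addgt0Pr => e e0; have [M _ HM] := cvgr0_norm_lt _ sw _ e0.
  have := HM M (leqnn M); rewrite /= ger0_norm ?semi_norm_ge0// => lt.
  have Dsn := SD _ (sP M).1.
  have Sx : S (- t *: r + s M) by apply: Slin => //; exact: (sP M).1.
  have le1 : Num.sqrt d <= N (v - (- t *: r + s M)).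
    by rewrite /N ler_sqrt ?dP// Bpos//; exact: semi_subspaceB (SD _ Sx).
  apply: (le_trans le1).
  have -> : v - (- t *: r + s M) = t *: r + (v - w) + (w - s M).
    by rewrite opprD scaleNr opprK addrCA -[RHS]addrA (addrA (v - w)) subrK.
  apply: le_trans (ler_semi_normD Dz (semi_subspaceB Dw Dsn)) _.
  by rewrite lerD2l (semi_normBC Dw Dsn) ltW.
have Bd : B (v - w) (v - w) <= d.
  rewrite -sqr_semi_norm//.
  have c1 : N (v - s n) ^+ 2 @[n --> \oo] --> N (v - w) ^+ 2.
    by rewrite expr2; under eq_fun do rewrite expr2; apply: cvgM.
  have c2 : d + n.+1%:R^-1 @[n --> \oo] --> d + 0.
    by apply: cvgD; [exact: cvg_cst|exact: cvg_harmonic].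
  rewrite addr0 in c2; apply: (ler_cvg_to c1 c2).
  by near=> n; rewrite sqr_semi_norm// ltW// (sP n).2.
have perp r : S r -> B (v - w) r = 0.
  move=> Sr; have Dr := SD _ Sr; have c0 := Bpos Dr.
  (* The minimizer of the quadratic would be - b / c, but c may be 0. With c + 1 the change is - b^2
     (c + 2) / (c + 1)^2, which still forces b = 0. *)
  pose b := B (v - w) r; pose c := B r r; pose t := - b / (c + 1).
  have := le_trans (lim_ge t r Sr) (lexx _); rewrite semi_sqr_lin// (Bsym Dr Dvw).
  rewrite -/b -/c => h; have {}h : 0 <= t ^+ 2 * c + 2 * t * b by lra.
  have c1 : 0 < c + 1 by rewrite ltr_wpDl.
  have E : t ^+ 2 * c + 2 * t * b = - (b ^+ 2 * ((c + 2) / (c + 1) ^+ 2)).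
    by rewrite /t; field; rewrite gt_eqF.
  move: h; rewrite E oppr_ge0 pmulr_lle0; last by rewrite divr_gt0 ?exprn_gt0// ltr_wpDl.
  by rewrite -/b => b2; apply/eqP; rewrite -sqrf_eq0 eq_le b2 sqr_ge0.
have N0 : N (v - w) = 0 by rewrite /N orth// sqrtr0.
rewrite N0 in cvgN.
have [M _ HM] := cvgr0_norm_lt _ cvgN _ eps0.
exists (s M); first exact: (sP M).1.
by have := HM M (leqnn M); rewrite /= ger0_norm// semi_norm_ge0.
Unshelve. all: by end_near. Qed.

End SemiInnerProduct.

(** * L^2 as a semi-inner product space *)

Section SquareIntegrable.
Context d (T : measurableType d) (R : realType) (mu : {measure set T -> \bar R}).
Implicit Types (f g h : T -> R) (a : R).

Definition L2fun : set (T -> R) := [set f | f \in Lfun mu 2%:E].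
Definition L2n f : R := semi_norm (L2dot mu) f.

Lemma L2normE f : measurable_fun setT f ->
  L2norm mu f = sqrte (\int[mu]_x (f x ^+ 2)%:E).
Proof.
move=> mf; rewrite /L2norm unlock /= poweR12_sqrt.
  congr sqrte; apply: eq_integral => x _; rewrite /= ; congr EFin.
  by rewrite powR_mulrn// real_normK ?num_real.
by apply: integral_ge0 => x _; rewrite lee_fin powR_ge0.
Qed.

Lemma L2funP f : L2fun f <->
  measurable_fun setT f /\ mu.-integrable setT (fun x => (f x ^+ 2)%:E).
Proof.
split=> [fL|[mf If]].
  split; last exact: Lfun2_integrable_sqr.
  by move: fL; rewrite /L2fun/= inE => /andP[]; rewrite inE.
rewrite /L2fun /= inE; apply/andP; split; rewrite inE//= /finite_norm.
have := L2normE mf; rewrite /L2norm => ->.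
have := integrable_fin_num measurableT If.
by case: (\int[mu]_x _)%E => // r _ /=; rewrite ltry.
Qed.

Lemma L2fun_measurable f : L2fun f -> measurable_fun setT f.
Proof. by move=> /L2funP[]. Qed.

Lemma L2fun_mul f g : L2fun f -> L2fun g ->
  mu.-integrable setT (fun x => (f x * g x)%:E).
Proof.
move=> /L2funP[mf If] /L2funP[mg Ig].
apply: le_integrable (integrableD measurableT If Ig) => //.
  exact/measurable_EFinP/measurable_funM.
move=> x _; rewrite /= lee_fin normrM [leRHS]ger0_norm ?addr_ge0 ?sqr_ge0//.
rewrite -[f x ^+ 2]real_normK ?num_real// -[g x ^+ 2]real_normK ?num_real//.
have := sqr_ge0 (`|f x| - `|g x|); have := normr_ge0 (f x); have := normr_ge0 (g x); nra.
Qed.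

Lemma L2fun0 : L2fun 0.
Proof.
apply/L2funP; split; first exact: measurable_cst.
by under eq_fun do rewrite expr0n; exact: integrable0.
Qed.

Lemma L2fun_lin a f g : L2fun f -> L2fun g -> L2fun (a *: f + g).
Proof.
move=> fL gL; have [mf If] := (L2funP f).1 fL; have [mg Ig] := (L2funP g).1 gL.
apply/L2funP; split; first by apply: measurable_funD => //; exact: measurable_funM.
have I2 := integrableZl measurableT (a * 2) (L2fun_mul fL gL).
have I1 := integrableZl measurableT (a ^+ 2) If.
have := integrableD measurableT (integrableD measurableT I1 I2) Ig.
apply: eq_integrable => // x _; rewrite -!EFinM -!EFinD; congr EFin.
have -> : (a *: f + g) x = a * f x + g x by [].
by ring.
Qed.

Lemma L2dot_lin a f g h : L2fun f -> L2fun g -> L2fun h ->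
  L2dot mu (a *: f + g) h = a * L2dot mu f h + L2dot mu g h.
Proof.
move=> fL gL hL.
rewrite /L2dot -(Rintegral_lin a (L2fun_mul fL hL) (L2fun_mul gL hL)).
apply: eq_Rintegral => x _; have -> : (a *: f + g) x = a * f x + g x by [].
by ring.
Qed.

Lemma L2dotC f g : L2fun f -> L2fun g -> L2dot mu f g = L2dot mu g f.
Proof. by move=> _ _; apply: eq_Rintegral => x _; rewrite mulrC. Qed.

Lemma L2dot_ge0 f : L2fun f -> 0 <= L2dot mu f f.
Proof. by move=> _; apply: Rintegral_ge0 => x _; rewrite -expr2 sqr_ge0. Qed.

Lemma L2_inner : semi_inner L2fun (L2dot mu).
Proof.
by split; [exact: L2fun0|exact: L2fun_lin|exact: L2dot_lin|exact: L2dotC|exact: L2dot_ge0].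
Qed.

Lemma L2dot_ae f g h : L2fun f -> L2fun g -> L2fun h -> f = g %[ae mu] ->
  L2dot mu f h = L2dot mu g h.
Proof.
move=> fL gL hL fg; rewrite /L2dot /Rintegral; congr fine.
apply: ae_eq_integral => //.
- exact: measurable_int (L2fun_mul fL hL).
- exact: measurable_int (L2fun_mul gL hL).
- by move: fg; apply: filterS => x /= -> //.
Qed.

Lemma L2norm_fin f : L2fun f -> L2norm mu f = (L2n f)%:E.
Proof.
move=> fL; have [mf If] := (L2funP f).1 fL.
rewrite L2normE// /L2n /semi_norm /L2dot /Rintegral.
under [in RHS]eq_integral do rewrite -expr2.
by rewrite -[X in sqrte X](fineK (integrable_fin_num measurableT If)).
Qed.

Lemma L2norm_ae f g : measurable_fun setT f -> measurable_fun setT g ->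
  f = g %[ae mu] -> L2norm mu f = L2norm mu g.
Proof.
move=> mf mg fg; rewrite !L2normE//; congr sqrte; apply: ae_eq_integral => //.
- exact/measurable_EFinP/measurable_funX.
- exact/measurable_EFinP/measurable_funX.
- by move: fg; apply: filterS => x /= -> //.
Qed.

Lemma L2n_ae_eq f g : L2fun f -> L2fun g -> f = g %[ae mu] -> L2n f = L2n g.
Proof.
move=> fL gL fg; have := L2norm_ae (L2fun_measurable fL) (L2fun_measurable gL) fg.
by rewrite (L2norm_fin fL) (L2norm_fin gL) => -[].
Qed.

Lemma L2n_eq0 f g : L2fun f -> L2fun g -> L2n (f - g) = 0 -> f = g %[ae mu].
Proof.
move=> fL gL n0; have hL : L2fun (f - g).
  exact: (semi_subspaceB L2_inner).
have := @Lnorm_eq0_eq0 _ _ _ mu (EFin \o (f - g)) 2%:E.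
have := L2norm_fin hL; rewrite n0 /L2norm => -> /(_ _ _ erefl) [].
- exact/measurable_EFinP/L2fun_measurable.
- by rewrite lte_fin.
move=> A [mA A0 sA]; exists A; split=> // x /= nfg; apply: sA => /=.
by move=> h; apply: nfg => _; have /= := h I; case=> /eqP; rewrite subr_eq0 => /eqP.
Qed.

Lemma L2cvgP (u : nat -> T -> R) f : (forall N, L2fun (u N)) -> L2fun f ->
  L2cvg mu u f <-> L2n (u N - f) @[N --> \oo] --> 0.
Proof.
move=> uL fL; have dL N : L2fun (u N - f) by exact: (semi_subspaceB L2_inner).
have E : (fun N => L2norm mu (fun x => u N x - f x)) = (fun N => (L2n (u N - f))%:E).
  by apply/funext => N; exact: (L2norm_fin (dL N)).
rewrite /L2cvg E.
split; first by move=> /fine_cvgP[].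
by move=> h; apply: cvg_EFin => //; near=> k.
Unshelve. all: by end_near. Qed.

End SquareIntegrable.

(** * Hilbert-Schmidt forms *)

(* [e] lists the orthonormal basis [E], possibly with zeros in between. *)
Definition enumerates (R : realType) (H : normedModType R) (E : set H)
    (e : nat -> H) (code : H -> nat) : Prop :=
  (forall x, E x -> e (code x) = x) /\
  (forall i, e i = 0 \/ E (e i) /\ code (e i) = i).

Section HilbertBasis.
Variables (R : realType) (H : completeNormedModType R).
Variables (ip : {dot H for idfun}) (E : set H).
Hypothesis ipn : forall h, `|h| ^+ 2 = ip h h.
Hypothesis sepH : separable H.
Hypothesis basisE : orthonormal_basis ip E.
Implicit Types u v w : H.

Lemma dotC u v : ip u v = ip v u.
Proof. by rewrite hermC expr0 mul1r. Qed.

Lemma dot_suml (J : Type) (r : seq J) (P : pred J) (f : J -> H) v :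
  ip (\sum_(i <- r | P i) f i) v = \sum_(i <- r | P i) ip (f i) v.
Proof. exact: linear_sumlz. Qed.

Lemma dotZl a u v : ip (a *: u) v = a * ip u v.
Proof. by rewrite linearZl_LR. Qed.

Lemma dotZr a u v : ip u (a *: v) = a * ip u v.
Proof. by rewrite dotC dotZl dotC. Qed.

Lemma dot_semi_norm u : semi_norm ip u = `|u|.
Proof. by rewrite /semi_norm -ipn sqrtr_sqr normr_id. Qed.

Lemma dot_inner : semi_inner setT (ip : H -> H -> R).
Proof.
split=> //.
- by move=> a x y z _ _ _; rewrite linearDl/= dotZl.
- by move=> x y _ _; exact: dotC.
- by move=> x _; rewrite -ipn sqr_ge0.
Qed.

Lemma dot_le_norm u v : `|ip u v| <= `|u| * `|v|.
Proof.
by rewrite -!dot_semi_norm; apply: (normr_semi_form dot_inner).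
Qed.

(** Distinct orthonormal vectors have distance sqrt 2 > 1. Points of a countable dense set chosen
    within 1/2 of them are therefore distinct, and their numbers serve as codes. *)
Lemma basis_enumeration : exists e code, enumerates E e code.
Proof.
have [D cD dD] := sepH; have [[orth _]] := (basisE, tt).
have /choice[g gP] : forall x : H, exists y, D y /\ `|x - y| < 2^-1.
  move=> x; have := dD (ball x 2^-1); case.
  - by exists x; apply: ballxx; rewrite invr_gt0.
  - exact: ball_open.
  - by move=> y [+ Dy]; rewrite -ball_normE => /= xy; exists y.
have [f finj] : exists f : H -> nat, {in D &, injective f} by exact/countable_injP.
pose code x := f (g x).
have codeinj x y : E x -> E y -> code x = code y -> x = y.
  move=> Ex Ey cxy; apply: contrapT => /eqP xy.
  have gxy : g x = g y by apply: finj => //; rewrite inE; [case: (gP x)|case: (gP y)].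
  have : `|x - y| < 1.
    have -> : x - y = (x - g x) + (g y - y) by rewrite gxy addrA subrK.
    rewrite (le_lt_trans (ler_normD _ _))//.
    rewrite (splitr 1) div1r; apply: ltrD; first by case: (gP x).
    by rewrite distrC; case: (gP y).
  rewrite -(@ltr_pXn2r _ 2)// ?nnegrE// expr1n ipn linearBl/= !linearBr/=.
  by rewrite !orth// !eqxx (negbTE xy) (eq_sym y) (negbTE xy)/= !mulr1n !mulr0n; lra.
pose e i := if pselect (exists2 x, E x & code x = i) is left ex then s2val (cid2 ex) else 0.
exists e, code; split=> [x Ex|i].
  rewrite /e; case: pselect => [ex|[]]; last by exists x.
  by case: cid2 => y /= Ey cy; exact: codeinj.
rewrite /e; case: pselect => [ex|]; last by left.
by case: cid2 => y /= Ey cy; right.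
Qed.

Variables (e : nat -> H) (code : H -> nat).
Hypothesis eE : enumerates E e code.

Definition basis_proj N u := \sum_(i < N) ip u (e i) *: e i.

Lemma dot_basis_neq i j : i != j -> ip (e i) (e j) = 0.
Proof.
have [orth _] := basisE; have [_ h] := eE => ij.
have [->|[Ei ci]] := h i; first by rewrite linear0l.
have [->|[Ej cj]] := h j; first by rewrite linear0r.
rewrite orth//; case: eqP => // eij; move: ij.
by rewrite -ci -cj eij eqxx.
Qed.

(** (e i, e i) is 1, or else e i = 0 and both sides vanish; this lets the zeros in the enumeration
    pass through the sums below. *)
Lemma dot_basis_idem u i : ip u (e i) * ip (e i) (e i) = ip u (e i).
Proof.
have [orth _] := basisE; have [_ h] := eE.
have [->|[Ei ci]] := h i; first by rewrite !linear0r.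
by rewrite (orth (e i))// eqxx mulr1.
Qed.

Lemma basis_proj_coord N u (i : 'I_N) : ip (basis_proj N u) (e i) = ip u (e i).
Proof.
rewrite dot_suml (bigD1 i)//= big1 ?addr0 => [|j ji]; rewrite dotZl.
  exact: dot_basis_idem.
by rewrite dot_basis_neq ?mulr0.
Qed.

Lemma dot_basis_proj N u v :
  ip (basis_proj N u) v = \sum_(i < N) ip u (e i) * ip v (e i).
Proof. by rewrite dot_suml; apply: eq_bigr => i _; rewrite dotZl (dotC v). Qed.

Lemma basis_proj_sqnorm N u : `|basis_proj N u| ^+ 2 = \sum_(i < N) ip u (e i) ^+ 2.
Proof.
rewrite ipn dot_basis_proj; apply: eq_bigr => i _.
by rewrite basis_proj_coord expr2.
Qed.

Lemma basis_proj_le N u : `|basis_proj N u| <= `|u|.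
Proof.
have [->|p0] := eqVneq (basis_proj N u) 0; first by rewrite normr0.
have pp : 0 < `|basis_proj N u| by rewrite normr_gt0.
rewrite -(ler_pM2r pp) -expr2 basis_proj_sqnorm.
apply: le_trans (dot_le_norm u (basis_proj N u)); apply: le_trans (ler_norm _).
by rewrite dotC dot_basis_proj; under eq_bigr do rewrite expr2.
Qed.

Lemma basis_projD N u v : basis_proj N (u + v) = basis_proj N u + basis_proj N v.
Proof.
by rewrite -big_split/=; apply: eq_bigr => i _; rewrite linearDl/= scalerDl.
Qed.

Lemma basis_projZ N a u : basis_proj N (a *: u) = a *: basis_proj N u.
Proof.
by rewrite scaler_sumr; apply: eq_bigr => i _; rewrite dotZl scalerA.
Qed.

Lemma basis_proj_fix N x : E x -> (code x < N)%N -> basis_proj N x = x.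
Proof.
move=> Ex cN; have [ec h] := eE; rewrite /basis_proj (bigD1 (Ordinal cN))//=.
rewrite big1 ?addr0 => [|j ji].
  by rewrite ec//; have [orth _] := basisE; rewrite orth// eqxx scale1r.
rewrite -[x in ip x _](ec _ Ex) dot_basis_neq ?scale0r//.
by apply: contra ji => /eqP cj; apply/eqP/val_inj; rewrite /= cj.
Qed.

(** The projections are contractions, and each finite combination of basis vectors is fixed by all
    late ones; such combinations are dense. *)
Lemma cvg_basis_proj u : basis_proj N u @[N --> \oo] --> u.
Proof.
apply/cvgrPdist_lt => eps eps0.
have [_ dE] := basisE; have := dE (ball u (eps / 2)); case.
- by exists u; apply: ballxx; rewrite divr_gt0.
- exact: ball_open.
move=> w [+ [d [x [c [Ex wE]]]]]; rewrite -ball_normE /= => uw.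
exists (\max_(i < d) (code (x i)).+1)%N => // N /= MN.
have pw : basis_proj N w = w.
  rewrite wE; apply: (big_ind (fun h => basis_proj N h = h)) => [|a b pa pb|i _].
  - by rewrite -[0 in LHS](scale0r 0) basis_projZ scale0r.
  - by rewrite basis_projD pa pb.
  rewrite basis_projZ basis_proj_fix//.
  by apply: leq_trans MN; exact: (leq_bigmax (F := fun i => (code (x i)).+1) i).
have -> : u - basis_proj N u = (u - w) + basis_proj N (w - u).
  by rewrite basis_projD pw -[- u]scaleN1r basis_projZ scaleN1r addrA subrK.
rewrite (le_lt_trans (ler_normD _ _))// (splitr eps) ltrD//.
by rewrite (le_lt_trans (basis_proj_le _ _))// distrC.
Qed.

End HilbertBasis.

(** * Multilinear expansion and polarization *)

Section Multilinear.
Variables (R : realType) (V : lmodType R) (n : nat).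
Implicit Types (A B : V ^ n -> R) (h : V ^ n).

Definition upd h (i : 'I_n) (x : V) : V ^ n := [ffun j => if j == i then x else h j].

Lemma upd_id h i : upd h i (h i) = h.
Proof. by apply/ffunP => j; rewrite ffunE; case: eqP => [->|]. Qed.

Lemma multilinear0 A h i : multilinear A -> A (upd h i 0) = 0.
Proof.
move=> mA; have := mA i h (-1) 0 0; rewrite scaler0 addr0 -/(upd h i 0).
by rewrite mulN1r addNr.
Qed.

Lemma multilinear_sum A h i (J : Type) (r : seq J) (c : J -> R) (x : J -> V) :
  multilinear A ->
  A (upd h i (\sum_(j <- r) c j *: x j)) = \sum_(j <- r) c j * A (upd h i (x j)).
Proof.
move=> mA; elim: r => [|j r IH]; first by rewrite !big_nil multilinear0.
by rewrite !big_cons -IH; exact: mA.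
Qed.

Lemma multilinear_lin a A B : multilinear A -> multilinear B ->
  multilinear (fun h => a * A h + B h).
Proof. by move=> mA mB i h b x y; rewrite mA mB; ring. Qed.

Definition in_span (G : set V) (v : V) : Prop :=
  exists m (c : 'I_m -> R) (x : 'I_m -> V),
    (forall j, G (x j)) /\ v = \sum_j c j *: x j.

Lemma multilinear_ext (G : set V) A B : multilinear A -> multilinear B ->
  (forall h, (forall i, G (h i)) -> A h = B h) ->
  forall h, (forall i, in_span G (h i)) -> A h = B h.
Proof.
move=> mA mB AB.
have claim k : (k <= n)%N -> forall h, (forall i : 'I_n, (i < k)%N -> in_span G (h i)) ->
    (forall i : 'I_n, (k <= i)%N -> G (h i)) -> A h = B h.
  elim: k => [|k IH] kn h hs hG; first by apply: AB => i; exact: hG.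
  have [m [c [x [Gx hk]]]] := hs (Ordinal kn) (ltnSn k).
  rewrite -(upd_id h (Ordinal kn)) hk !multilinear_sum//.
  apply: eq_bigr => j _; congr (_ * _); apply: IH (ltnW kn) _ _ _ => i ik; rewrite ffunE.
    by case: eqP => [i_k|_]; [move: ik; rewrite i_k ltnn|exact: hs (ltnW ik)].
  case: eqP => // ine; apply: hG; rewrite ltn_neqAle ik andbT.
  by apply/eqP => ki; apply: ine; exact/val_inj.
by move=> h hs; apply: (claim n (leqnn n)) => // i; rewrite leqNgt ltn_ord.
Qed.

(** A surjective self-map of a finite set is a permutation, so all n! terms equal A h. Surjectivity
    is the form in which the condition arises from the alternating sum in the polarization. *)
Lemma symmetric_surj_sum A h : Defs.symmetric_form A ->
  \sum_(g : {ffun 'I_n -> 'I_n} | [forall j, [exists i, g i == j]])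
    A [ffun i => h (g i)] = n`!%:R * A h.
Proof.
move=> sA.
have injP (g : {ffun 'I_n -> 'I_n}) :
    [forall j, [exists i, g i == j]] = injectiveb g.
  apply/idP/idP => [/forallP sg|/injectiveP ig].
    apply/injectiveP => x y gxy; have /image_injP inj : #|codom g| == #|'I_n|.
      apply/eqP; apply: eq_card => j; have /existsP[i /eqP <-] := sg j.
      by rewrite inE codom_f.
    exact: inj gxy.
  apply/forallP => j; apply/existsP; exists (invF ig j).
  by rewrite f_invF.
under eq_bigl do rewrite injP.
rewrite (reindex (@pval _)) /=; last first.
  pose in_Sn := insubd (1%g : 'S_n).
  by exists in_Sn => /= f Uf; first apply: val_inj; apply: insubdK.
rewrite (eq_bigl predT) => [|s]; last by rewrite (valP s).
rewrite (eq_bigr (fun _ => A h)) => [|s _].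
  by rewrite sumr_const -[#|_|]/#|'S_n| card_Sn mulr_natl.
by rewrite -[RHS](sA s); congr A; apply/ffunP => i; rewrite !ffunE pvalE.
Qed.

End Multilinear.

(** Both sides are multilinear in the coefficient vectors c i, so by [multilinear_ext] they need
    only be compared on unit vectors, where one term of the sum survives. *)
Lemma multilinear_expand (R : realType) (V : lmodType R) n m (A : V ^ n -> R)
    (c : 'I_n -> 'I_m -> R) (x : 'I_n -> 'I_m -> V) : multilinear A ->
  A [ffun i => \sum_j c i j *: x i j] =
  \sum_(g : {ffun 'I_n -> 'I_m}) (\prod_i c i (g i)) * A [ffun i => x i (g i)].
Proof.
move=> mA.
pose A' (r : 'rV[R]_m ^ n) := A [ffun i => \sum_j r i 0 j *: x i j].
pose B' (r : 'rV[R]_m ^ n) :=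
  \sum_(g : {ffun 'I_n -> 'I_m}) (\prod_i r i 0 (g i)) * A [ffun i => x i (g i)].
have mA' : multilinear A'.
  move=> i h a u v; rewrite /A'.
  have E (w : 'rV[R]_m) :
      [ffun k => \sum_j [ffun j0 => if j0 == i then w else h j0] k 0 j *: x k j] =
      upd [ffun k => \sum_j h k 0 j *: x k j] i (\sum_j w 0 j *: x i j).
    by apply/ffunP => k; rewrite !ffunE; case: eqP => [->|_].
  rewrite !E -mA; congr A; apply/ffunP => k; rewrite !ffunE; case: eqP => // _.
  rewrite scaler_sumr -big_split/=; apply: eq_bigr => j _.
  by rewrite !mxE scalerDl scalerA.
have mB' : multilinear B'.
  move=> i h a u v; rewrite /B' mulr_sumr -big_split/=; apply: eq_bigr => g _.
  rewrite mulrA -mulrDl; congr (_ * _).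
  rewrite (bigD1 i)//= [in RHS](bigD1 i)//= [X in _ = _ + X](bigD1 i)//= !ffunE eqxx.
  have E (w : 'rV[R]_m) : \prod_(k < n | k != i)
      ([ffun j => if j == i then w else h j] k) 0 (g k) = \prod_(k < n | k != i) h k 0 (g k).
    by apply: eq_bigr => k /negbTE ki; rewrite ffunE ki.
  by rewrite !E !mxE; ring.
have := @multilinear_ext R 'rV[R]_m n [set v | exists j, v = delta_mx 0 j] A' B' mA' mB'.
move=> /(_ _ [ffun i => \row_j c i j]).
rewrite /A' /B'; set Ac := A _; set Bc := \sum_g _ => h.
have -> : A [ffun i => \sum_j c i j *: x i j] = Ac.
  congr A; apply/ffunP => i; rewrite !ffunE; apply: eq_bigr => j _.
  by rewrite mxE.
have -> : \sum_(g : {ffun 'I_n -> 'I_m}) (\prod_i c i (g i)) * A [ffun i => x i (g i)] = Bc.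
  apply: eq_bigr => g _; congr (_ * _); apply: eq_bigr => i _.
  by rewrite ffunE mxE.
apply: h => [r rG|i]; last first.
  exists m, (fun j => c i j), (fun j => delta_mx 0 j); split=> [j|]; first by exists j.
  by rewrite ffunE [LHS]row_sum_delta; apply: eq_bigr => j _; rewrite mxE.
have /choice[g0 rg] : forall i, exists j, r i = delta_mx 0 j by [].
rewrite /A' /B' (bigD1 (finfun g0))//= [X in _ = _ + X]big1 ?addr0 => [|g gg0].
  rewrite [X in _ = X * _]big1 ?mul1r => [|i _]; last by rewrite rg ffunE mxE !eqxx.
  congr A; apply/ffunP => i; rewrite !ffunE (bigD1 (g0 i))//= big1 ?addr0 => [|j jg].
    by rewrite rg mxE !eqxx scale1r.
  by rewrite rg mxE eqxx/= (negbTE jg) scale0r.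
have [i gi] : exists i, g i != g0 i.
  apply/existsP; rewrite -negb_forall; apply: contra gg0 => /forallP gE.
  by apply/eqP/ffunP => i; rewrite ffunE; exact/eqP.
by rewrite (bigD1 i)//= rg mxE eqxx/= (negbTE gi) !mul0r.
Qed.

(* Ryser's alternating sum over the subsets of the arguments. *)
Lemma symmetric_polarization (R : realType) (V : lmodType R) n (A : V ^ n -> R) :
  multilinear A -> Defs.symmetric_form A ->
  (forall v, A [ffun=> v] = 0) -> forall h, A h = 0.
Proof.
move=> mA sA Adiag h.
pose sg (b : bool) : R := if b then 1 else -1.
have : \sum_(eps : {ffun 'I_n -> bool}) (\prod_i sg (eps i)) *
    A [ffun i => \sum_j (eps j)%:R *: h j] = 0.
  apply: big1 => eps _; rewrite (_ : [ffun _ => _] = [ffun=> \sum_j (eps j)%:R *: h j]).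
    by rewrite Adiag mulr0.
  by apply/ffunP => i; rewrite !ffunE.
under eq_bigr do rewrite multilinear_expand// mulr_sumr.
rewrite exchange_big /=.
have E (g : {ffun 'I_n -> 'I_n}) :
    \sum_(eps : {ffun 'I_n -> bool}) (\prod_i sg (eps i)) *
      ((\prod_i (eps (g i))%:R) * A [ffun i => h (g i)]) =
    [forall j, [exists i, g i == j]]%:R * A [ffun i => h (g i)].
  under eq_bigr do rewrite mulrA; rewrite -mulr_suml; congr (_ * _).
  pose F (j : 'I_n) (b : bool) : R := sg b * \prod_(i | g i == j) b%:R.
  transitivity (\sum_(eps : {ffun 'I_n -> bool}) \prod_j F j (eps j)).
    apply: eq_bigr => eps _; rewrite big_split/=; congr (_ * _).
    rewrite (partition_big g xpredT)//=; apply: eq_bigr => j _.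
    by apply: eq_bigr => i /eqP ->.
  rewrite -(bigA_distr_bigA F) /=.
  (* If no argument is mapped to j, the two signs cancel; otherwise exclusion of j gives the value 0
     and its inclusion 1. Hence only surjective maps g contribute. *)
  have FE j : \sum_(b : bool) F j b = [exists i, g i == j]%:R.
    rewrite big_bool /F /sg/= mul1r big1 ?mulN1r//.
    case: existsP => [[i gi]|nex].
      by rewrite (bigD1 i)//= mul0r oppr0 addr0.
    rewrite big_pred0 ?subrr// => i; apply/negbTE/negP => gi.
    by apply: nex; exists i.
  under eq_bigr do rewrite FE.
  case: forallP => [all|nall].
    by rewrite big1// => j _; rewrite all.
  have [j nj] : exists j, ~~ [exists i, g i == j].
    by apply/existsP; rewrite -negb_forall; apply/forallP.
  by rewrite (bigD1 j)//= (negbTE nj) mul0r.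
under eq_bigr do rewrite E.
rewrite (bigID (fun g : {ffun 'I_n -> 'I_n} => [forall j, [exists i, g i == j]]))/=.
rewrite [X in _ + X]big1 ?addr0 => [|g /negbTE ->]; last by rewrite mul0r.
under eq_bigr => g -> do rewrite mul1r.
rewrite symmetric_surj_sum// => /eqP; rewrite mulf_eq0 pnatr_eq0 -leqn0 leqNgt fact_gt0/=.
by move/eqP.
Qed.

(** * The Hilbert space of Hilbert-Schmidt forms *)

Section HilbertSchmidt.
Variables (R : realType) (H : completeNormedModType R).
Variables (ip : {dot H for idfun}) (E : set H).
Hypothesis ipn : forall h, `|h| ^+ 2 = ip h h.
Hypothesis basisE : orthonormal_basis ip E.
Variables (e : nat -> H) (code : H -> nat).
Hypothesis eE : enumerates E e code.
Variable n : nat.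
Implicit Types A B : H ^ n -> R.

Let eg N (g : {ffun 'I_n -> 'I_N}) : H ^ n := [ffun i => e (g i)].
(** Finite sections of the Hilbert-Schmidt product. They are bilinear outright, unlike the extended
    sum that defines the norm, which only has nonnegative terms. *)
Let S N A B := \sum_(g : {ffun 'I_n -> 'I_N}) A (eg g) * B (eg g).
Let W N : set (H ^ n) := [set f | forall i, E (f i) /\ (code (f i) < N)%N].

Let code_e i : E (e i) -> code (e i) = i.
Proof.
have [orth _] := basisE; have [_ h] := eE; have [e0 Ei|[]//] := h i.
have := orth _ _ Ei Ei; rewrite eqxx e0 linear0l => /eqP.
by rewrite eq_sym oner_eq0.
Qed.

(** A multi-index that meets a zero of the enumeration contributes 0 by multilinearity; the other
    ones are coded by tuples of basis vectors. *)
Let partial_esum N A : multilinear A ->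
  (S N A A)%:E = \esum_(f in W N) ((A f) ^+ 2)%:E.
Proof.
move=> mA; have [ec eh] := eE.
pose P := [set g : {ffun 'I_n -> 'I_N} | forall i, E (e (g i))].
rewrite (@reindex_esum R _ _ P (W N) (@eg N)); last first.
  split.
  - move=> g Pg i; rewrite ffunE; split; first exact: Pg.
    by rewrite code_e//; exact: Pg.
  - move=> g g'; rewrite !inE => Pg Pg' gg'; apply/ffunP => i; apply/val_inj => /=.
    rewrite -(code_e (Pg i)) -(code_e (Pg' i)); congr code.
    by have := congr1 (fun f : H ^ n => f i) gg'; rewrite !ffunE.
  - move=> f Wf; exists [ffun i => Ordinal (Wf i).2].
      by move=> i; rewrite ffunE /= ec; case: (Wf i).
    by apply/ffunP => i; rewrite !ffunE /= ec//; case: (Wf i).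
rewrite esum_mkcond (_ : setT = [set` xpredT]); last by apply/seteqP; split.
rewrite esum_fset//; last first.
  by move=> g _; case: ifP => // _; rewrite lee_fin sqr_ge0.
rewrite -(@bigfs _ _ _ _ (index_enum {ffun 'I_n -> 'I_N}) xpredT) ?index_enum_uniq//; last first.
  by move=> g _; rewrite mem_index_enum.
rewrite /S -sumEFin; apply: eq_bigr => g _; rewrite -expr2.
case: ifPn => //; rewrite notin_setE => nP.
have [i nE] : exists i, ~ E (e (g i)).
  by apply: contrapT => /forallNP h; apply: nP => i; apply: contrapT; exact: h.
have e0 : e (g i) = 0 by have [|[]] := eh (g i).
rewrite (_ : A (eg g) = 0) ?expr0n//.
by rewrite -(upd_id (eg g) i) ffunE e0 multilinear0.
Qed.

Let partial_le_HS N A : multilinear A -> ((S N A A)%:E <= HS_sqnorm E A)%E.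
Proof.
move=> mA; rewrite partial_esum// /HS_sqnorm.
rewrite [leRHS]esum_mkcond [leLHS]esum_mkcond; apply: le_esum => f _.
case: ifPn => [|_]; last by case: ifP => // _; rewrite lee_fin sqr_ge0.
rewrite inE => Wf; rewrite mem_set// => i.
by case: (Wf i).
Qed.

Let partial_mono N M A : multilinear A -> (N <= M)%N -> S N A A <= S M A A.
Proof.
move=> mA NM; rewrite -lee_fin !partial_esum//.
rewrite [leRHS]esum_mkcond [leLHS]esum_mkcond; apply: le_esum => f _.
case: ifPn => [|_]; last by case: ifP => // _; rewrite lee_fin sqr_ge0.
rewrite inE => Wf; rewrite mem_set// => i.
by case: (Wf i) => Ei ci; split=> //; exact: leq_trans NM.
Qed.

Let HS_le_partial A (l : R) : multilinear A -> (forall N, S N A A <= l) ->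
  (HS_sqnorm E A <= l%:E)%E.
Proof.
move=> mA Sl; apply: ge_ereal_sup => _ [F [finF FE] <-].
pose N := (\max_(f <- finmap.enum_fset (fset_set F)) \max_(i < n) (code (f i)).+1)%N.
apply: (@le_trans _ _ (S N A A)%:E); last by rewrite lee_fin.
rewrite partial_esum//; apply: esum_ge; exists F => //; split=> // f Ff i.
split; first exact: FE.
apply: (@leq_trans (\max_(i < n) (code (f i)).+1)%N).
  exact: (leq_bigmax (F := fun i => (code (f i)).+1) i).
have fF := in_fset_set finF f; rewrite (mem_set Ff) in fF.
rewrite /N (big_rem f)/=; last exact: fF.
exact: leq_maxl.
Qed.

(** Symmetry is left out because [tensor v], against which forms are paired to evaluate them, is in
    general not symmetric. *)
Definition HS_space : set (H ^ n -> R) :=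
  [set A | [/\ multilinear A, bounded_form A & (HS_sqnorm E A < +oo)%E]].

Lemma HS_spaceP A : HS_space A <->
  [/\ multilinear A, bounded_form A & exists l, forall N, S N A A <= l].
Proof.
split=> [[mA bA fA]|[mA bA [l Al]]]; split => //; last first.
  by apply: le_lt_trans (HS_le_partial mA Al) _; rewrite ltry.
exists (fine (HS_sqnorm E A)) => N; rewrite -lee_fin fineK ?partial_le_HS//.
rewrite ge0_fin_numE//; apply: esum_ge0 => f _; rewrite lee_fin sqr_ge0 //.
Qed.

Lemma HS_form_space A : HS_form E A <-> HS_space A /\ Defs.symmetric_form A.
Proof. by split=> [[]|[[]]]. Qed.

Lemma bounded_form_lin a A B : bounded_form A -> bounded_form B ->
  bounded_form (a *: A + B).
Proof.
move=> [C1 h1] [C2 h2]; exists (`|a| * C1 + C2) => h.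
have -> : (a *: A + B) h = a * A h + B h by [].
by rewrite (le_trans (ler_normD _ _))// mulrDl lerD// normrM -mulrA ler_wpM2l.
Qed.

Let S_lin N a A B C : S N (a *: A + B) C = a * S N A C + S N B C.
Proof.
rewrite /S mulr_sumr -big_split/=; apply: eq_bigr => g _.
by have -> : (a *: A + B) (eg g) = a * A (eg g) + B (eg g) by []; ring.
Qed.

Let S_sym N A B : S N A B = S N B A.
Proof. by apply: eq_bigr => g _; rewrite mulrC. Qed.

Let S_ge0 N A : 0 <= S N A A.
Proof. by apply: sumr_ge0 => g _; rewrite -expr2 sqr_ge0. Qed.

Let S_sqr_lin N a A B :
  S N (a *: A + B) (a *: A + B) = a ^+ 2 * S N A A + 2 * a * S N A B + S N B B.
Proof. rewrite S_lin !(S_sym N _ (_ + _)) !S_lin (S_sym N B A); ring. Qed.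

Lemma HS_space0 : HS_space 0.
Proof.
apply/HS_spaceP; split.
- by move=> i h a x y; rewrite /= mulr0 addr0.
- by exists 0 => h; rewrite normr0 mul0r.
- by exists 0 => N; rewrite /S big1// => g _; rewrite mulr0.
Qed.

Lemma HS_space_lin a A B : HS_space A -> HS_space B -> HS_space (a *: A + B).
Proof.
move=> /HS_spaceP[mA bA [l1 h1]] /HS_spaceP[mB bB [l2 h2]]; apply/HS_spaceP; split.
- exact: multilinear_lin.
- exact: bounded_form_lin.
exists (2 * a ^+ 2 * l1 + 2 * l2) => N.
have := S_ge0 N (- a *: A + B); rewrite !S_sqr_lin sqrrN.
have hA : a ^+ 2 * S N A A <= a ^+ 2 * l1 by rewrite ler_wpM2l ?sqr_ge0.
have hB := h2 N; nra.
Qed.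

Let cvg_S_diag A : HS_space A -> S N A A @[N --> \oo] --> fine (HS_sqnorm E A).
Proof.
move=> HA; have /HS_spaceP[mA bA [l Al]] := HA; have [_ _ fA] := HA.
have fin : HS_sqnorm E A \is a fin_num.
  by rewrite ge0_fin_numE//; apply: esum_ge0 => f _; rewrite lee_fin sqr_ge0.
have nd : nondecreasing_seq (fun N => S N A A) by move=> N M NM; exact: partial_mono.
have ub : has_ubound (range (fun N => S N A A)) by exists l => _ [N _ <-].
have := nondecreasing_cvgn nd ub.
rewrite (_ : sup _ = fine (HS_sqnorm E A))//; apply/eqP; rewrite eq_le; apply/andP; split.
  apply: ge_sup; first by exists (S 0 A A), 0.
  by move=> _ [N _ <-]; rewrite -lee_fin fineK// partial_le_HS.
rewrite -lee_fin fineK//; apply: HS_le_partial => // N.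
by apply: ub_le_sup => //; exists N.
Qed.

Definition HS_dot A B : R := limn (fun N => S N A B).

(** By polarization the sections of a pair are combinations of diagonal ones, which increase to the
    squared norms. *)
Let cvg_S A B : HS_space A -> HS_space B -> S N A B @[N --> \oo] --> HS_dot A B.
Proof.
move=> HA HB; apply/cvg_ex => /=.
have HAB := HS_space_lin 1 HA HB.
exists ((fine (HS_sqnorm E (1 *: A + B)) - fine (HS_sqnorm E A) - fine (HS_sqnorm E B)) * 2^-1).
rewrite [X in X @ _ --> _](_ : _ = fun N => (S N (1 *: A + B) (1 *: A + B) - S N A A - S N B B) * 2^-1); last first.
  by apply/funext => N; rewrite S_sqr_lin; field.
have c1 : (S N (1 *: A + B) (1 *: A + B) - S N A A - S N B B) @[N --> \oo] -->
    fine (HS_sqnorm E (1 *: A + B)) - fine (HS_sqnorm E A) - fine (HS_sqnorm E B).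
  by apply: cvgB; [apply: cvgB|]; exact: cvg_S_diag.
by apply: cvgM c1 _; exact: cvg_cst.
Qed.

Lemma HS_dot_sqnorm A : HS_space A -> HS_dot A A = fine (HS_sqnorm E A).
Proof. by move=> HA; exact: cvg_unique (cvg_S HA HA) (cvg_S_diag HA). Qed.

Lemma HS_dot_lin a A B C : HS_space A -> HS_space B -> HS_space C ->
  HS_dot (a *: A + B) C = a * HS_dot A C + HS_dot B C.
Proof.
move=> HA HB HC; apply: (cvg_unique _ (cvg_S (HS_space_lin a HA HB) HC)) => //.
rewrite (_ : (fun N => S N (a *: A + B) C) = fun N => a * S N A C + S N B C); last first.
  by apply/funext => N; exact: S_lin.
apply: cvgD; last exact: cvg_S.
by apply: cvgM; [exact: cvg_cst|exact: cvg_S].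
Qed.

Lemma HS_dotC A B : HS_dot A B = HS_dot B A.
Proof.
rewrite /HS_dot (_ : (fun N => S N A B) = fun N => S N B A)//.
by apply/funext => N; exact: S_sym.
Qed.

Lemma HS_dot_ge0 A : HS_space A -> 0 <= HS_dot A A.
Proof.
by move=> HA; apply: (cvgr_to_ge (cvg_S HA HA)); near=> N; exact: S_ge0.
Unshelve. all: by end_near. Qed.

Lemma HS_inner : semi_inner HS_space HS_dot.
Proof.
split; [exact: HS_space0|exact: HS_space_lin|exact: HS_dot_lin| |exact: HS_dot_ge0].
by move=> A B _ _; exact: HS_dotC.
Qed.

Definition HSn A : R := semi_norm HS_dot A.

Lemma HS_normE A : HS_space A -> HS_norm E A = HSn A.
Proof. by move=> HA; rewrite /HSn /semi_norm HS_dot_sqnorm. Qed.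

Let S_le A N : HS_space A -> S N A A <= HSn A ^+ 2.
Proof.
move=> HA; rewrite (sqr_semi_norm HS_inner)// HS_dot_sqnorm// -lee_fin fineK.
  by rewrite partial_le_HS//; case: HA.
by rewrite ge0_fin_numE; [case: HA|apply: esum_ge0 => f _; rewrite lee_fin sqr_ge0].
Qed.

Definition tensor (v : H ^ n) : H ^ n -> R := fun h => \prod_i ip (h i) (v i).

Let S_tensor A N v : multilinear A ->
  S N A (tensor v) = A [ffun i => basis_proj ip e N (v i)].
Proof.
move=> mA; rewrite /basis_proj multilinear_expand//.
apply: eq_bigr => g _; rewrite mulrC; congr (_ * _).
by apply: eq_bigr => i _; rewrite ffunE dotC.
Qed.

Lemma multilinear_tensor v : multilinear (tensor v).
Proof.
move=> i h a x y; rewrite /tensor (bigD1 i)//= [in RHS](bigD1 i)//=.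
rewrite [X in _ = _ + X](bigD1 i)//= !ffunE eqxx.
have F (w : H) : \prod_(k < n | k != i) ip ([ffun j => if j == i then w else h j] k) (v k)
    = \prod_(k < n | k != i) ip (h k) (v k).
  by apply: eq_bigr => k /negbTE ki; rewrite ffunE ki.
by rewrite !F linearDl/= dotZl; ring.
Qed.

Lemma HS_space_tensor v : HS_space (tensor v).
Proof.
have mt := multilinear_tensor v; apply/HS_spaceP; split => //.
  exists (\prod_i `|v i|) => h; rewrite /tensor normr_prod -big_split/=.
  by apply: ler_prod => i _; rewrite normr_ge0 mulrC dot_le_norm.
exists (\prod_i `|v i| ^+ 2) => N; rewrite S_tensor// /tensor.
apply: ler_prod => i _; rewrite ffunE dot_basis_proj.
under eq_bigr do rewrite -expr2.
rewrite -(basis_proj_sqnorm ipn basisE eE) sqr_ge0/= lerXn2r ?nnegrE//.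
exact: (basis_proj_le ipn basisE eE).
Qed.

Lemma bounded_multilinear_cvg A (w : nat -> H ^ n) (v : H ^ n) :
  multilinear A -> bounded_form A -> (forall i, w N i @[N --> \oo] --> v i) ->
  A (w N) @[N --> \oo] --> A v.
Proof.
move=> mA [C bA] wv.
(* Hybrids of the two tuples: consecutive ones differ in a single argument, so their difference is
   one value of A with a small argument and the others bounded. *)
pose hyb k N : H ^ n := [ffun i : 'I_n => if (i < k)%N then w N i else v i].
suff claim k : (k <= n)%N -> A (hyb k N) @[N --> \oo] --> A v.
  have := claim n (leqnn n); rewrite (_ : (fun N => A (hyb n N)) = fun N => A (w N))//.
  by apply/funext => N; congr A; apply/ffunP => i; rewrite !ffunE ltn_ord.
elim: k => [_|k IH kn].
  rewrite [X in X @ _ --> _](_ : _ = cst (A v)); first exact: cvg_cst.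
  by apply/funext => N; congr A; apply/ffunP => i; rewrite !ffunE.
pose i0 := Ordinal kn.
have hE N : hyb k.+1 N = upd (hyb k N) i0 (w N i0).
  apply/ffunP => i; rewrite !ffunE; case: (eqVneq i i0) => [->|ne]; first by rewrite /= ltnSn.
  rewrite ltnS leq_eqVlt (_ : _ == k = false)//.
  by apply/eqP => ik; move/eqP: ne; apply; exact/val_inj.
have hE' N : hyb k N = upd (hyb k N) i0 (v i0).
  by rewrite -[LHS](upd_id _ i0) ffunE ltnn.
have dE N : A (hyb k.+1 N) - A (hyb k N) = A (upd (hyb k N) i0 (w N i0 - v i0)).
  rewrite hE {2}hE'; have := mA i0 (hyb k N) (-1) (v i0) (w N i0).
  by rewrite scaleN1r addrC => ->; rewrite mulN1r addrC.
rewrite [X in X @ _ --> _](_ : _ = fun N => (A (hyb k.+1 N) - A (hyb k N)) + A (hyb k N)); last first.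
  by apply/funext => N; rewrite subrK.
rewrite -[A v]add0r; apply: cvgD; last exact: IH (ltnW kn).
apply/norm_cvg0P.
have c0 : `|C| * (\prod_(i < n | i != i0) (`|v i| + 1)) * `|w N i0 - v i0| @[N --> \oo] --> 0.
  rewrite -[X in _ --> X](mulr0 (`|C| * (\prod_(i < n | i != i0) (`|v i| + 1)))).
  apply: cvgM; first exact: cvg_cst.
  rewrite -(@normr0 _ H) -(subrr (v i0)); apply: cvg_norm; apply: cvgB; last exact: cvg_cst.
  exact: wv.
have wb : \forall N \near \oo, forall i, `|w N i| <= `|v i| + 1.
  apply: filter_forall => i.
  have /cvgrPdist_lt/(_ _ ltr01) := wv i; apply: filterS => N /ltW h.
  by rewrite -[w N i](subrK (v i)) (le_trans (ler_normD _ _))// addrC lerD2l distrC.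
apply: squeeze_cvgr (cvg_cst 0) c0; near=> N; rewrite normr_ge0/= dE.
have wbN : forall i, `|w N i| <= `|v i| + 1 by near: N.
apply: le_trans (bA _) _; apply: (@le_trans _ _ (`|C| * \prod_i
    `|upd (hyb k N) i0 (w N i0 - v i0) i|)).
  by rewrite ler_wpM2r ?ler_norm// prodr_ge0.
rewrite -mulrA ler_wpM2l// (bigD1 i0)//= ffunE eqxx mulrC ler_wpM2r//.
apply: ler_prod => i /negbTE ine; rewrite normr_ge0 ffunE ine ffunE /=.
by case: ifP => // _; rewrite lerDl.
Unshelve. all: by end_near. Qed.

(** Reproducing property. On the first N basis vectors the pairing is A at the projected arguments;
    boundedness of A allows the passage to the limit. *)
Lemma HS_dot_tensor A v : HS_space A -> HS_dot A (tensor v) = A v.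
Proof.
move=> HA; have [mA bA _] := HA.
apply: (cvg_unique _ (cvg_S HA (HS_space_tensor v))) => //.
rewrite (_ : (fun N => S N A (tensor v)) =
    fun N => A [ffun i => basis_proj ip e N (v i)]); last first.
  by apply/funext => N; exact: S_tensor.
apply: bounded_multilinear_cvg => // i; under eq_fun do rewrite ffunE.
exact: (cvg_basis_proj ipn basisE eE).
Qed.

(** Cauchy-Schwarz applied to the reproducing property. It turns convergence in norm into pointwise
    convergence. *)
Lemma HS_eval_le A h : HS_space A -> `|A h| <= HSn A * \prod_i `|h i|.
Proof.
move=> HA; rewrite -HS_dot_tensor//.
have -> : \prod_i `|h i| = HSn (tensor h).
  rewrite /HSn /semi_norm HS_dot_tensor; last exact: HS_space_tensor.
  rewrite /tensor -[LHS]ger0_norm ?prodr_ge0// -sqrtr_sqr -prodrXl; congr Num.sqrt.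
  by apply: eq_bigr => i _; rewrite ipn.
by apply: (normr_semi_form HS_inner) => //; exact: HS_space_tensor.
Qed.

(** The candidate is the pointwise limit. It is kept in the conclusion because symmetry and other
    identities between values pass to the limit through it. *)
Lemma HS_complete (u : nat -> H ^ n -> R) : (forall k, HS_space (u k)) ->
  semi_cauchy HS_dot u ->
  exists A, [/\ HS_space A, forall h, u k h @[k --> \oo] --> A h
    & HSn (u k - A) @[k --> \oo] --> 0].
Proof.
move=> Hu cu.
have Hd k l : HS_space (u k - u l) by exact: (semi_subspaceB HS_inner).
have ptcvg h : exists a : R, u k h @[k --> \oo] --> a.
  suff /cauchy_cvgP/cvg_ex[a ua] : cauchy (u k h @[k --> \oo]) by exists a.
  apply: cauchy_exP => eps eps0.
  pose p := \prod_i `|h i|; have p0 : 0 <= p by exact: prodr_ge0.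
  have e1 : 0 < eps / (p + 1) by rewrite divr_gt0// ltr_wpDl.
  have [M HM] := cu _ e1; exists (u M h); exists M => // k /= Mk.
  rewrite -ball_normE /=; have := HS_eval_le h (Hd M k) => /le_lt_trans; apply.
  have := HM _ _ (leqnn M) Mk; rewrite ltr_pdivlMr ?ltr_wpDl// => /le_lt_trans -> //.
  by rewrite ler_wpM2l ?semi_norm_ge0// lerDl.
have /choice[A uA] := ptcvg.
have [M1 HM1] := cu 1 ltr01.
pose K := \sum_(k < M1.+1) HSn (u k) + 1.
have uK k : (M1 <= k)%N -> HSn (u k) <= K.
  move=> Mk; have := ler_semi_dist HS_inner (Hu k) (Hu M1).
  have := HM1 k M1 Mk (leqnn _) => lt le.
  have : HSn (u M1) <= \sum_(k < M1.+1) HSn (u k).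
    by rewrite big_ord_recr/= lerDr sumr_ge0// => i _; exact: semi_norm_ge0.
  rewrite /K /HSn in lt le *; lra.
have K0 : 0 <= K by exact: le_trans (semi_norm_ge0 _ _) (uK M1 (leqnn _)).
have mA : multilinear A.
  move=> i h a x y; apply: (cvg_unique _ (uA _)) => //.
  rewrite (_ : (fun k => _) = fun k => a * u k [ffun j => if j == i then x else h j] +
    u k [ffun j => if j == i then y else h j]).
    by apply: cvgD; [apply: cvgM; [exact: cvg_cst|]|].
  by apply/funext => k; have [mu_ _ _] := Hu k; exact: mu_.
have bA : bounded_form A.
  exists K => h; have c1 : `|u k h| @[k --> \oo] --> `|A h| by apply: cvg_norm; exact: uA.
  apply: (cvgr_to_le c1); near=> k.
  apply: le_trans (HS_eval_le h (Hu k)) _; rewrite ler_wpM2r ?prodr_ge0//.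
  by apply: uK; near: k; exact: nbhs_infty_ge.
have S_cvg N (w : nat -> H ^ n -> R) B : (forall h, w k h @[k --> \oo] --> B h) ->
    S N (w k) (w k) @[k --> \oo] --> S N B B.
  by move=> wB; apply: cvg_big => [|g _]; [exact: add_continuous|apply: cvgM]; exact: wB.
have HA : HS_space A.
  apply/HS_spaceP; split=> //; exists (K ^+ 2) => N.
  apply: (cvgr_to_le (S_cvg N _ _ uA)); near=> k.
  apply: le_trans (S_le N (Hu k)) _; rewrite lerXn2r ?nnegrE ?semi_norm_ge0//.
  by apply: uK; near: k; exact: nbhs_infty_ge.
exists A; split=> //.
have HdA k : HS_space (u k - A) by exact: (semi_subspaceB HS_inner).
apply/cvgr0Pnorm_le => eps eps0; have [M HM] := cu _ eps0.
exists M => // k /= Mk; rewrite ger0_norm ?semi_norm_ge0//.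
rewrite -(@ler_pXn2r _ 2)// ?nnegrE ?semi_norm_ge0 ?(ltW eps0)//.
rewrite (sqr_semi_norm HS_inner)//.
(* For fixed N the section is a finite sum of values, so l may tend to infinity inside it; the
   resulting bound does not depend on N. *)
apply: (cvgr_to_le (cvg_S (HdA k) (HdA k))); near=> N.
have c3 : S N (u k - u l) (u k - u l) @[l --> \oo] --> S N (u k - A) (u k - A).
  apply: (S_cvg N (fun l => u k - u l)) => h.
  by apply: cvgB; [exact: cvg_cst|exact: uA].
apply: (cvgr_to_le c3); near=> l.
apply: le_trans (S_le N (Hd k l)) _; rewrite lerXn2r ?nnegrE ?semi_norm_ge0 ?(ltW eps0)//.
by apply/ltW/HM => //; near: l; exact: nbhs_infty_ge.
Unshelve. all: by end_near. Qed.

Lemma HS_form_inner : semi_inner (HS_form (n := n) E) HS_dot.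
Proof.
have [D0 Dl Bl Bs Bp] := HS_inner; split.
- apply/HS_form_space; split=> //.
- move=> a A B /HS_form_space[HA sA] /HS_form_space[HB sB]; apply/HS_form_space.
  split; first exact: Dl.
  move=> s h; have EAB h' : (a *: A + B) h' = a * A h' + B h' by [].
  by rewrite !EAB sA sB.
- by move=> a A B C /HS_form_space[HA _] /HS_form_space[HB _] /HS_form_space[HC _]; exact: Bl.
- by move=> A B /HS_form_space[HA _] /HS_form_space[HB _]; exact: Bs.
- by move=> A /HS_form_space[HA _]; exact: Bp.
Qed.

Lemma HS_form_complete (u : nat -> H ^ n -> R) : (forall k, HS_form E (u k)) ->
  semi_cauchy HS_dot u ->
  exists2 A, HS_form E A & HSn (u k - A) @[k --> \oo] --> 0.
Proof.
move=> Fu cu; have [A [HA uA cA]] := HS_complete (fun k => proj1 ((HS_form_space _).1 (Fu k))) cu.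
exists A => //; apply/HS_form_space; split=> // s h.
apply: (cvg_unique _ (uA _)) => //.
rewrite (_ : (fun k => u k [ffun i => h (s i)]) = fun k => u k h); first exact: uA.
by apply/funext => k; have /HS_form_space[_ su] := Fu k; exact: su.
Qed.

Lemma HS_form_eq0 A : HS_form E A -> HSn A = 0 -> A = 0.
Proof.
move=> /HS_form_space[HA _] A0; apply/funext => h.
by have := HS_eval_le h HA; rewrite A0 mul0r normr_le0 => /eqP.
Qed.

Definition tensor_power (u : H) : H ^ n -> R := tensor [ffun=> u].

Lemma tensor_powerE u h : tensor_power u h = \prod_i ip (h i) u.
Proof. by apply: eq_bigr => i _; rewrite ffunE. Qed.

Lemma HS_form_tensor_power u : HS_form E (tensor_power u).
Proof.
apply/HS_form_space; split; first exact: HS_space_tensor.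
move=> s h; rewrite !tensor_powerE [RHS](reindex_inj (@perm_inj _ s)).
by apply: eq_bigr => i _; rewrite ffunE.
Qed.

Lemma HS_dot_tensor_power u v : HS_dot (tensor_power u) (tensor_power v) = ip u v ^+ n.
Proof.
rewrite HS_dot_tensor; last exact: HS_space_tensor.
rewrite tensor_powerE (eq_bigr (fun=> ip u v)) => [|i _]; last by rewrite ffunE dotC.
by rewrite prodr_const card_ord.
Qed.

Definition tensor_comb (r : seq (R * H)) : H ^ n -> R :=
  \sum_(p <- r) p.1 *: tensor_power p.2.

Lemma HS_form_tensor_comb r : HS_form E (tensor_comb r).
Proof.
have [D0 Dl _ _ _] := HS_form_inner; rewrite /tensor_comb.
elim: r => [|p r IH]; first by rewrite big_nil.
by rewrite big_cons; apply: Dl => //; exact: HS_form_tensor_power.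
Qed.

(** A form orthogonal to the powers of the vectors of U vanishes on the diagonal over U by the
    reproducing property, then on the whole diagonal by continuity, and polarization makes it 0. *)
Lemma tensor_comb_dense (U : set H) : dense U -> forall A, HS_form E A ->
  forall eps, 0 < eps ->
  exists2 r : seq (R * H), (forall p, p \in r -> U p.2) & HSn (A - tensor_comb r) < eps.
Proof.
move=> dU A FA eps eps0.
pose T : set (H ^ n -> R) :=
  [set tensor_comb r | r in [set r : seq (R * H) | forall p, p \in r -> U p.2]].
have [|||| B [r Ur <-] lt] := semi_dense HS_form_inner HS_form_complete (S := T) _ _ _ _ FA eps0.
- by exists [::] => //; rewrite /tensor_comb big_nil.
- move=> a _ _ [r1 U1 <-] [r2 U2 <-].
  exists ([seq (a * p.1, p.2) | p <- r1] ++ r2).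
    move=> p; rewrite mem_cat => /orP[/mapP[q qr ->]|]; [exact: U1 qr|exact: U2].
  rewrite /tensor_comb big_cat big_map scaler_sumr; congr (_ + _).
  by apply: eq_bigr => p _; rewrite scalerA.
- by move=> _ [r _ <-]; exact: HS_form_tensor_comb.
- move=> B FB orth; have /HS_form_space[HB sB] := FB; have [mB bB _] := HB.
  have B0 u : U u -> B [ffun=> u] = 0.
    move=> Uu; rewrite -HS_dot_tensor//; apply: orth; exists [:: (1, u)].
      by move=> p; rewrite inE => /eqP ->.
    by rewrite /tensor_comb big_seq1 scale1r.
  suff -> : B = 0 by rewrite (semi_form0 HS_inner)//; exact: HS_space0.
  apply/funext; apply: symmetric_polarization => // v.
  have /choice[w wP] : forall N : nat, exists w, U w /\ `|v - w| < N.+1%:R^-1.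
    move=> N; have := dU (ball v N.+1%:R^-1); case.
    - by exists v; apply: ballxx; rewrite invr_gt0.
    - exact: ball_open.
    - by move=> w [+ Uw]; rewrite -ball_normE => /= vw; exists w.
  have wv : w N @[N --> \oo] --> v.
    apply/cvgrPdist_le => e0 e00; have [M _ HM] := cvgr0_norm_lt _ (@cvg_harmonic R) _ e00.
    exists M => // N /= MN; apply/ltW; apply: lt_trans (wP N).2 _.
    by have := HM N MN; rewrite /= ger0_norm.
  have c : B [ffun=> w N] @[N --> \oo] --> B [ffun=> v].
    apply: bounded_multilinear_cvg => // i; rewrite ffunE.
    rewrite (_ : (fun N => _) = w)//; apply/funext => N; exact: ffunE.
  apply: (cvg_unique _ c) => //.
  rewrite (_ : (fun N => B [ffun=> w N]) = cst 0); first exact: cvg_cst.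
  by apply/funext => N; rewrite B0//; case: (wP N).
by exists r.
Qed.

End HilbertSchmidt.

(** * Borel sets generated by cosines of functionals *)

Section CosClosure.
Variables (R : realType) (X : normedModType R).

(* An algebra of bounded functions closed under bounded pointwise limits; that it
   contains all Borel indicators replaces the Stone-Weierstrass theorem. *)
Inductive cos_closure : (X -> R) -> Prop :=
| cos_closure_cos (l : {scalar X}) (c : R) : continuous l ->
    cos_closure (fun x => cos (l x - c))
| cos_closure_lin a f g : cos_closure f -> cos_closure g -> cos_closure (a *: f + g)
| cos_closure_lim (u : nat -> X -> R) f (M : R) : (forall n, cos_closure (u n)) ->
    (forall n x, `|u n x| <= M) -> (forall x, u n x @[n --> \oo] --> f x) ->
    cos_closure f.

Let C := cos_closure.

Lemma cos_closure_ext f g : C f -> f =1 g -> C g.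
Proof. by move=> Cf /funext <-. Qed.

Lemma cos_closure_cst a : C (cst a).
Proof.
have c0 : continuous (\0 : X -> R) by move=> x; exact: cvg_cst.
have C1 := @cos_closure_cos (\0 : {scalar X}) 0 c0.
have C0 := cos_closure_lin (-1) C1 C1.
apply: cos_closure_ext (cos_closure_lin a C1 C0) _ => x.
rewrite -[LHS]/(a * cos (0 - 0) + (-1 * cos (0 - 0) + cos (0 - 0))) subrr cos0 /=; ring.
Qed.

Lemma cos_closureZ a f : C f -> C (fun x => a * f x).
Proof.
move=> Cf; apply: cos_closure_ext (cos_closure_lin a Cf (cos_closure_cst 0)) _ => x.
by rewrite -[LHS]/(a * f x + 0) addr0.
Qed.

Lemma cos_closureD f g : C f -> C g -> C (fun x => f x + g x).
Proof.
move=> Cf Cg; apply: cos_closure_ext (cos_closure_lin 1 Cf Cg) _ => x.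
by rewrite -[LHS]/(1 * f x + g x) mul1r.
Qed.

Lemma cos_closureB f g : C f -> C g -> C (fun x => f x - g x).
Proof.
move=> Cf Cg; apply: cos_closure_ext (cos_closure_lin (-1) Cg Cf) _ => x.
by rewrite -[LHS]/(-1 * g x + f x) mulN1r addrC.
Qed.

Lemma cos_closure_bounded f : C f -> exists M, forall x, `|f x| <= M.
Proof.
elim=> [l c _|a {}f g _ [M fM] _ [K gK]|u {}f M _ _ uM uf].
- by exists 1 => x; exact: cos_max.
- exists (`|a| * M + K) => x; rewrite -[X in `|X|]/(a * f x + g x).
  by rewrite (le_trans (ler_normD _ _))// lerD// normrM ler_wpM2l.
exists M => x; have c1 : `|u n x| @[n --> \oo] --> `|f x| by exact: cvg_norm.
by apply: (cvgr_to_le c1); near=> n; exact: uM.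
Unshelve. all: by end_near. Qed.

Let cosM_cos (l m : {scalar X}) (a b : R) : continuous l -> continuous m ->
  C (fun x => cos (l x - a) * cos (m x - b)).
Proof.
move=> cl cm.
have C1 : C (fun x => cos ((l \+ m) x - (a + b))).
  by apply: (@cos_closure_cos (l \+ m)) => x; apply: cvgD; [exact: cl|exact: cm].
have C2 : C (fun x => cos ((l \- m) x - (a - b))).
  by apply: (@cos_closure_cos (l \- m)) => x; apply: cvgB; [exact: cl|exact: cm].
apply: cos_closure_ext (cos_closureZ 2^-1 (cos_closureD C1 C2)) _ => x /=.
have -> : l x + m x - (a + b) = (l x - a) + (m x - b) by ring.
have -> : l x - m x - (a - b) = (l x - a) - (m x - b) by ring.
by rewrite (cosD (l x - a)) (cosB (l x - a)); field.
Qed.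

Let cosM_lin (h f g : X -> R) a : C (fun x => h x * f x) -> C (fun x => h x * g x) ->
  C (fun x => h x * (a *: f + g) x).
Proof.
move=> C1 C2; apply: cos_closure_ext (cos_closure_lin a C1 C2) _ => x.
rewrite -[RHS]/(h x * (a * f x + g x)) -[LHS]/(a * (h x * f x) + h x * g x); ring.
Qed.

Let cosM_lim (h f : X -> R) (u : nat -> X -> R) M K : (forall x, `|h x| <= K) ->
  (forall n, C (fun x => h x * u n x)) ->
  (forall n x, `|u n x| <= M) -> (forall x, u n x @[n --> \oo] --> f x) ->
  C (fun x => h x * f x).
Proof.
move=> hK Cu uM uf; apply: (@cos_closure_lim (fun n x => h x * u n x) _ (K * M)) => //.
  by move=> n x; rewrite normrM ler_pM.
by move=> x; apply: cvgM; [exact: cvg_cst|exact: uf].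
Qed.

(** Two inductions: first one factor is a single cosine, then it is arbitrary. The factor held fixed
    is bounded, so that products with a bounded sequence stay uniformly bounded. *)
Lemma cos_closureM f g : C f -> C g -> C (fun x => f x * g x).
Proof.
have step (l : {scalar X}) a h : continuous l -> C h ->
    C (fun x => cos (l x - a) * h x).
  move=> cl; elim=> [m b cm|b f' g' _ IHf _ IHg|u f' M _ IH uM uf].
  - exact: cosM_cos.
  - exact: cosM_lin.
  - by apply: (cosM_lim (K := 1) _ IH uM uf) => x; exact: cos_max.
move=> Cf; have [K fK] := cos_closure_bounded Cf.
elim=> [m b cm|b f' g' _ IHf _ IHg|u f' M _ IH uM uf].
- by apply: cos_closure_ext (step m b f cm Cf) _ => x; rewrite mulrC.
- exact: cosM_lin.
- exact: (cosM_lim fK IH uM uf).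
Qed.

Lemma cos_closureX f n : C f -> C (fun x => f x ^+ n).
Proof.
move=> Cf; elim: n => [|n IH]; first exact: cos_closure_ext (cos_closure_cst 1) _.
by apply: cos_closure_ext (cos_closureM Cf IH) _ => x; rewrite exprS.
Qed.

Definition cos_measurable (A : set X) := C \1_A.

Lemma cos_measurableC A : cos_measurable A -> cos_measurable (~` A).
Proof.
move=> CA; apply: cos_closure_ext (cos_closureB (cos_closure_cst 1) CA) _ => x.
by rewrite indicC indicE/=; case: (x \in A); rewrite /= ?subrr ?subr0.
Qed.

Lemma cos_measurableI A B : cos_measurable A -> cos_measurable B ->
  cos_measurable (A `&` B).
Proof. by move=> CA CB; rewrite /cos_measurable indicI; exact: cos_closureM. Qed.

Lemma cos_measurableT : cos_measurable setT.
Proof. by apply: cos_closure_ext (cos_closure_cst 1) _ => x; rewrite indicT. Qed.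

Lemma cos_measurable0 : cos_measurable set0.
Proof. by apply: cos_closure_ext (cos_closure_cst 0) _ => x; rewrite indic0. Qed.

Lemma cos_measurable_lim (F : nat -> set X) A : (forall n, cos_measurable (F n)) ->
  (forall x, \forall n \near \oo, F n x <-> A x) -> cos_measurable A.
Proof.
move=> CF FA; apply: (cos_closure_lim (M := 1) CF) => [n x|x].
  by rewrite indicE; case: (x \in F n); rewrite ?normr1 ?normr0.
apply: cvg_near_cst; apply: filterS (FA x) => n /propext FAx.
by rewrite !indicE; congr (_%:R); congr nat_of_bool; apply/idP/idP; rewrite !inE FAx.
Qed.

Lemma cos_measurable_bigcap (F : nat -> set X) : (forall n, cos_measurable (F n)) ->
  cos_measurable (\bigcap_n F n).
Proof.
move=> CF; apply: (@cos_measurable_lim (fun n => \big[setI/setT]_(k < n) F k)) => [n|x].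
  by elim/big_ind: _ => //; [exact: cos_measurableT|exact: cos_measurableI].
have [h|/existsNP[k Fk]] := pselect (forall k, F k x).
  near=> n; split=> [_ k _//|_]; rewrite -bigcap_mkord => k _; exact: h.
exists k.+1 => // n kn; rewrite -bigcap_mkord; split=> /(_ k) h; exfalso; apply: Fk; exact: h.
Unshelve. all: by end_near. Qed.

Lemma cos_measurable_bigcup (F : nat -> set X) : (forall n, cos_measurable (F n)) ->
  cos_measurable (\bigcup_n F n).
Proof.
move=> CF; rewrite -[X in cos_measurable X]setCK setC_bigcup; apply: cos_measurableC.
by apply: cos_measurable_bigcap => n; exact: cos_measurableC.
Qed.

(** The powers of f tend to 1 where f = 1 and to 0 elsewhere. *)
Lemma cos_measurable_eq1 f : C f -> (forall x, 0 <= f x <= 1) ->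
  cos_measurable [set x | f x = 1].
Proof.
move=> Cf f01; apply: (@cos_closure_lim (fun n x => f x ^+ n) _ 1) => [n|n x|x].
- exact: cos_closureX.
- by have /andP[f0 f1] := f01 x; rewrite normrX exprn_ile1// ger0_norm.
rewrite indicE; have [/eqP fx1|fx1] := boolP (f x == 1).
  rewrite mem_set//= fx1; under eq_fun do rewrite expr1n; exact: cvg_cst.
rewrite memNset//=; last exact/eqP.
apply: cvg_expr; have /andP[f0 f1] := f01 x.
by rewrite ger0_norm// lt_neqAle fx1.
Qed.

(** Bernoulli's inequality and its companion (1 - a)^k <= 1 / (1 + k a), cleared of the
    denominator. *)
Lemma expr_onem_le (R' : realFieldType) (a : R') k : 0 <= a <= 1 ->
  1 - k%:R * a <= (1 - a) ^+ k /\ (1 - a) ^+ k * (1 + k%:R * a) <= 1.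
Proof.
move=> /andP[a0 a1]; have na0 : 0 <= 1 - a by rewrite subr_ge0.
elim: k => [|k [IH1 IH2]]; first by rewrite !mul0r subr0 addr0 expr0 mulr1.
have p0 : 0 <= (1 - a) ^+ k by rewrite exprn_ge0.
have p1 : (1 - a) ^+ k <= 1 by rewrite exprn_ile1// lerBlDr lerDl.
have k0 : 0 <= k%:R :> R' by [].
rewrite exprS -natr1; split; first by nra.
have -> : (1 - a) * (1 - a) ^+ k * (1 + (k%:R + 1) * a) =
  (1 - a) ^+ k * (1 + k%:R * a) - (1 - a) ^+ k * (k.+1%:R * a ^+ 2).
  by rewrite -natr1; ring.
by rewrite lerBlDr (le_trans IH2)// lerDl mulr_ge0// mulr_ge0// sqr_ge0.
Qed.

(** The step polynomials of Brosowski and Deutsch. With a = q^n and k = 2^n the product k a is (2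
    q)^n, which tends to 0 or to infinity according to the side of 1/2 on which q lies. *)
Let halfpow (q : R) : 0 <= q <= 1 -> q != 2^-1 ->
  (1 - q ^+ n) ^+ (2 ^ n) @[n --> \oo] --> ((q < 2^-1)%R%:R : R).
Proof.
move=> q01 qn; have /andP[q0 q1] := q01.
have a01 n : 0 <= q ^+ n <= 1 by rewrite exprn_ge0// exprn_ile1.
have E n : (2 ^ n)%N%:R * q ^+ n = (2 * q) ^+ n :> R by rewrite natrX exprMn.
have [lt|ge] := ltP q 2^-1.
  have c0 : (2 * q) ^+ n @[n --> \oo] --> (0 : R).
    by apply: cvg_expr; rewrite ger0_norm ?mulr_ge0//; lra.
  have c1 : 1 - (2 * q) ^+ n @[n --> \oo] --> (1 : R).
    by rewrite -[X in _ --> X]subr0; apply: cvgB => //; exact: cvg_cst.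
  have c2 : (fun _ : nat => 1 : R) @ \oo --> (1 : R) by exact: cvg_cst.
  apply: (squeeze_cvgr _ c1 c2); near=> n.
  rewrite -E (expr_onem_le _ (a01 n)).1 exprn_ile1//; have /andP[? ?] := a01 n; lra.
have gt : 2^-1 < q by rewrite lt_neqAle eq_sym qn.
have q20 : 0 < 2 * q by lra.
have c0 : ((2 * q)^-1) ^+ n @[n --> \oo] --> (0 : R).
  apply: cvg_expr; rewrite gtr0_norm ?invr_gt0// invf_lt1//; lra.
have c1 : (fun _ : nat => 0 : R) @ \oo --> (0 : R) by exact: cvg_cst.
apply: (squeeze_cvgr _ c1 c0); near=> n.
have /andP[a0 a1] := a01 n; have b0 : 0 <= 1 - q ^+ n by rewrite subr_ge0.
rewrite exprn_ge0//= exprVn -[leRHS]mul1r ler_pdivlMr ?exprn_gt0//.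
apply: le_trans (expr_onem_le (2 ^ n) (a01 n)).2.
by rewrite E ler_wpM2l ?exprn_ge0// lerDr.
Unshelve. all: by end_near. Qed.

Lemma cos_measurable_lt0 f : C f -> (forall x, `|f x| <= 1) ->
  cos_measurable [set x | f x < 0].
Proof.
move=> Cf f1.
(* The affine map g moves the threshold 0 to 1/2. On the zeros of f, where g = 1/2, [halfpow] says
   nothing; the indicator of the complement of N sets these points to 0. *)
pose N := [set x | 1 - f x ^+ 2 = 1]; pose g x := 2^-1 * (1 + f x).
have CN : cos_measurable N.
  apply: (cos_measurable_eq1 (f := fun x => 1 - f x ^+ 2)).
    apply: (cos_closureB (f := cst 1)); [exact: cos_closure_cst|exact: cos_closureX].
  move=> x; rewrite subr_ge0 lerBlDr lerDl sqr_ge0 andbT.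
  by rewrite -real_normK ?num_real// exprn_ile1.
have Cg : C g.
  by apply: cos_closureZ; apply: (cos_closureD (f := cst 1)) => //; exact: cos_closure_cst.
have g01 x : 0 <= g x <= 1 by have := f1 x; rewrite ler_norml /g; lra.
apply: (@cos_closure_lim (fun n x => \1_(~` N) x * (1 - g x ^+ n) ^+ (2 ^ n)) _ 1).
- move=> n; apply: cos_closureM; first exact: cos_measurableC.
  apply: cos_closureX; apply: (cos_closureB (f := cst 1)); first exact: cos_closure_cst.
  exact: cos_closureX.
- move=> n x; have /andP[g0 g1] := g01 x.
  have p0 : 0 <= 1 - g x ^+ n by rewrite subr_ge0 exprn_ile1.
  rewrite normrM -[leRHS]mulr1 ler_pM//.
    by rewrite indicE; case: (x \in _); rewrite ?normr1 ?normr0.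
  by rewrite ger0_norm ?exprn_ge0// exprn_ile1// lerBlDr lerDl exprn_ge0.
move=> x; have [f0|f0] := eqVneq (f x) 0.
  rewrite [X in _ --> X]indicE memNset /= ?f0 ?ltxx//.
  have -> : \1_(~` N) x = 0 :> R.
    by rewrite indicE memNset//; apply; rewrite /N /= f0 expr0n subr0.
  under eq_fun do rewrite mul0r; exact: cvg_cst.
have Nx : ~ N x.
  rewrite /N /= => /eqP; rewrite -subr_eq0 addrAC subrr add0r oppr_eq0 sqrf_eq0.
  by rewrite (negbTE f0).
have -> : \1_(~` N) x = 1 :> R by rewrite indicE mem_set.
under eq_fun do rewrite mul1r.
rewrite indicE; have -> : (x \in [set x | f x < 0]) = (g x < 2^-1).
  by rewrite /g; apply/idP/idP; rewrite inE /=; lra.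
apply: halfpow => //; apply: contra f0 => /eqP; rewrite /g => h; apply/eqP; lra.
Qed.

Lemma cos_measurable_halfspace (l : {scalar X}) c : continuous l ->
  cos_measurable [set x | l x < c].
Proof.
(* For n large, [y n x] is so small that its sine has the sign of [l x - c]. *)
move=> cl; pose y n x := n.+1%:R^-1 * (l x - c).
apply: (@cos_measurable_lim (fun n => [set x | sin (y n x) < 0])) => [n|x].
  apply: cos_measurable_lt0; last by move=> x; exact: sin_max.
  have cln : continuous (n.+1%:R^-1 \*: l).
    by move=> x; apply: cvgM; [exact: cvg_cst|exact: cl].
  apply: cos_closure_ext (cos_closure_cos (n.+1%:R^-1 * c + pi / 2) cln) _ => x.
  by rewrite /= opprD addrA cosBpihalf -mulrBr.
have : y n x @[n --> \oo] --> 0.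
  by rewrite -[X in _ --> X](mul0r (l x - c)); apply: cvgM; [exact: cvg_harmonic|exact: cvg_cst].
move=> /cvgr0_norm_lt/(_ _ (pi_gt0 R)); apply: filterS => n.
have n0 : 0 < n.+1%:R^-1 :> R by rewrite invr_gt0.
rewrite ltr_norml => /andP[y1 y2] /=.
have E : (l x < c) = (y n x < 0) by rewrite /y pmulr_rlt0// subr_lt0.
rewrite E; have [yx|yx|->] := ltgtP (y n x) 0.
- split=> // _; rewrite -oppr_gt0 -sinN sin_gt0_pi// oppr_gt0 yx/=; lra.
- by split => // s0; have := @sin_gt0_pi R (y n x); rewrite yx y2 => /(_ isT); lra.
- by rewrite sin0 ltxx.
Qed.

End CosClosure.

(** * From half-spaces to all Borel sets *)

Section BorelCosClosure.
Variables (R : realType) (X : completeNormedModType R).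
Hypothesis sepX : separable X.

Lemma separable_sequence : exists d : nat -> X, forall x eps, 0 < eps ->
  exists n, `|x - d n| < eps.
Proof.
have [D cD dD] := sepX.
have near x eps : 0 < eps -> exists2 y, D y & `|x - y| < eps.
  move=> eps0; have [|y [By Dy]] := dD (ball x eps) _ (ball_open x eps).
    by exists x; exact: ballxx.
  by exists y => //; move: By; rewrite -ball_normE.
move: cD => /pfcard_geP[D0|[f]].
  by have [y] := near 0 1 ltr01; rewrite D0.
exists f => x eps eps0; have [y Dy xy] := near x _ eps0.
by have [n _ fn] := @surj _ _ _ _ f _ Dy; exists n; rewrite fn.
Qed.

(** The ball is cut out by the half-spaces of functionals norming a dense sequence: if d n is close
    to x - a, the functional of d n nearly norms x - a as well. The sign -1 turns a closed
    half-space into the complement of an open one. *)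
Let cos_measurable_ball (a : X) r : cos_measurable [set x | `|x - a| <= r].
Proof.
have [d dd] := separable_sequence.
have [l Hl] := choice (fun x0 : X => norming_functional x0).
rewrite (_ : mkset _ = \bigcap_n ~` [set x | ((-1) \*: l (d n)) x < - (r + l (d n) a)]).
  apply: cos_measurable_bigcap => n; apply: cos_measurableC.
  apply: (@cos_measurable_halfspace _ _ ((-1) \*: l (d n))) => x.
  by apply: cvgM; [exact: cvg_cst|have [cl _ _] := Hl (d n); exact: cl].
apply/seteqP; split=> [x xr n _ /=|x xr].
  have [_ ln _] := Hl (d n); apply/negP; rewrite /GRing.scale/= mulN1r ltrN2 -leNgt -lerBlDr -raddfB.
  by rewrite (le_trans (ler_norm _))// (le_trans (ln _)).
rewrite /=; apply/ler_addgt0Pl => eps eps0.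
have e2 : 0 < eps / 2 by rewrite divr_gt0.
have [n] := dd (x - a) _ e2; set y := x - a => yd.
have [_ ln ld] := Hl (d n).
have := xr n I; rewrite /= /GRing.scale/= mulN1r => /negP; rewrite ltrN2 -leNgt -lerBlDr -raddfB -/y => ly.
have h1 := ln (d n - y); rewrite distrC in yd.
have h2 := ler_norm (l (d n) (d n - y)); rewrite raddfB/= ld in h2 h1.
have h3 : `|y| <= `|d n| + `|d n - y| by rewrite -{1}(subKr (d n) y) ler_normB.
lra.
Qed.

(** In a separable space U is the union of the countably many closed balls with radius 1 / (j + 1)
    and center in a dense sequence that it contains. *)
Lemma cos_measurable_open (U : set X) : open U -> cos_measurable U.
Proof.
move=> oU; have [d dd] := separable_sequence.
pose F n := if unpickle n is Some (i, j) then
  if pselect ([set x | `|x - d i| <= j.+1%:R^-1] `<=` U)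
  then [set x | `|x - d i| <= j.+1%:R^-1] else set0 else set0.
rewrite (_ : U = \bigcup_n F n).
  apply: cos_measurable_bigcup => n; rewrite /F.
  case: (unpickle n) => [[i j]|]; last exact: cos_measurable0.
  case: pselect => ?; [exact: cos_measurable_ball|exact: cos_measurable0].
apply/seteqP; split=> [x Ux|x [n _]]; last first.
  rewrite /F; case: (unpickle n) => [[i j]|//]; case: pselect => // sU; exact: sU.
have /nbhs_ballP[eps /= eps0 xU] : nbhs x U by exact: open_nbhs_nbhs.
have [j] : exists j : nat, j.+1%:R^-1 < eps / 2.
  have [j _ /(_ j (leqnn j))] := near_infty_natSinv_lt (PosNum (divr_gt0 eps0 (ltr0n R 2))).
  by exists j.
move=> jeps; have j0 : 0 < j.+1%:R^-1 :> R by rewrite invr_gt0.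
have [i di] := dd x _ j0.
exists (pickle (i, j)) => //; rewrite /F pickleK; case: pselect => [?|].
  exact: ltW.
case=> y /= yd; apply: xU; rewrite -ball_normE /=.
rewrite (le_lt_trans (ler_distD (d i) x y))// [`|d i - y|]distrC (splitr eps).
by rewrite ltrD// (lt_trans di, le_lt_trans yd).
Qed.

Lemma borel_cos_measurable (A : set (borel X)) : measurable A -> cos_measurable A.
Proof.
apply: smallest_sub; last exact: cos_measurable_open.
split; first exact: cos_measurable0.
- by move=> B CB; rewrite setTD; exact: cos_measurableC.
- exact: cos_measurable_bigcup.
Qed.

End BorelCosClosure.

Section SemiClosure.
Variables (R : realType) (V : lmodType R) (D : set V) (B : V -> V -> R).
Hypothesis SI : semi_inner D B.
Variable S : set V.
Hypotheses (S0 : S 0) (Slin : forall a u v, S u -> S v -> S (a *: u + v)) (SD : S `<=` D).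
Local Notation N := (semi_norm B).

Definition semi_closure : set V :=
  [set v | D v /\ forall eps, 0 < eps -> exists2 s, S s & N (v - s) < eps].

Lemma sub_semi_closure : S `<=` semi_closure.
Proof.
move=> s Ss; split=> [|eps eps0]; first exact: SD.
by exists s => //; rewrite subrr (semi_norm0 SI).
Qed.

Lemma semi_closure_lin a u v : semi_closure u -> semi_closure v -> semi_closure (a *: u + v).
Proof.
move=> [Du Su] [Dv Sv]; split=> [|eps eps0]; first exact: (semi_space_lin SI).
have a0 : 0 < `|a| + 1 by rewrite ltr_wpDl.
have [s Ss us] := Su (eps / 2 / (`|a| + 1)) (divr_gt0 (divr_gt0 eps0 (ltr0n R 2)) a0).
have [t St vt] := Sv _ (divr_gt0 eps0 (ltr0n R 2)).
exists (a *: s + t); first exact: Slin.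
have Dus := semi_subspaceB SI Du (SD Ss); have Dvt := semi_subspaceB SI Dv (SD St).
have -> : a *: u + v - (a *: s + t) = a *: (u - s) + (v - t).
  by rewrite scalerBr opprD addrACA.
apply: le_lt_trans (ler_semi_normD SI (semi_subspaceZ SI a Dus) Dvt) _.
rewrite (splitr eps) (semi_normZ SI)// ler_ltD//.
move: us; rewrite ltr_pdivlMr// => /ltW; apply: le_trans.
by rewrite mulrC ler_wpM2l ?semi_norm_ge0// lerDl.
Qed.

Lemma semi_closure_closed v : D v ->
  (forall eps, 0 < eps -> exists2 u, semi_closure u & N (v - u) < eps) -> semi_closure v.
Proof.
move=> Dv Cv; split=> // eps eps0; have e2 := divr_gt0 eps0 (ltr0n R 2).
have [u [Du Su] vu] := Cv _ e2; have [s Ss us] := Su _ e2; exists s => //.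
apply: le_lt_trans (ler_semi_normB SI Dv Du (SD Ss)) _.
by rewrite (splitr eps) ltrD.
Qed.

Lemma semi_closure_cvg (u : nat -> V) v : (forall n, semi_closure (u n)) -> D v ->
  N (u n - v) @[n --> \oo] --> 0 -> semi_closure v.
Proof.
move=> Cu Dv uv; apply: semi_closure_closed => // eps eps0.
have [M _ HM] := cvgr0_norm_lt _ uv _ eps0; exists (u M) => //.
rewrite (semi_normBC SI)//; last by case: (Cu M).
by have := HM M (leqnn M); rewrite /= ger0_norm ?semi_norm_ge0.
Qed.

End SemiClosure.

Section L2Dominated.
Context d (T : measurableType d) (R : realType) (mu : {measure set T -> \bar R}).

Lemma L2fun_le (f g : T -> R) : measurable_fun setT f -> L2fun mu g -> (forall x, `|f x| <= g x) ->
  L2fun mu f.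
Proof.
move=> mf /L2funP[mg Ig] fg; apply/L2funP; split => //.
apply: le_integrable Ig => // [|x _]; first exact/measurable_EFinP/measurable_funX.
have g0 : 0 <= g x by exact: le_trans (fg x).
by rewrite /= lee_fin !normrX (ger0_norm g0) lerXn2r ?nnegrE.
Qed.

Lemma L2_dominated (u : nat -> T -> R) (f g : T -> R) : (forall n, measurable_fun setT (u n)) ->
  L2fun mu g -> (forall n x, `|u n x| <= g x) -> (forall x, u n x @[n --> \oo] --> f x) ->
  L2fun mu f /\ L2n mu (u n - f) @[n --> \oo] --> 0.
Proof.
move=> mu_ gL ug uf; have mf := measurable_fun_cvg mu_ (fun x _ => uf x).
have fg x : `|f x| <= g x.
  have c1 : `|u n x| @[n --> \oo] --> `|f x| by exact: cvg_norm.
  by apply: (cvgr_to_le c1); near=> n; exact: ug.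
have fL := L2fun_le mf gL fg; split => //.
have [mg Ig] := (L2funP mu g).1 gL.
pose h n x : \bar R := ((u n x - f x) * (u n x - f x))%:E.
have hc : (\int[mu]_x h n x)%E @[n --> \oo] --> (\int[mu]_x (cst 0 x))%E.
  (* The majorant 4 g^2 comes from |u n x - f x| <= 2 g x. *)
  apply: (@dominated_cvg _ _ _ mu setT measurableT h (cst 0%E) (fun x => (4 * g x ^+ 2)%:E)).
  - by move=> n; apply/measurable_EFinP; apply: measurable_funM; exact: measurable_funB.
  - move=> x _; apply: cvg_EFin; first by near=> n.
    rewrite [X in X @ _](_ : _ = fun n => (u n x - f x) * (u n x - f x))//.
    have c : u n x - f x @[n --> \oo] --> (0 : R).
      by rewrite -(subrr (f x)); apply: cvgB; [exact: uf|exact: cvg_cst].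
    by rewrite -[X in _ --> X](mul0r (0 : R)); exact: cvgM.
  - by [].
  - rewrite (_ : (fun x => _) = fun x => (4%:E * (g x ^+ 2)%:E)%E)//.
    exact: integrableZl.
  move=> n x _; rewrite lee_fin normrM -expr2.
  have := ler_normB (u n x) (f x); have := ug n x; have := fg x.
  have : 0 <= `|u n x - f x| by []. set a := `|u n x - f x| => *.
  nra.
rewrite integral0 in hc.
have {}hc : fine (\int[mu]_x h n x)%E @[n --> \oo] --> (0 : R) by exact: (fine_cvg hc).
have -> : (0 : R) = Num.sqrt 0 by rewrite sqrtr0.
rewrite (_ : (fun n => L2n mu (u n - f)) = fun n => Num.sqrt (fine (\int[mu]_x h n x)%E))//.
by apply: continuous_cvg hc; exact: sqrt_continuous.
Unshelve. all: by end_near. Qed.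

Lemma L2n_ae f g : L2fun mu f -> L2fun mu g -> f = g %[ae mu] -> L2n mu (f - g) = 0.
Proof.
move=> fL gL fg; have fgL := semi_subspaceB (L2_inner mu) fL gL.
have fg0 : f - g = 0 %[ae mu].
  by apply: (filterS _ fg) => x fgx xT; rewrite -[LHS]/(f x - g x) fgx// subrr.
by rewrite (L2n_ae_eq fgL (L2fun0 mu) fg0) [LHS](semi_norm0 (L2_inner mu)).
Qed.

End L2Dominated.

Import HBSimple HBNNSimple.

Section L2Generated.
Context d (T : measurableType d) (R : realType) (mu : probability T R).
Variable K : set (T -> R).
Hypothesis Klin : forall a f g, K f -> K g -> K (a *: f + g).
Hypothesis Kcvg : forall (u : nat -> T -> R) f, (forall n, K (u n)) -> L2fun mu f ->
  L2n mu (u n - f) @[n --> \oo] --> 0 -> K f.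
Hypothesis Kindic : forall A, measurable A -> K \1_A.

Let K0 : K 0.
Proof. by have := Kindic measurable0; rewrite indic0. Qed.

Let Ksimple (s : {nnsfun T >-> R}) : K s.
Proof.
have -> : (s : T -> R) = \sum_(y <- finmap.enum_fset (fset_set (range s))) y *: \1_(s @^-1` [set y]).
  apply/funext => x; rewrite fimfunE fsbig_finite//=.
  by elim/big_rec2: _ => [|y f1 f2 _ ->].
elim/big_rec: _ => // y f _ Kf; apply: Klin => //; apply: Kindic.
exact: measurable_funPTI.
Qed.

(** The positive and negative parts are limits of simple functions that they dominate, so the
    convergence also holds in L^2. *)
Lemma L2fun_generated f : L2fun mu f -> K f.
Proof.
have step g : L2fun mu g -> (forall x, 0 <= g x) -> K g.
  move=> gL g0; have mg : measurable_fun setT (EFin \o g).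
    by apply/measurable_EFinP; exact: (L2fun_measurable gL).
  pose u n := nnsfun_approx measurableT mg n.
  have ug x : u n x @[n --> \oo] --> g x.
    exact: (fine_cvg (cvg_nnsfun_approx measurableT mg (fun x _ => g0 x) Logic.I)).
  have le n x : `|u n x| <= g x.
    have u0 k : 0 <= u k x by [].
    rewrite ger0_norm//.
    apply: (cvgr_to_ge (ug x)); exists n => // m /= nm.
    by have /lefP := nd_nnsfun_approx measurableT mg nm; apply.
  have [_ c] := L2_dominated (fun n => @measurable_funP _ _ _ _ _ (u n)) gL le ug.
  by apply: (Kcvg (u := fun n => u n)) => // n; exact: Ksimple.
move=> fL; have mf := L2fun_measurable fL.
have aL : L2fun mu (fun x => `|f x|).
  apply/L2funP; split; first exact: measurableT_comp.
  have [_] := (L2funP mu f).1 fL.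
  by under [X in _ -> _.-integrable _ X]eq_fun do rewrite real_normK ?num_real//.
have pL : L2fun mu f^\+.
  apply: L2fun_le aL _ => [|x]; first exact: measurable_funrpos.
  by rewrite ger0_norm ?funrpos_ge0// /funrpos ge_max ler_norm normr_ge0.
have nL : L2fun mu f^\-.
  apply: L2fun_le aL _ => [|x]; first exact: measurable_funrneg.
  by rewrite ger0_norm ?funrneg_ge0// /funrneg ge_max -normrN ler_norm normr_ge0.
by rewrite -(funrposBneg f) addrC -scaleN1r; apply: Klin; apply: step.
Qed.

End L2Generated.

(** * The chaos expansion *)

Section RepresentedVectors.
Variables (R : realType) (X H : completeNormedModType R).
Variables (mu : probability (borel X) R) (ip : {dot H for idfun}).
Variable iota : {linear H -> X}.
Hypothesis CM : cameron_martin mu ip iota.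

Definition represented : set H :=
  [set u | exists2 l : {scalar X}, continuous l & represents ip iota l u].

Lemma dense_represented : dense represented.
Proof.
have [[ipn' _] iinj _ _ rep] := CM.
have ipn h : `|h| ^+ 2 = ip h h by exact: ipn'.
have complete (u : nat -> H) : (forall n, setT (u n)) -> semi_cauchy ip u ->
    exists2 v, setT v & semi_norm ip (u n - v) @[n --> \oo] --> 0.
  move=> _ cu; suff /cauchy_cvgP/cvg_ex[v uv] : cauchy (u k @[k --> \oo]).
    exists v => //; rewrite (_ : (fun n => _) = fun n => `|u n - v|).
      rewrite -(@normr0 _ H) -(subrr v); apply: cvg_norm; apply: cvgB => //.
      exact: cvg_cst.
    by apply/funext => n; rewrite dot_semi_norm.
  apply: cauchy_exP => eps eps0; have [M HM] := cu _ eps0.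
  exists (u M); exists M => // k /= Mk; rewrite -ball_normE /=.
  by have := HM _ _ (leqnn M) Mk; rewrite dot_semi_norm.
have Slin a u v : represented u -> represented v -> represented (a *: u + v).
  move=> [l cl lu] [m cm mv]; exists (a \*: l \+ m).
    by move=> x; apply: cvgD; [apply: cvgM; [exact: cvg_cst|exact: cl]|exact: cm].
  by move=> h; rewrite linearDl/= linearZl_LR/= lu mv.
have S0 : represented 0.
  have c0 : continuous (\0 : X -> R) by move=> x; exact: cvg_cst.
  by exists (\0 : {scalar X}) => // h; rewrite linear0l.
(* If v is orthogonal to all represented vectors, a functional norming iota v gives |iota v| = (u,
   v) = 0, and [iota] is injective. *)
have orth v : setT v -> (forall s, represented s -> ip v s = 0) -> ip v v = 0.
  move=> _ vS; suff -> : v = 0 by rewrite linear0l.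
  apply: iinj; rewrite linear0; apply/eqP; rewrite -normr_eq0.
  have [l [cl _ lx]] := norming_functional (iota v).
  have [u [lu _ _]] := rep _ cl.
  by rewrite -lx -lu dotC vS//; exists l.
move=> O [v Ov] oO; have : nbhs v O by exact: open_nbhs_nbhs.
move=> /nbhs_ballP[eps /= eps0 vO].
have [s Ss vs] := semi_dense (dot_inner ipn) complete S0 Slin (@subsetT _ _) orth (I : setT v) eps0.
exists s; split => //; apply: vO; rewrite -ball_normE /=.
by rewrite -(dot_semi_norm ipn).
Qed.

End RepresentedVectors.

(** * Isometry, orthogonality and completeness of the chaoses *)

Section WienerChaos.
Variables (R : realType) (X H : completeNormedModType R).
Variables (mu : probability (borel X) R) (ip : {dot H for idfun}).
Variables (iota : {linear H -> X}) (E : set H).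
Variable J : forall n : nat, (H ^ n -> R) -> borel X -> R.
Arguments J : clear implicits.
Hypothesis sepX : separable X.
Hypothesis gauss_mu : centered_gaussian mu.
Hypothesis CM : cameron_martin mu ip iota.
Hypothesis basisE : orthonormal_basis ip E.
Hypothesis intJ : forall n, multiple_integral mu ip iota E (J n).
Variables (e : nat -> H) (code : H -> nat).
Hypothesis eE : enumerates E e code.

Let ipn h : `|h| ^+ 2 = ip h h. Proof. by have [[]] := CM. Qed.

Lemma J_L2 n A : HS_form E A -> L2fun mu (J n A).
Proof. by move=> FA; have [[IL _] _ _] := intJ n; exact: IL. Qed.

Lemma J_lin n a A B : HS_form E A -> HS_form E B ->
  J n (a *: A + B) = a *: J n A + J n B %[ae mu].
Proof. by move=> FA FB; have [[_ Ilin] _ _] := intJ n; exact: Ilin. Qed.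

Let FI n := HS_form_inner basisE eE n.

Lemma L2dot_J_lin n a A B f : HS_form E A -> HS_form E B -> L2fun mu f ->
  L2dot mu (J n (a *: A + B)) f = a * L2dot mu (J n A) f + L2dot mu (J n B) f.
Proof.
move=> FA FB fL; have FAB := semi_space_lin (FI n) a FA FB.
rewrite -(L2dot_lin a (J_L2 FA) (J_L2 FB) fL).
apply: (L2dot_ae (J_L2 FAB) (L2fun_lin a (J_L2 FA) (J_L2 FB)) fL).
exact: J_lin.
Qed.

Lemma J_bound n : exists2 C : R, 0 <= C & forall A, HS_form E A ->
  L2n mu (J n A) <= C * HSn e A.
Proof.
have [_ [C IC] _] := intJ n; exists `|C| => // A FA.
have := IC A FA; rewrite (L2norm_fin (J_L2 FA)) lee_fin => /le_trans; apply.
have /HS_form_space[HA _] := FA.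
rewrite (HS_normE basisE eE HA) ler_wpM2r ?ler_norm// semi_norm_ge0//.
Qed.

Lemma poly_L2 (l : {scalar X}) (p : {poly R}) : continuous l ->
  L2fun mu (fun x => p.[l x]).
Proof.
move=> cl; apply/L2funP; split.
  apply: borel_continuous => x; apply: continuous_comp; first exact: cl.
  exact: continuous_horner.
by under eq_fun do rewrite expr2; exact: (gaussian_poly_integrable gauss_mu p p cl cl).
Qed.

Lemma J_form0 n : J n 0 = 0 %[ae mu].
Proof.
have F0 := semi_space0 (FI n); have := J_lin (-1) F0 F0.
rewrite scaler0 addr0; apply: filterS => x /= E0 _.
rewrite (E0 Logic.I) -[LHS]/(-1 * J n 0 x + J n 0 x) -[RHS]/(0 : R); ring.
Qed.

Let J_tensor_power_unit n (l : {scalar X}) u : continuous l ->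
  represents ip iota l u -> `|u| = 1 ->
  J n (tensor_power ip u) = (fun x => (hpoly 1 n).[l x]) %[ae mu].
Proof.
move=> cl lu u1; have [_ _ Ifin] := intJ n.
have := Ifin 1 (fun _ => l) (fun _ => u) (fun _ => n) (tensor_power ip u).
move=> /(_ (fun _ => cl) (fun _ => lu)) [].
- by move=> i j; rewrite !ord1 eqxx -ipn u1 expr1n.
- by rewrite big_ord1.
- exact: (HS_form_tensor_power ipn basisE eE).
- move=> h; rewrite tensor_powerE big_ord1 (eq_bigr (fun=> ip h u)) => [|i _].
    by rewrite prodr_const card_ord.
  by rewrite ffunE.
move=> N [mN N0 sN]; exists N; split => // x /= nx; apply: sN => /= h; apply: nx => xT.
by rewrite (h xT) big_ord1 hermite_hpoly.
Qed.

(** A nonzero u is c times a unit vector, and both sides scale by c^n. For u = 0 there is no unit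
    vector to use: degree 0 is read off from the empty orthonormal system, and in positive degree
    both sides vanish almost everywhere, the right one because its norm is 0. *)
Lemma J_tensor_power n (l : {scalar X}) u : continuous l ->
  represents ip iota l u ->
  J n (tensor_power ip u) = (fun x => (hpoly (`|u| ^+ 2) n).[l x]) %[ae mu].
Proof.
move=> cl lu; have [u0|u0] := eqVneq u 0; last first.
  pose c := `|u|; have c0 : c != 0 by rewrite normr_eq0.
  pose u1 := c^-1 *: u; pose l1 : {scalar X} := c^-1 \*: l.
  have cl1 : continuous l1 by move=> x; apply: cvgM; [exact: cvg_cst|exact: cl].
  have lu1 : represents ip iota l1 u1 by move=> h; rewrite dotZl lu.
  have nu1 : `|u1| = 1 by rewrite normrZ gtr0_norm ?mulVf// invr_gt0 normr_gt0.
  have uE : u = c *: u1 by rewrite scalerA divff// scale1r.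
  have TE : tensor_power (n := n) ip u = c ^+ n *: tensor_power ip u1 + 0.
    rewrite addr0; apply/funext => h; rewrite /= /GRing.scale/= !tensor_powerE uE.
    by rewrite (eq_bigr (fun i => c * ip (h i) u1)) ?big_split/= ?prodr_const ?card_ord// => i _; rewrite dotZr.
  have := J_lin (c ^+ n) (HS_form_tensor_power ipn basisE eE n u1) (semi_space0 (FI n)).
  rewrite -TE; have := @J_tensor_power_unit n l1 u1 cl1 lu1 nu1.
  move=> h1 h2; have h3 := J_form0 n.
  apply: (filterS3 _ _ h1 h2 h3) => x {}h1 {}h2 {}h3 xT.
  rewrite (h2 xT) -[LHS]/(c ^+ n * J n (tensor_power ip u1) x + J n 0 x) (h1 xT) (h3 xT).
  rewrite addr0 -hpoly_homogeneous; congr _.[_].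
  by rewrite /l1 /= /GRing.scale/= mulrA divff// mul1r.
case: n => [|n].
  have [_ _ Jfin] := intJ 0.
  have := Jfin 0 (fun _ => l) (fun _ => u) (fun _ => 0) (tensor_power ip u).
  move=> /(_ (fun _ => cl) (fun _ => lu)) [].
  - by case.
  - by rewrite big_ord0.
  - exact: (HS_form_tensor_power ipn basisE eE).
  - by move=> h; rewrite tensor_powerE !big_ord0.
  move=> N [mN N0 sN]; exists N; split => // x /= nx; apply: sN => /= h; apply: nx => xT.
  by rewrite (h xT) big_ord0 hornerC.
have TE : tensor_power (n := n.+1) ip u = 0.
  by apply/funext => h; rewrite tensor_powerE big_ord_recl u0 linear0r mul0r.
rewrite TE; have hL : L2fun mu (fun x => (hpoly (`|u| ^+ 2) n.+1).[l x]) by exact: poly_L2.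
have : (fun x : borel X => (hpoly (`|u| ^+ 2) n.+1).[l x]) = 0 %[ae mu].
  apply: L2n_eq0 => //; first exact: L2fun0.
  rewrite subr0 /L2n /semi_norm /L2dot (hpoly_orthogonal gauss_mu CM _ _ cl cl lu lu).
  by rewrite u0 linear0l expr0n/= !mulr0 sqrtr0.
move=> h1; have h2 := J_form0 n.+1.
by apply: (filterS2 _ _ h1 h2) => x {}h1 {}h2 xT; rewrite (h1 xT) (h2 xT).
Qed.

Lemma L2dot_J_comb n r f : L2fun mu f ->
  L2dot mu (J n (tensor_comb ip r)) f =
  \sum_(p <- r) p.1 * L2dot mu (J n (tensor_power ip p.2)) f.
Proof.
move=> fL; rewrite /tensor_comb; elim: r => [|p r IH].
  rewrite !big_nil (L2dot_ae (J_L2 (semi_space0 (FI n))) (L2fun0 mu) fL (J_form0 n)).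
  exact: (semi_form0 (L2_inner mu)).
rewrite !big_cons L2dot_J_lin ?IH//; first exact: (HS_form_tensor_power ipn basisE eE).
exact: (HS_form_tensor_comb ipn basisE eE).
Qed.

Let HS_dot_comb n r (B : H ^ n -> R) : HS_form E B ->
  HS_dot e (tensor_comb ip r) B = \sum_(p <- r) p.1 * HS_dot e (tensor_power ip p.2) B.
Proof.
move=> FB; have FT p := HS_form_tensor_power ipn basisE eE n p.
have FpT (p : R * H) : HS_form E (p.1 *: tensor_power (n := n) ip p.2).
  exact: (semi_subspaceZ (FI n)).
have [_ ->] := semi_form_sum (FI n) r FpT FB.
by apply: eq_bigr => p _; rewrite (semi_formZ (FI n)).
Qed.

Lemma L2dot_J_tensor_power n m u v : represented ip iota u -> represented ip iota v ->
  L2dot mu (J n (tensor_power ip u)) (J m (tensor_power ip v)) =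
  (n == m)%:R * (n`!%:R * ip u v ^+ n).
Proof.
move=> [l cl lu] [l' cl' lv].
rewrite -(hpoly_orthogonal gauss_mu CM n m cl cl' lu lv).
have TF k w := HS_form_tensor_power ipn basisE eE k w.
have pL k s := @poly_L2 l (hpoly s k) cl; have pL' k s := @poly_L2 l' (hpoly s k) cl'.
rewrite (L2dot_ae (J_L2 (TF n u)) (pL n (`|u| ^+ 2)) (J_L2 (TF m v)) (J_tensor_power n cl lu)).
rewrite L2dotC//; last exact: J_L2.
rewrite (L2dot_ae (J_L2 (TF m v)) (pL' m (`|v| ^+ 2)) (pL n (`|u| ^+ 2)) (J_tensor_power m cl' lv)).
by rewrite L2dotC.
Qed.

(** The density argument shared by orthogonality and isometry: an identity for tensor powers of
    represented vectors extends to all forms, one argument at a time. [K] has no prescribed sign,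
    whence |K| + 1. *)
Let vanishing n (F : (H ^ n -> R) -> R) (K : R) :
  (forall r : seq (R * H), (forall p, p \in r -> represented ip iota p.2) ->
    F (tensor_comb ip r) = 0) ->
  (forall A B, HS_form E A -> HS_form E B -> `|F A - F B| <= K * HSn e (A - B)) ->
  forall A, HS_form E A -> F A = 0.
Proof.
move=> F0 FK A FA; apply/eqP; rewrite -normr_le0; apply/ler_addgt0Pl => eps eps0.
rewrite addr0.
have e1 : 0 < eps / (`|K| + 1) by rewrite divr_gt0// ltr_wpDl.
have [r rU lt] := tensor_comb_dense ipn basisE eE (dense_represented CM) FA e1.
have FT := HS_form_tensor_comb ipn basisE eE n r.
have := FK _ _ FA FT; rewrite F0// subr0 => /le_trans; apply.
move: lt; rewrite ltr_pdivlMr ?ltr_wpDl// => /ltW; apply: le_trans.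
rewrite mulrC ler_wpM2l ?semi_norm_ge0// (le_trans (ler_norm _))// lerDl//.
Qed.

Let L2dot_J_continuous n (A B : H ^ n -> R) f (C : R) : L2fun mu f ->
  (forall A, HS_form E A -> L2n mu (J n A) <= C * HSn e A) ->
  HS_form E A -> HS_form E B ->
  `|L2dot mu (J n A) f - L2dot mu (J n B) f| <= C * L2n mu f * HSn e (A - B).
Proof.
move=> fL JC FA FB; have FBA := semi_subspaceB (FI n) FA FB.
have -> : L2dot mu (J n A) f - L2dot mu (J n B) f = L2dot mu (J n (A - B)) f.
  by rewrite [A - B]addrC -[- B]scaleN1r L2dot_J_lin// mulN1r addrC.
apply: le_trans (normr_semi_form (L2_inner mu) (J_L2 FBA) fL) _.
by rewrite mulrAC ler_wpM2r ?semi_norm_ge0// JC.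
Qed.

Lemma chaos_orthogonal n m A B : n != m -> HS_form E A -> HS_form E B ->
  L2dot mu (J n A) (J m B) = 0.
Proof.
move=> nm FA FB; have [C _ JC] := J_bound n; have [C' _ JC'] := J_bound m.
have step r : (forall p, p \in r -> represented ip iota p.2) ->
    L2dot mu (J n (tensor_comb ip r)) (J m B) = 0.
  move=> rU; have FT := HS_form_tensor_comb ipn basisE eE n r.
  rewrite L2dotC; [|exact: J_L2|exact: J_L2].
  apply: (vanishing (F := fun B => L2dot mu (J m B) (J n (tensor_comb ip r)))
     (K := C' * L2n mu (J n (tensor_comb ip r)))) => [r' r'U|A' B' FA' FB'|//].
    rewrite L2dot_J_comb; last exact: J_L2.
    rewrite big_seq big1// => p pr'.
    have FTp := HS_form_tensor_power ipn basisE eE m p.2.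
    rewrite L2dotC; [|exact: J_L2|exact: J_L2].
    rewrite L2dot_J_comb; last exact: J_L2.
    rewrite big_seq big1 ?mulr0// => q qr.
    rewrite L2dot_J_tensor_power ?(negbTE nm) ?mul0r ?mulr0//; [exact: rU|exact: r'U].
  by apply: L2dot_J_continuous => //; exact: J_L2.
apply: (vanishing (F := fun A => L2dot mu (J n A) (J m B)) (K := C * L2n mu (J m B))) => //.
by move=> A' B' FA' FB'; apply: L2dot_J_continuous => //; exact: J_L2.
Qed.

(** [vanishing] is applied to the difference of the two sides, first in B with a tensor combination
    as first argument, then in A. For tensor powers both sides are n! (u, v)^n. *)
Lemma chaos_isometry n A B : HS_form E A -> HS_form E B ->
  L2dot mu (J n A) (J n B) = n`!%:R * HS_dot e A B.
Proof.
move=> FA FB; have [C _ JC] := J_bound n.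
have HC (A1 B1 B2 : H ^ n -> R) : HS_form E A1 -> HS_form E B1 -> HS_form E B2 ->
   `|n`!%:R * HS_dot e B1 A1 - n`!%:R * HS_dot e B2 A1| <= n`!%:R * HSn e A1 * HSn e (B1 - B2).
  move=> FA1 FB1 FB2; rewrite -mulrBr normrM normr_nat -mulrA ler_wpM2l//.
  have -> : HS_dot e B1 A1 - HS_dot e B2 A1 = HS_dot e (B1 - B2) A1.
    by rewrite [B1 - B2]addrC -[- B2]scaleN1r (semi_form_lin (FI n) (-1) FB2 FB1 FA1) mulN1r addrC.
  by rewrite mulrC; apply: (normr_semi_form (FI n)) => //; exact: (semi_subspaceB (FI n)).
have tri (a b c d x y : R) : `|a - b| <= x -> `|c - d| <= y -> `|a - c - (b - d)| <= x + y.
  move=> h1 h2; have -> : a - c - (b - d) = (a - b) - (c - d) by ring.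
  by apply: le_trans (ler_normB _ _) _; exact: lerD.
have step r B' : HS_form E B' -> (forall p, p \in r -> represented ip iota p.2) ->
    L2dot mu (J n (tensor_comb ip r)) (J n B') - n`!%:R * HS_dot e (tensor_comb ip r) B' = 0.
  move=> FB' rU; have FT := HS_form_tensor_comb ipn basisE eE n r.
  rewrite L2dotC; [|exact: J_L2|exact: J_L2].
  rewrite (semi_formC (FI n))//.
  apply: (vanishing (F := fun B => L2dot mu (J n B) (J n (tensor_comb ip r)) -
       n`!%:R * HS_dot e B (tensor_comb ip r))
     (K := C * L2n mu (J n (tensor_comb ip r)) +
       n`!%:R * HSn e (tensor_comb (n := n) ip r))) => [r' r'U|A1 B1 FA1 FB1|//].
    have FT' := HS_form_tensor_comb ipn basisE eE n r'.
    rewrite L2dot_J_comb; last exact: J_L2.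
    rewrite HS_dot_comb// mulr_sumr -sumrB big_seq big1// => p pr'.
    have FTp := HS_form_tensor_power ipn basisE eE n p.2.
    rewrite L2dotC; [|exact: J_L2|exact: J_L2].
    rewrite (semi_formC (FI n))// L2dot_J_comb; last exact: J_L2.
    rewrite HS_dot_comb// mulrCA -mulrBr mulr_sumr -sumrB big_seq big1 ?mulr0// => q qr.
    rewrite L2dot_J_tensor_power; [|exact: rU|exact: r'U].
    rewrite (HS_dot_tensor_power ipn basisE eE) eqxx mul1r; ring.
  rewrite mulrDl; apply: tri; last exact: HC.
  by apply: L2dot_J_continuous => //; exact: J_L2.
apply/eqP; rewrite -subr_eq0; apply/eqP.
apply: (vanishing (F := fun A => L2dot mu (J n A) (J n B) - n`!%:R * HS_dot e A B)
   (K := C * L2n mu (J n B) + n`!%:R * HSn e B)) => //.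
  by move=> r rU; exact: step.
move=> A' B' FA' FB'; rewrite mulrDl; apply: tri; last exact: HC.
by apply: L2dot_J_continuous => //; exact: J_L2.
Qed.

Lemma L2n_J n A : HS_form E A -> L2n mu (J n A) = Num.sqrt n`!%:R * HSn e A.
Proof.
by move=> FA; rewrite /L2n /semi_norm chaos_isometry// sqrtrM.
Qed.

Let FT n u : HS_form E (tensor_power (n := n) ip u) := HS_form_tensor_power ipn basisE eE n u.

Definition chaos_sum N (A : forall n, H ^ n -> R) : borel X -> R :=
  \sum_(n < N) J n (A n).

(** Closed under almost everywhere equality, because the integrals are linear only in this sense and
    a sum of two chaos sums need not be literally a chaos sum. *)
Definition chaos_span : set (borel X -> R) :=
  [set g | L2fun mu g /\ exists N (A : forall n, H ^ n -> R),
     (forall n, HS_form E (A n)) /\ g = chaos_sum N A %[ae mu]].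

Lemma L2fun_chaos_sum N A : (forall n, HS_form E (A n)) -> L2fun mu (chaos_sum N A).
Proof.
move=> FA; rewrite /chaos_sum; elim/big_ind: _ => [|f g fL gL|i _].
- exact: L2fun0.
- exact: (semi_subspaceD (L2_inner mu) fL gL).
- exact: J_L2.
Qed.

(** Padding by zero forms, so that sums of different lengths can be added degree by degree. *)
Definition truncate N (A : forall n, H ^ n -> R) n : H ^ n -> R := if (n < N)%N then A n else 0.
Arguments truncate : clear implicits.

Lemma HS_form_truncate N A : (forall n, HS_form E (A n)) -> forall n, HS_form E (truncate N A n).
Proof. by move=> FA n; rewrite /truncate; case: ifP => // _; exact: (semi_space0 (FI n)). Qed.

Lemma chaos_sum_truncate N A k : chaos_sum (N + k) (truncate N A) = chaos_sum N A %[ae mu].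
Proof.
elim: k => [|k IH].
  rewrite addn0; have -> : chaos_sum N (truncate N A) = chaos_sum N A; last exact: aeW.
  by apply: eq_bigr => i _; rewrite /truncate ltn_ord.
apply: (filterS2 _ _ IH (J_form0 (N + k))) => x {}IH h _.
rewrite -IH// /chaos_sum addnS big_ord_recr/=.
rewrite -[LHS]/((\sum_(i < N + k) J i (truncate N A i)) x + J (N + k) (truncate N A (N + k)) x).
have -> : truncate N A (N + k)%N = 0 by rewrite /truncate ltnNge leq_addr.
by rewrite h// addr0.
Qed.

Lemma chaos_sum_lin N a A B : (forall n, HS_form E (A n)) -> (forall n, HS_form E (B n)) ->
  chaos_sum N (fun n => a *: A n + B n) = a *: chaos_sum N A + chaos_sum N B %[ae mu].
Proof.
move=> FA FB; elim: N => [|N IH].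
  by rewrite /chaos_sum !big_ord0 scaler0 addr0; exact: aeW.
apply: (filterS2 _ _ IH (J_lin a (FA N) (FB N))) => x {}IH h _.
rewrite /chaos_sum !big_ord_recr/= -/(chaos_sum N A) -/(chaos_sum N B).
rewrite -/(chaos_sum N (fun n => a *: A n + B n)).
rewrite -[LHS]/(chaos_sum N (fun n => a *: A n + B n) x + J N (a *: A N + B N) x).
rewrite IH// h//.
rewrite -[LHS]/(a * chaos_sum N A x + chaos_sum N B x + (a * J N (A N) x + J N (B N) x)).
rewrite -[RHS]/(a * (chaos_sum N A x + J N (A N) x) + (chaos_sum N B x + J N (B N) x)).
ring.
Qed.

Let span0 : chaos_span 0.
Proof.
split; first exact: L2fun0; exists 0, (fun n => 0); split.
  by move=> n; exact: (semi_space0 (FI n)).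
by rewrite /chaos_sum big_ord0; exact: aeW.
Qed.

Let span_lin a f g : chaos_span f -> chaos_span g -> chaos_span (a *: f + g).
Proof.
move=> [fL [N [A [FA fA]]]] [gL [M [B [FB gB]]]]; split; first exact: L2fun_lin.
exists (N + M), (fun n => a *: truncate N A n + truncate M B n).
have FA' := HS_form_truncate N FA; have FB' := HS_form_truncate M FB.
split=> [n|]; first exact: (semi_space_lin (FI n)).
have h1 := chaos_sum_truncate N A M; have h2 := chaos_sum_truncate M B N; rewrite addnC in h2.
have h3 := chaos_sum_lin (N + M) a FA' FB'.
have h : a *: chaos_sum (N + M) (truncate N A) + chaos_sum (N + M) (truncate M B) =
    a *: f + g %[ae mu].
  have h4 : chaos_sum (N + M) (truncate N A) = f %[ae mu].
    by apply: (filterS2 _ _ fA h1) => x {}fA {}h1 _; rewrite fA// h1.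
  apply: (filterS3 _ _ h4 gB h2) => x {}h4 {}gB {}h2 _.
  rewrite -[LHS]/(a * chaos_sum (N + M) (truncate N A) x + chaos_sum (N + M) (truncate M B) x).
  by rewrite h4// h2// -gB.
by apply: (filterS2 _ _ h h3) => x {}h {}h3 _; rewrite h3// h.
Qed.

Let spanL : chaos_span `<=` L2fun mu. Proof. by move=> f []. Qed.

Let K := semi_closure (L2fun mu) (L2dot mu) chaos_span.

Let K_lin a f g : K f -> K g -> K (a *: f + g).
Proof. exact: (semi_closure_lin (L2_inner mu) span_lin spanL). Qed.

Let KL : K `<=` L2fun mu. Proof. by move=> f []. Qed.

Let K_cvg (u : nat -> borel X -> R) f : (forall n, K (u n)) -> L2fun mu f ->
  L2n mu (u n - f) @[n --> \oo] --> 0 -> K f.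
Proof. exact: (semi_closure_cvg (L2_inner mu) spanL). Qed.

Let K_span f : chaos_span f -> K f.
Proof. exact: (sub_semi_closure (L2_inner mu) spanL). Qed.

Let K_hpoly (l : {scalar X}) u n : continuous l -> represents ip iota l u ->
  K (fun x => (hpoly (`|u| ^+ 2) n).[l x]).
Proof.
move=> cl lu; apply: K_span; split; first exact: (poly_L2).
exists n.+1, (fun m => if m == n then tensor_power ip u else 0); split.
  by move=> m; case: eqP => _; [exact: FT|exact: (semi_space0 (FI m))].
have h1 := J_tensor_power n cl lu.
have h2 : chaos_sum n (fun=> 0) = 0 %[ae mu].
  by have := chaos_sum_truncate 0 (fun=> 0) n; rewrite /chaos_sum [X in _ = X %[ae _]]big_ord0.
apply: (filterS2 _ _ h1 h2) => x {}h1 {}h2 _.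
rewrite /chaos_sum big_ord_recr/= eqxx.
rewrite (eq_bigr (fun i : 'I_n => J i 0)) => [|i _]; last by rewrite ltn_eqF.
rewrite -/(chaos_sum n (fun=> 0)) -[RHS]/(chaos_sum n (fun=> 0) x + J n (tensor_power ip u) x).
by rewrite h1// h2// add0r.
Qed.

Let K_exprn (l : {scalar X}) n : continuous l -> K (fun x => l x ^+ n).
Proof.
move=> cl; have [_ _ _ _ /(_ l cl)[u [lu _ _]]] := CM.
set s := `|u| ^+ 2.
(* The three-term recursion X h_k = h_(k+1) + k s h_(k-1) removes the factors X one by one; a power
   of l is the case k = 0. *)
suff P m k : K (fun x => ('X^m * hpoly s k).[l x]).
  have := P n 0; rewrite /= mulr1.
  by under [X in K X]eq_fun do rewrite hornerXn.
elim: m k => [|m IH] k.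
  by under [X in K X]eq_fun do rewrite expr0 mul1r; exact: K_hpoly.
have := K_lin (k%:R * s) (IH k.-1) (IH k.+1).
congr K; apply/funext => x.
rewrite -[LHS]/(k%:R * s * ('X^m * hpoly s k.-1).[l x] + ('X^m * hpoly s k.+1).[l x]).
by rewrite hpolyS exprSr !(hornerM, hornerD, hornerN, hornerZ, hornerX); ring.
Qed.

(** The partial sums are polynomials in l dominated by a multiple of exp |l|, so a pointwise
    convergent power series of exponential type also converges in L^2. *)
Let K_series (l : {scalar X}) (a : nat -> R) (C : R) f : continuous l ->
  (forall k, `|a k| <= C / k`!%:R) ->
  (forall x, \sum_(0 <= k < n) a k * l x ^+ k @[n --> \oo] --> f x) -> K f.
Proof.
move=> cl aC cf; pose u n x := \sum_(0 <= k < n) a k * l x ^+ k.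
have Ku n : K (u n : borel X -> R).
  rewrite /u; elim: n => [|n IH].
    have := K_span span0; congr K; apply/funext => x; by rewrite big_nil.
  have := K_lin (a n) (K_exprn n cl) IH; congr K; apply/funext => x.
  by rewrite big_nat_recr//= [RHS]addrC.
(* This majorant of C exp |l| is a sum of exponentials of l, and its square is integrable since exp
   (2 l) and exp (-2 l) are. *)
pose g (x : borel X) := C * (expR (l x) + expR (- l x)).
have C0 : 0 <= C by have := aC 0; rewrite fact0 divr1; apply: le_trans.
have gL : L2fun mu g.
  have h t : mu.-integrable setT (fun x => (expR (t * l x))%:E).
    exact: gaussian_expR_integrable.
  have ml : measurable_fun setT (l : borel X -> R) by exact: borel_continuous.
  apply/L2funP; split.
    apply: measurable_funM => //; apply: measurable_funD; apply: measurableT_comp => //.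
    exact: measurableT_comp.
  have := integrableZl measurableT (C ^+ 2)
    (integrableD measurableT (integrableD measurableT (h 2) (h (-2)))
    (integrableZl measurableT 2 (h 0))).
  congr (_.-integrable _ _); apply/funext => x /=.
  rewrite -!EFinD; congr EFin; rewrite /g mul0r expR0.
  have -> : 2 * l x = l x + l x by ring.
  have -> : -2 * l x = - l x + - l x by ring.
  have E1 : expR (l x) * expR (- l x) = 1 by rewrite -expRD subrr expR0.
  rewrite !expRD; ring: E1.
have ug n x : `|u n x| <= g x.
  have le1 : `|u n x| <= C * \sum_(0 <= k < n) exp_coeff `|l x| k.
    rewrite (le_trans (ler_norm_sum _ _ _))// mulr_sumr ler_sum// => k _.
    rewrite normrM normrX /exp_coeff/= [_ / _]mulrC mulrA.
    by rewrite ler_wpM2r ?exprn_ge0.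
  apply: le_trans le1 _; rewrite /g ler_wpM2l//.
  have le2 : \sum_(0 <= k < n) exp_coeff `|l x| k <= expR `|l x|.
    have c : series (exp_coeff `|l x|) @ \oo --> expR `|l x|.
      exact: is_cvg_series_exp_coeff.
    apply: (cvgr_to_ge c); exists n => // m /= nm.
    by apply: (nondecreasing_series (P := xpredT)) => // k _ _; exact: exp_coeff_ge0.
  apply: le_trans le2 _; have [lx|lx] := leP 0 (l x).
    by rewrite (ger0_norm lx) lerDl expR_ge0.
  by rewrite (ltr0_norm lx) lerDr expR_ge0.
have [fL c] := L2_dominated (fun n => L2fun_measurable (KL (Ku n))) gL ug cf.
exact: K_cvg c.
Qed.

(** The addition formula splits cos (l - c) into the cosine and sine series of l with coefficients
    cos c and sin c; each is bounded by 1 / k!, hence C = 2. *)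
Let K_cos (l : {scalar X}) c : continuous l -> K (fun x => cos (l x - c)).
Proof.
move=> cl.
pose A k : R := (~~ odd k)%:R * (-1) ^ k./2 / k`!%:R.
pose B k : R := (odd k)%:R * (-1) ^+ k.-1./2 / k`!%:R.
have AE x k : A k * x ^+ k = cos_coeff x k by rewrite /A /cos_coeff/= mulrAC.
have BE x k : B k * x ^+ k = sin_coeff x k by rewrite /B /sin_coeff/= mulrAC.
have bd (b : bool) m k : `|b%:R * (-1) ^+ m / k`!%:R| <= 1 / k`!%:R :> R.
  rewrite !normrM normfV normrX normrN1 expr1n mulr1 !normr_nat ler_wpM2r ?invr_ge0//.
  by case: b.
apply: (K_series (l := l) (a := fun k => cos c * A k + sin c * B k) (C := 2)) => // [k|x].
  have -> : 2 / k`!%:R = 1 / k`!%:R + 1 / k`!%:R :> R by ring.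
  rewrite (le_trans (ler_normD _ _))// lerD// normrM.
    rewrite (le_trans _ (bd (~~ odd k) k./2 k))// ler_piMl// cos_max//.
  rewrite (le_trans _ (bd (odd k) k.-1./2 k))// ler_piMl// sin_max//.
have c1 : series (cos_coeff (l x)) n @[n --> \oo] --> cos (l x).
  by rewrite cos.unlock; exact: is_cvg_series_cos_coeff.
have c2 : series (sin_coeff (l x)) n @[n --> \oo] --> sin (l x).
  by rewrite sin.unlock; exact: is_cvg_series_sin_coeff.
rewrite (_ : (fun n => _) =
  fun n => cos c * series (cos_coeff (l x)) n + sin c * series (sin_coeff (l x)) n).
  rewrite cosB [cos (l x) * _]mulrC [sin (l x) * _]mulrC.
  by apply: cvgD; apply: cvgM => //; exact: cvg_cst.
apply/funext => n; rewrite /series/= !mulr_sumr -big_split/=.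
by apply: eq_bigr => k _; rewrite -AE -BE; ring.
Qed.

Let K_cos_closure f : cos_closure f -> K f.
Proof.
elim=> [l c cl|a {}f g _ Kf _ Kg|u {}f M _ Ku uM uf].
- exact: K_cos.
- exact: K_lin.
have cL : L2fun mu (cst M).
  apply/L2funP; split; first exact: measurable_cst.
  exact: (finite_measure_integrable_cst mu (M ^+ 2)).
have [fL c] := L2_dominated (fun n => L2fun_measurable (KL (Ku n))) cL uM uf.
exact: K_cvg c.
Qed.

Lemma chaos_dense f : L2fun mu f -> forall eps, 0 < eps ->
  exists N (A : forall n, H ^ n -> R), (forall n, HS_form E (A n)) /\
    L2n mu (f - chaos_sum N A) < eps.
Proof.
move=> fL eps eps0; have [_ Sf] : K f.
  apply: (L2fun_generated (mu := mu) K_lin K_cvg _ fL) => A mA.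
  by apply: K_cos_closure; exact: borel_cos_measurable.
have [g [gL [N [A [FA gA]]]] lt] := Sf _ eps0.
exists N, A; split=> //; have cL := L2fun_chaos_sum N FA.
apply: le_lt_trans lt; apply: le_trans (ler_semi_normB (L2_inner mu) fL gL cL) _.
by rewrite [X in _ + X](L2n_ae gL cL gA) addr0.
Qed.

Let SI := L2_inner mu.
Local Notation forms A := (forall n, HS_form E (A n)).
Local Notation csum := chaos_sum.

Let sumL N (A : forall n, H ^ n -> R) : forms A -> L2fun mu (csum N A).
Proof. by move=> FA; exact: L2fun_chaos_sum. Qed.

Let formsB (A B : forall n, H ^ n -> R) : forms A -> forms B -> forms (fun n => A n - B n).
Proof. by move=> FA FB n; exact: (semi_subspaceB (FI n)). Qed.

Let normBC f g : L2fun mu f -> L2fun mu g -> L2n mu (f - g) = L2n mu (g - f).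
Proof. exact: (semi_normBC SI). Qed.

Let normB f g h : L2fun mu f -> L2fun mu g -> L2fun mu h ->
  L2n mu (f - h) <= L2n mu (f - g) + L2n mu (g - h).
Proof. exact: (ler_semi_normB SI). Qed.

Lemma chaos_sum_sqr N (A : forall n, H ^ n -> R) : forms A ->
  L2n mu (csum N A) ^+ 2 = \sum_(n < N) n`!%:R * HSn e (A n) ^+ 2.
Proof.
move=> FA; rewrite (sqr_semi_norm SI)//; last exact: sumL.
rewrite (semi_sqr_sum_orthogonal SI).
- apply: eq_bigr => n _; rewrite (chaos_isometry)//.
  by rewrite (sqr_semi_norm (FI n)).
- by move=> n; exact: (J_L2).
- by move=> n m nm; exact: (chaos_orthogonal).
Qed.

Lemma chaos_sum_norm_mono (A : forall n, H ^ n -> R) N M : forms A -> (N <= M)%N ->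
  L2n mu (csum N A) <= L2n mu (csum M A).
Proof.
move=> FA NM; rewrite -(@ler_pXn2r _ 2)// ?nnegrE ?semi_norm_ge0//.
rewrite !chaos_sum_sqr// (big_ord_widen M (fun n => n`!%:R * HSn e (A n) ^+ 2) NM).
rewrite [leLHS]big_mkcond/=; apply: ler_sum => i _; case: ifP => // _.
by rewrite mulr_ge0// sqr_ge0.
Qed.

(** One term of an orthogonal sum, with n! >= 1. It turns bounds on sums into bounds on each
    coefficient. *)
Lemma HSn_le_chaos_sum (A : forall n, H ^ n -> R) n N : forms A -> (n < N)%N ->
  HSn e (A n) <= L2n mu (csum N A).
Proof.
move=> FA nN; rewrite -(@ler_pXn2r _ 2)// ?nnegrE ?semi_norm_ge0//.
rewrite chaos_sum_sqr// (bigD1 (Ordinal nN))//=.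
rewrite -[leLHS]addr0 lerD//; last by apply: sumr_ge0 => i _; rewrite mulr_ge0// sqr_ge0.
by rewrite ler_peMl ?sqr_ge0// ler1n fact_gt0.
Qed.

Lemma chaos_sum_normB N (A B : forall n, H ^ n -> R) : forms A -> forms B ->
  L2n mu (csum N A - csum N B) = L2n mu (csum N (fun n => A n - B n)).
Proof.
move=> FA FB; have FAB := formsB FA FB.
have h : csum N A - csum N B = csum N (fun n => A n - B n) %[ae mu].
  have := chaos_sum_lin N (-1) FB FA.
  rewrite (_ : (fun n => -1 *: B n + A n) = fun n => A n - B n); last first.
    by apply: functional_extensionality_dep => n; rewrite scaleN1r addrC.
  by rewrite scaleN1r addrC; apply: filterS => x h xT; rewrite h.
have L1 := semi_subspaceB SI (sumL N FA) (sumL N FB); have L2 := sumL N FAB.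
exact: (L2n_ae_eq L1 L2 h).
Qed.

Lemma chaos_sum_cvg0 N (A : nat -> forall n, H ^ n -> R) : (forall k, forms (A k)) ->
  (forall n, HSn e (A k n) @[k --> \oo] --> 0) -> L2n mu (csum N (A k)) @[k --> \oo] --> 0.
Proof.
move=> FA A0; have S0 : \sum_(n < N) n`!%:R * HSn e (A k n) ^+ 2 @[k --> \oo] --> (0 : R).
  elim: N => [|N IH].
    by rewrite (_ : (fun k => _) = fun=> 0); [exact: cvg_cst|apply/funext => k; rewrite big_ord0].
  rewrite (_ : (fun k => _) = fun k => \sum_(n < N) n`!%:R * HSn e (A k n) ^+ 2 +
    N`!%:R * (HSn e (A k N) * HSn e (A k N))); last by apply/funext => k; rewrite big_ord_recr.
  have c1 : N`!%:R * (HSn e (A k N) * HSn e (A k N)) @[k --> \oo] --> N`!%:R * (0 * 0 : R).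
    by apply: cvgM; [exact: cvg_cst|exact: cvgM].
  by rewrite !mulr0 in c1; rewrite -[X in _ --> X]addr0; apply: cvgD.
have h : L2n mu (csum N (A k)) ^+ 2 @[k --> \oo] --> (0 : R).
  rewrite (_ : (fun k => _) = fun k => \sum_(n < N) n`!%:R * HSn e (A k n) ^+ 2)//.
  by apply/funext => k; rewrite chaos_sum_sqr.
rewrite -(sqrtr0 R) (_ : (fun k => _) = fun k => Num.sqrt (L2n mu (csum N (A k)) ^+ 2)).
  by apply: continuous_cvg h; exact: sqrt_continuous.
by apply/funext => k; rewrite sqrtr_sqr ger0_norm ?semi_norm_ge0.
Qed.

Lemma chaos_expansion f : L2fun mu f ->
  exists2 A : forall n, H ^ n -> R, forms A & L2n mu (csum N A - f) @[N --> \oo] --> 0.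
Proof.
move=> fL; have d0 k : 0 < k.+1%:R^-1 :> R by rewrite invr_gt0.
have /choice[NA HNA] : forall k, exists NA : nat * (forall n, H ^ n -> R),
    forms (NA.2) /\ L2n mu (f - csum NA.1 NA.2) < k.+1%:R^-1.
  move=> k; have [N [A FA]] := chaos_dense fL (d0 k).
  by exists (N, A).
pose g k := csum (NA k).1 (NA k).2.
pose B k := truncate (NA k).1 (NA k).2.
have FB k : forms (B k) by apply: (HS_form_truncate); have [] := HNA k.
have gL k : L2fun mu (g k) by apply: sumL; have [] := HNA k.
have gB k M : ((NA k).1 <= M)%N -> csum M (B k) = g k %[ae mu].
  by move=> NM; rewrite -(subnKC NM); exact: (chaos_sum_truncate).
have fg k : L2n mu (f - g k) < k.+1%:R^-1 by have [] := HNA k.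
(* The bound is uniform in N: lengthening an orthogonal sum increases its norm, and beyond both
   truncation indices the two sums are [g k] and [g j]. *)
have BB N k j : L2n mu (csum N (fun n => B k n - B j n)) <= k.+1%:R^-1 + j.+1%:R^-1.
  pose M := (N + ((NA k).1 + (NA j).1))%N.
  have NM : (N <= M)%N by rewrite leq_addr.
  apply: le_trans (chaos_sum_norm_mono (formsB (FB k) (FB j)) NM) _.
  rewrite -(chaos_sum_normB _ (FB k) (FB j)).
  have h i : ((NA i).1 <= M)%N -> L2n mu (csum M (B i) - g i) = 0.
    by move=> iM; apply: (L2n_ae (sumL _ (FB i)) (gL i)); exact: gB.
  have k0 := h k (leq_trans (leq_addr _ _) (leq_addl _ _)).
  have j0 := h j (leq_trans (leq_addl _ _) (leq_addl _ _)).
  rewrite (normBC (sumL _ (FB j)) (gL j)) in j0.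
  apply: le_trans (normB (sumL M (FB k)) fL (sumL M (FB j))) _.
  rewrite lerD//.
    apply: le_trans (normB (sumL M (FB k)) (gL k) fL) _.
    by rewrite [X in X + _]k0 add0r (normBC (gL k) fL) ltW.
  apply: le_trans (normB fL (gL j) (sumL M (FB j))) _.
  by rewrite [X in _ + X]j0 addr0 ltW.
(* In each degree the coefficients of the approximations [g k] are Cauchy; their
   limits are the coefficients of [f]. *)
have cau n : semi_cauchy (HS_dot (n := n) e) (fun k => B k n).
  move=> eps eps0.
  have [M _ HM] := near_infty_natSinv_lt (PosNum (divr_gt0 eps0 (ltr0n R 2))).
  exists M => k j Mk Mj.
  apply: le_lt_trans (HSn_le_chaos_sum (formsB (FB k) (FB j)) (ltnSn n)) _.
  apply: le_lt_trans (BB _ _ _) _; rewrite (splitr eps).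
  by apply: ltrD; [exact: HM Mk|exact: HM Mj].
pose A n := projT1 (cid2 (HS_form_complete ipn basisE eE (fun k => FB k n) (cau n))).
have HA n : HS_form E (A n) /\ HSn e (B k n - A n) @[k --> \oo] --> 0.
  by rewrite /A; case: cid2.
have FA : forms A by move=> n; have [] := HA n.
exists A => //.
(* Let j tend to infinity in [BB]. For fixed N only finitely many degrees occur, so convergence in
   each degree suffices. *)
have BA N k : L2n mu (csum N (fun n => B k n - A n)) <= k.+1%:R^-1.
  have c0 := @chaos_sum_cvg0 N (fun j n => B j n - A n)
    (fun j => formsB (FB j) FA) (fun n => (HA n).2).
  have c1 : k.+1%:R^-1 + j.+1%:R^-1 + L2n mu (csum N (fun n => B j n - A n)) @[j --> \oo] --> (k.+1%:R^-1 : R).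
    rewrite -[X in _ --> X]addr0; apply: cvgD => //.
    by rewrite -[X in _ --> X]addr0; apply: cvgD; [exact: cvg_cst|exact: cvg_harmonic].
  apply: (cvgr_to_ge c1); near=> j.
  rewrite -(chaos_sum_normB _ (FB k) FA) -(chaos_sum_normB _ (FB j) FA).
  apply: le_trans (normB (sumL N (FB k)) (sumL N (FB j)) (sumL N FA)) _.
  by rewrite lerD2r [leLHS](chaos_sum_normB _ (FB k) (FB j)) BB.
apply/cvgr0Pnorm_lt => eps eps0.
have [M _ HM] := near_infty_natSinv_lt (PosNum (divr_gt0 eps0 (ltr0n R 2))).
have {HM} Me := HM M (leqnn M); rewrite /= in Me.
exists (NA M).1 => // N /= MN; rewrite ger0_norm ?semi_norm_ge0//.
rewrite (normBC (sumL N FA) fL) (splitr eps).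
apply: le_lt_trans (normB fL (gL M) (sumL N FA)) _.
rewrite ltrD ?(lt_trans (fg M))//.
apply: le_lt_trans Me.
apply: le_trans (normB (gL M) (sumL N (FB M)) (sumL N FA)) _.
rewrite (normBC (gL M) (sumL N (FB M))) [X in X + _](L2n_ae (sumL N (FB M)) (gL M) (gB _ _ MN)).
by rewrite add0r [leLHS](chaos_sum_normB _ (FB M) FA) BA.
Unshelve. all: by end_near. Qed.

Lemma chaos_expansion_unique f (A B : forall n, H ^ n -> R) : L2fun mu f ->
  forms A -> forms B ->
  L2n mu (csum N A - f) @[N --> \oo] --> 0 -> L2n mu (csum N B - f) @[N --> \oo] --> 0 ->
  A = B.
Proof.
move=> fL FA FB cA cB; apply: functional_extensionality_dep => n.
apply/eqP; rewrite -subr_eq0; apply/eqP.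
apply: (HS_form_eq0 ipn basisE eE (formsB FA FB n)).
apply/eqP; rewrite eq_le semi_norm_ge0 andbT.
have c1 : L2n mu (csum N A - f) + L2n mu (csum N B - f) @[N --> \oo] --> (0 : R).
  by rewrite -[X in _ --> X]addr0; exact: cvgD.
apply: (cvgr_to_ge c1); exists n.+1 => // N /= nN.
apply: le_trans (HSn_le_chaos_sum (formsB FA FB) nN) _.
rewrite -(chaos_sum_normB _ FA FB).
apply: le_trans (normB (sumL N FA) fL (sumL N FB)) _.
by rewrite lerD2l (normBC fL (sumL N FB)).
Qed.

End WienerChaos.

(** * Transport by an injective Borel map *)

Section MeasureSmall.
Context d (T : measurableType d) (R : realType) (nu : probability T R).

Lemma measure_bigcup_small (D : set T) (F : nat -> set T) (eps : R) : 0 <= eps ->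
  measurable D -> (forall n, measurable (F n)) -> D `<=` \bigcup_n F n ->
  (forall n, nu (F n) <= (eps / (2 ^ n.+1)%:R)%:E)%E -> (nu D <= eps%:E)%E.
Proof.
move=> eps0 mD mF DF Fe; apply: le_trans (measure_sigma_subadditive nu mF mD DF) _.
apply: le_trans (epsilon_trick0 xpredT eps0).
by apply: lee_nneseries => [n *|n *]; [exact: measure_ge0|exact: Fe].
Qed.

Lemma nonincreasing_measure_small (D : nat -> set T) (c : \bar R) :
  (forall n, measurable (D n)) -> {homo D : n m / (n <= m)%N >-> m `<=` n} ->
  (nu (\bigcap_n D n) < c)%E -> exists N, (nu (D N) < c)%E.
Proof.
move=> mD dD lt; have mI : measurable (\bigcap_n D n) by exact: bigcap_measurable.
have c1 : nu (D n) @[n --> \oo] --> nu (\bigcap_n D n).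
  apply: (nonincreasing_cvg_mu (mu := nu) (F := D)) => //.
    by rewrite (le_lt_trans (probability_le1 _ _)) ?ltry.
  by move=> n m nm; apply/subsetPset; exact: dD.
have [|N _ HN] := c1 [set y | (y < c)%E].
  by apply: open_nbhs_nbhs; split => //; exact: open_ereal_lt_ereal.
by exists N; exact: HN (leqnn N).
Qed.

End MeasureSmall.

(** * Regularity of Borel probability measures *)

Section Regularity.
Variables (R : realType) (X : normedModType R) (nu : probability (borel X) R).

Definition closed_regular (A : set (borel X)) := forall eps : R, 0 < eps ->
  exists C U : set X, [/\ closed C, open U, C `<=` A, A `<=` U & (nu (U `\` C) < eps%:E)%E].

Let mUC (U C : set X) : open U -> closed C -> measurable (U `\` C : set (borel X)).
Proof. by move=> oU cC; apply: measurableD; [exact: borel_open|exact: borel_closed]. Qed.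

(** The points whose open 1 / (n + 1)-ball lies in A form closed sets that increase to A. *)
Let regular_open (A : set X) : open A -> closed_regular A.
Proof.
move=> oA eps eps0.
pose C n := [set x : X | forall y, `|x - y| < n.+1%:R^-1 -> A y].
have cC n : closed (C n).
  rewrite -[C n]setCK; apply: open_closedC; rewrite openE => x /= /existsNP[y /not_implyP[xy Ay]].
  have r0 : 0 < n.+1%:R^-1 - `|x - y| by rewrite subr_gt0.
  apply/nbhs_ballP; exists (n.+1%:R^-1 - `|x - y|) => //= z; rewrite -ball_normE /= => xz Cz; apply: Ay; apply: Cz.
  rewrite (le_lt_trans (ler_distD x z y))// [`|z - x|]distrC -ltrBrDr//.
have CA n : C n `<=` A.
  by move=> x; apply; rewrite subrr normr0 invr_gt0.
have [|||N lt] := @nonincreasing_measure_small _ _ _ nu (fun n => A `\` C n) eps%:E.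
- by move=> n; exact: mUC.
- move=> n m nm x [Ax nx]; split => // Cx; apply: nx => y xy; apply: Cx.
  by rewrite (lt_le_trans xy)// lef_pV2 ?posrE// ler_nat ltnS.
- rewrite (_ : \bigcap_n _ = set0) ?measure0 ?lte_fin//.
  apply/seteqP; split=> // x Ix; have [Ax _] := Ix 0 I.
  have /nbhs_ballP[r /= r0 xA] : nbhs x A by exact: open_nbhs_nbhs.
  have [j _ /(_ j (leqnn j)) jr] := near_infty_natSinv_lt (PosNum r0).
  have [_ /(_ _)] := Ix j I; apply => y xy; apply: xA; rewrite -ball_normE /=.
  exact: lt_trans xy jr.
by exists (C N), A; split => //; exact: subset_refl.
Qed.

Let regularC A : closed_regular A -> closed_regular (~` A).
Proof.
move=> rA eps eps0; have [C [U [cC oU CA AU lt]]] := rA _ eps0.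
exists (~` U), (~` C); split; [exact: open_closedC|exact: closed_openC|exact: subsetC|exact: subsetC|].
by rewrite setDE setCK setIC -setDE.
Qed.

(** The union of the inner closed sets need not be closed, so a finite union is kept; half of eps
    pays for this and the other half is distributed over the sets. *)
Let regular_bigcup (F : nat -> set (borel X)) : (forall n, closed_regular (F n)) ->
  closed_regular (\bigcup_n F n).
Proof.
move=> rF eps eps0; have e2 : 0 < eps / 2 by rewrite divr_gt0.
have /choice[CU H] : forall n, exists CU : set X * set X,
    [/\ closed CU.1, open CU.2, CU.1 `<=` F n, F n `<=` CU.2 &
      (nu (CU.2 `\` CU.1) < (eps / 2 / (2 ^ n.+1)%:R)%:E)%E].
  move=> n; have p0 : 0 < eps / 2 / (2 ^ n.+1)%:R by rewrite divr_gt0// ltr0n expn_gt0.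
  by have [C [U ?]] := rF n _ p0; exists (C, U).
pose U := \bigcup_n (CU n).2; pose C N := \bigcup_(n < N) (CU n).1.
have oU : open U by apply: bigcup_open => n _; have [] := H n.
have cC N : closed (C N).
  rewrite /C (bigcup_mkord N (fun n => (CU n).1)).
  by elim/big_ind: _ => [|? ? ? ?|n _]; [exact: closed0|exact: closedU|have [] := H n].
have [|||N lt] := @nonincreasing_measure_small _ _ _ nu (fun n => U `\` C n) eps%:E.
- by move=> n; exact: mUC.
- move=> n m nm; apply: setDS => x [i ni Cx].
  by exists i => //; exact: leq_trans nm.
- apply: (@le_lt_trans _ _ (eps / 2)%:E); last by rewrite lte_fin ltr_pdivrMr//; lra.
  apply: (@measure_bigcup_small _ _ _ nu _ (fun n => (CU n).2 `\` (CU n).1)) => //.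
  + exact: ltW.
  + by apply: bigcap_measurable => // n _; exact: mUC.
  + by move=> n; have [? ? _ _ _] := H n; exact: mUC.
  + move=> x Ix; have [[n _ Ux] _] := Ix 0 I; exists n => //; split=> // Cx.
    have [_] := Ix n.+1 I; apply; exists n => //=.
  + by move=> n; have [_ _ _ _ /ltW] := H n.
exists (C N), U; split => // x.
  by move=> [n _ Cx]; exists n => //; have [_ _ CF _ _] := H n; exact: CF.
by move=> [n _ Fx]; exists n => //; have [_ _ _ FU _] := H n; exact: FU.
Qed.

Lemma measurable_closed_regular (A : set (borel X)) : measurable A -> closed_regular A.
Proof.
apply: smallest_sub; last exact: regular_open.
split; first by apply: regular_open; exact: open0.
- by move=> B rB; rewrite setTD; exact: regularC.
- exact: regular_bigcup.
Qed.

End Regularity.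

(** * Tightness in a separable Banach space *)

Section Tightness.
Variables (R : realType) (X : completeNormedModType R) (nu : probability (borel X) R).
Hypothesis sepX : separable X.

Let cball (a : X) (r : R) : set X := [set x | `|a - x| <= r].

Let closed_cball a r : closed (cball a r).
Proof.
rewrite (_ : cball a r = (fun x => `|a - x|) @^-1` [set y | y <= r])//.
apply: preimage_closed; last exact: closed_le.
move=> x _; apply: cvg_norm; apply: cvgB; [exact: cvg_cst|exact: cvg_id].
Qed.

(** An ultrafilter on K contains one of finitely many small balls covering K, so it is Cauchy;
    completeness and closedness give its limit in K. *)
Lemma totally_bounded_compact (K : set X) : closed K ->
  (forall eps : R, 0 < eps -> exists s : seq X, K `<=` \bigcup_(a in [set` s]) cball a eps) ->
  compact K.
Proof.
move=> cK tK; rewrite compact_ultra => F UF FK.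
have cF : cauchy F.
  apply: cauchy_exP => eps eps0; have e2 : 0 < eps / 2 by rewrite divr_gt0.
  have [s Ks] := tK _ e2.
  have : F (\bigcup_(a in [set` s]) cball a (eps / 2)) by apply: filterS FK.
  elim: s {Ks} => [|a s IH] Fs.
    have : F set0 by apply: filterS Fs => x [].
    by move=> /filter_not_empty.
  have [Fa|Fa] := in_ultra_setVsetC (cball a (eps / 2)) UF.
    exists a; apply: filterS Fa => x; rewrite /cball -ball_normE /= => ax.
    by rewrite (le_lt_trans ax)// ltr_pdivrMr// ltr_pMr// ltr1n.
  apply: IH; apply: filterS2 Fs Fa => x [b /=]; rewrite inE => /orP[/eqP ->|bs] xb nx //.
  by exists b.
have /cauchy_cvgP/cvg_ex[p Fp] := cF.
by exists p; split => //; exact: (@closed_cvg _ _ F _ id K cK FK p Fp).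
Qed.

(** Ulam's argument: for each radius 1 / (j + 1) finitely many balls carry all but eps / 2^(j+1) of
    the mass, and the intersection over j is totally bounded. *)
Lemma probability_tight (eps : R) : 0 < eps ->
  exists2 K : set X, compact K & (nu (~` K) <= eps%:E)%E.
Proof.
move=> eps0; have [d dd] := separable_sequence sepX.
pose r j : R := j.+1%:R^-1; have r0 j : 0 < r j by rewrite invr_gt0.
pose A j N := \bigcup_(n < N) cball (d n) (r j).
have cA j N : closed (A j N).
  rewrite /A (bigcup_mkord N (fun n => cball (d n) (r j))).
  elim/big_ind: _ => [|? ? ? ?|n _]; [exact: closed0|exact: closedU|exact: closed_cball].
have mA j N : measurable (~` A j N : set (borel X)).
  by apply: measurableC; exact: borel_closed.
have /choice[N HN] : forall j, exists N, (nu (~` A j N) < (eps / (2 ^ j.+1)%:R)%:E)%E.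
  move=> j; apply: (@nonincreasing_measure_small _ _ _ nu (fun n => ~` A j n)) => //.
    move=> n m nm; apply: subsetC => x [i ni Cx].
    by exists i => //; exact: leq_trans nm.
  rewrite (_ : \bigcap_n _ = set0).
    by rewrite measure0 lte_fin divr_gt0// ltr0n expn_gt0.
  apply/seteqP; split=> // x Ix; have [n xn] := dd x _ (r0 j).
  have := Ix n.+1 I; apply; exists n => //=.
  by rewrite /cball /= distrC ltW.
pose K : set X := \bigcap_j A j (N j).
have cK : closed K by apply: closed_bigI => j _; exact: cA.
exists K.
  apply: totally_bounded_compact => // e e0.
  have [j _ /(_ j (leqnn j)) je] := near_infty_natSinv_lt (PosNum e0).
  exists [seq d n | n <- iota 0 (N j)] => x /(_ j I)[n nN xn].
  exists (d n); first by rewrite /= map_f// mem_iota.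
  by apply: le_trans xn _; exact: ltW.
apply: (@measure_bigcup_small _ _ _ nu _ (fun j => ~` A j (N j))) => //.
- exact: ltW.
- by apply: measurableC; exact: borel_closed.
- by rewrite /K setC_bigcap.
- by move=> j; exact: ltW.
Qed.

End Tightness.

(** * Transport of square integrable functions by T *)

Section InjectiveTransport.
Variables (R : realType) (X : completeNormedModType R).
Variables (mu nu : probability (borel X) R).
Variables (X0 : set (borel X)) (T : borel X -> borel X).
Hypothesis sepX : separable X.
Hypotheses (mX0 : measurable X0) (mT : measurable_fun X0 T).

(* Approximating the preimage of every set V of a countable base and its
   complement by closed sets, and discarding what these leave uncovered, makes T
   continuous on the rest. *)
Lemma lusin_compact (M : set (borel X)) (eps : R) : measurable M -> M `<=` X0 ->
  0 < eps -> exists K : set X, [/\ compact K, K `<=` M,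
    {within K, continuous (T : X -> X)} & (nu (M `\` K) <= eps%:E)%E].
Proof.
move=> mM MX0 eps0; have [d dd] := separable_sequence sepX.
have e2 : 0 < eps / 2 by rewrite divr_gt0.
pose V n : set X := if unpickle n is Some (i, j) then ball (d i) (j.+1%:R^-1 : R) else set0.
have oV n : open (V n).
  by rewrite /V; case: unpickle => [[i j]|]; [exact: ball_open|exact: open0].
pose P n : set (borel X) := M `&` (X0 `&` T @^-1` V n).
have mP n : measurable (P n).
  by apply: measurableI => //; apply: mT => //; exact: borel_open.
have mQ n : measurable (M `\` P n) by exact: measurableD.
(* Half of eps is spent on tightness; the other half is distributed over n, and each share is split
   between [P n] and its complement. *)
have p0 n : 0 < eps / 2 / 2 / (2 ^ n.+1)%:R.
  by rewrite !divr_gt0// ltr0n expn_gt0.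
have inner (A : set (borel X)) (n : nat) : measurable A -> exists C : set X, [/\ closed C, C `<=` A &
    (nu (A `\` C) <= (eps / 2 / 2 / (2 ^ n.+1)%:R)%:E)%E].
  move=> mA; have [C [U [cC oU CA AU /ltW lt]]] := measurable_closed_regular nu mA (p0 n).
  exists C; split => //; apply: le_trans lt.
  apply: le_measure; rewrite ?inE; last exact: setSD.
    by apply: measurableD => //; exact: borel_closed.
  by apply: measurableD; [exact: borel_open|exact: borel_closed].
have /choice[F HF] := fun n => inner _ n (mP n).
have /choice[G HG] := fun n => inner _ n (mQ n).
pose C : set X := \bigcap_n (F n `|` G n).
have cFG n : closed (F n `|` G n).
  by apply: closedU; [have [] := HF n|have [] := HG n].
have cC : closed C by apply: closed_bigI => n _.
have mC : measurable (C : set (borel X)) by exact: borel_closed.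
have [K0 kK0 K0e] := probability_tight nu sepX e2.
have mK0 : measurable (K0 : set (borel X)).
  by apply: borel_closed; apply: compact_closed kK0; exact: norm_hausdorff.
have CM : C `<=` M.
  move=> x /(_ 0 I)[Fx|Gx].
    by have [_ FP _] := HF 0; have [] := FP x Fx.
  by have [_ GQ _] := HG 0; have [] := GQ x Gx.
exists (K0 `&` C); split.
- exact: compact_closedI.
- by move=> x [_ /CM].
- apply/subspace_continuousP => x [_ Cx] W /nbhs_ballP[rho /= rho0 xW].
  have [j _ /(_ j (leqnn j)) jr] := near_infty_natSinv_lt (PosNum (divr_gt0 rho0 (ltr0n R 2))).
  rewrite /= in jr; have j0 : 0 < j.+1%:R^-1 :> R by rewrite invr_gt0.
  have [i xi] := dd (T x) _ j0.
  pose n := pickle (i, j); have VE : V n = ball (d i) (j.+1%:R^-1 : R) by rewrite /V pickleK.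
  have VTx : V n (T x) by rewrite VE -ball_normE /= distrC.
  have VW y : V n y -> W y.
    rewrite VE -ball_normE /= => iy; apply: xW; rewrite -ball_normE /=.
    rewrite (le_lt_trans (ler_distD (d i) _ _))// (splitr rho) ltrD//.
      exact: lt_trans jr.
    exact: lt_trans jr.
  have Mx : M x by exact: CM.
  (* Since T x lies in V n, x avoids the closed set G n, and so do all nearby points; those in C
     must then lie in F n, where T takes values in V n. *)
  have nGx : ~ G n x.
    have [_ GQ _] := HG n => /GQ[_]; apply; split => //; split => //; exact: MX0.
  have [cG _ _] := HG n.
  have : nbhs x (~` G n) by apply: open_nbhs_nbhs; split => //; exact: closed_openC.
  rewrite /within /=; apply: filterS => y nGy [_ Cy]; apply: VW.
  have [Fy|//] := Cy n I; have [_ FP _] := HF n.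
  by have [_ []] := FP y Fy.
rewrite (_ : M `\` _ = (M `\` K0) `|` (M `\` C)) ?setDIr//.
apply: le_trans (measureU2 _ _ _) _; [exact: measurableD|exact: measurableD|].
rewrite (splitr eps) EFinD; apply: leeD.
  apply: le_trans K0e; apply: le_measure; rewrite ?inE.
  - exact: measurableD.
  - exact: measurableC.
  - by move=> x [].
apply: (@measure_bigcup_small _ _ _ nu _ (fun n => M `\` (F n `|` G n))).
- exact: ltW.
- exact: measurableD.
- by move=> n; apply: measurableD => //; exact: borel_closed.
- by move=> x [Mx /existsNP[n nFG]]; exists n => //; split => // FG; apply: nFG.
move=> n; have [cF FP Fe] := HF n; have [cG GQ Ge] := HG n.
have mF := borel_closed cF; have mG := borel_closed cG.
apply: (@le_trans _ _ (nu ((P n `\` F n) `|` ((M `\` P n) `\` G n)))).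
  apply: le_measure; rewrite ?inE.
  - by apply: measurableD => //; exact: measurableU.
  - by apply: measurableU; exact: measurableD.
  move=> x [Mx /not_orP[nF nG]]; have [Px|nP] := pselect (P n x); [by left|by right].
apply: le_trans (measureU2 _ _ _) _; [exact: measurableD|exact: measurableD|].
have -> : eps / 2 / (2 ^ n.+1)%:R = eps / 2 / 2 / (2 ^ n.+1)%:R + eps / 2 / 2 / (2 ^ n.+1)%:R.
  by rewrite -mulrDl -splitr.
by rewrite EFinD; exact: leeD.
Qed.

Hypothesis injT : forall x y, X0 x -> X0 y -> T x = T y -> x = y.

(** The sets A with Borel image form a sigma-algebra: injectivity makes the image of a complement
    the difference of images. It contains the closed sets, whose images are compact. *)
Lemma image_compact_measurable (K : set X) (A : set (borel X)) : compact K -> K `<=` X0 ->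
  {within K, continuous (T : X -> X)} -> measurable A ->
  measurable (T @` (K `&` A) : set (borel X)).
Proof.
move=> kK KX0 cT.
have mclosed (C : set X) : closed C -> measurable (T @` (K `&` C) : set (borel X)).
  move=> cC; apply: borel_closed.
  have kKC : compact (K `&` C) by exact: compact_closedI.
  have : compact ((T : X -> X) @` (K `&` C)).
    apply: continuous_compact kKC; apply: continuous_subspaceW cT.
    by move=> x [].
  by apply: compact_closed; exact: norm_hausdorff.
have mK : measurable (T @` K : set (borel X)).
  by have := mclosed setT closedT; rewrite setIT.
have step (B : set (borel X)) : measurable (T @` (K `&` B) : set (borel X)) ->
    measurable (T @` (K `&` ~` B) : set (borel X)).
  move=> mB; rewrite (_ : T @` (K `&` ~` B) = T @` K `\` T @` (K `&` B)); first exact: measurableD.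
  apply/seteqP; split=> [_ [x [Kx nB] <-]|_ [[x Kx <-] nB]].
    split; first by exists x.
    case=> y [Ky By] Txy; apply: nB.
    by rewrite -(injT (KX0 _ Ky) (KX0 _ Kx) Txy).
  by exists x => //; split => // Bx; apply: nB; exists x.
apply: (smallest_sub (X := [set A : set (borel X) | measurable (T @` (K `&` A) : set (borel X))])).
  split.
  - by rewrite /= setI0 image_set0.
  - by move=> B /=; rewrite setTD; exact: step.
  - move=> B /= mB; rewrite setI_bigcupr image_bigcup; exact: bigcup_measurable.
move=> U oU /=; rewrite -[U]setCK; apply: step; apply: mclosed; exact: open_closedC.
Qed.

Hypothesis nuX0 : nu X0 = 1%E.
Hypothesis nuT : forall B : set (borel X), measurable B -> nu (X0 `&` T @^-1` B) = mu B.

(** T made total by the value 0, so that the theory of image measures for everywhere defined maps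
    applies; the change is on a [nu]-null set. *)
Definition total_map (x : borel X) : borel X := if x \in X0 then T x else (0 : X).

Lemma nuX0C : nu (~` X0) = 0%E.
Proof. by rewrite probability_setC// nuX0 -EFinB subrr. Qed.

Lemma ae_X0 : {ae nu, forall x, X0 x}.
Proof. by exists (~` X0); split; [exact: measurableC|exact: nuX0C|]. Qed.

Lemma total_mapE x : X0 x -> total_map x = T x.
Proof. by move=> X0x; rewrite /total_map mem_set. Qed.

Lemma measurable_total_map : measurable_fun setT total_map.
Proof.
move=> _ B mB; rewrite setTI.
have m0 : measurable (~` X0 `&` [set _ : borel X | B (0 : X)]).
  have [B0|B0] := pselect (B (0 : X)).
    by rewrite (_ : [set _ | _] = setT) ?setIT; [exact: measurableC|by apply/seteqP; split].
  by rewrite (_ : [set _ | _] = set0) ?setI0//; apply/seteqP; split.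
rewrite (_ : _ @^-1` B = (X0 `&` T @^-1` B) `|` (~` X0 `&` [set _ : borel X | B (0 : X)])).
  by apply: measurableU => //; exact: mT.
apply/seteqP; split=> [x /=|x [[X0x /= Bx]|[X0x /= Bx]]].
- have [X0x|X0x] := pselect (X0 x); first by rewrite total_mapE//; left.
  by rewrite /total_map memNset//; right.
- by rewrite total_mapE.
- by rewrite /total_map memNset.
Qed.

Lemma nu_total_map B : measurable B -> nu (total_map @^-1` B) = mu B.
Proof.
move=> mB; have mTB : measurable (total_map @^-1` B).
  by rewrite -[_ @^-1` B]setTI; exact: measurable_total_map.
have D0 : nu (total_map @^-1` B `\` X0) = 0%E.
  apply/eqP; rewrite eq_le measure_ge0 andbT -nuX0C; apply: le_measure; rewrite ?inE.
  - exact: measurableD.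
  - exact: measurableC.
  - by move=> x [].
rewrite -(nuT mB) [LHS](measureDI nu mTB mX0) [X in (X + _)%E]D0 add0e.
congr (nu _); apply/seteqP; split=> x [].
  by move=> + X0x; rewrite /= total_mapE.
by move=> X0x TB; split => //; rewrite /= total_mapE.
Qed.

Lemma ge0_integral_total_map (h : borel X -> \bar R) : measurable_fun setT h ->
  (forall x, 0 <= h x)%E -> (\int[nu]_x h (total_map x) = \int[mu]_x h x)%E.
Proof.
move=> mh h0.
have := ge0_integral_pushforward measurable_total_map nu measurableT mh (fun x _ => h0 x).
rewrite preimage_setT => <-; apply: eq_measure_integral => [|mtot B mB _]; first exact: measurable_total_map.
exact: nu_total_map.
Qed.

Lemma ae_total_map (P : borel X -> Prop) : {ae mu, forall x, P x} ->
  {ae nu, forall x, P (total_map x)}.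
Proof.
move=> [N [mN N0 PN]]; exists (total_map @^-1` N); split.
- by rewrite -[_ @^-1` N]setTI; exact: measurable_total_map.
- by rewrite nu_total_map.
- by move=> x nP; exact: PN.
Qed.

Lemma pullbackE (f : borel X -> R) x : X0 x -> pullback X0 T f x = f (total_map x).
Proof. by move=> X0x; rewrite /pullback /patch mem_set// total_mapE. Qed.

Lemma ae_pullback (f : borel X -> R) : pullback X0 T f = f \o total_map %[ae nu].
Proof. by apply: filterS ae_X0 => x X0x _; rewrite pullbackE. Qed.

Lemma measurable_pullback (f : borel X -> R) : measurable_fun setT f ->
  measurable_fun setT (pullback X0 T f).
Proof.
move=> mf; apply/(measurable_restrictT _ mX0).
by apply: measurableT_comp mT.
Qed.

Lemma L2norm_pullback (f : borel X -> R) : measurable_fun setT f ->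
  L2norm nu (pullback X0 T f) = L2norm mu f.
Proof.
move=> mf; have mfT : measurable_fun setT (f \o total_map).
  exact: measurableT_comp measurable_total_map.
rewrite (L2norm_ae (measurable_pullback mf) mfT (ae_pullback f)) !L2normE//; congr sqrte.
apply: (@ge0_integral_total_map (fun x => (f x ^+ 2)%:E)).
  exact/measurable_EFinP/measurable_funX.
by move=> x; rewrite lee_fin sqr_ge0.
Qed.

Lemma pullback_L2 (f : borel X -> R) : L2fun mu f -> L2fun nu (pullback X0 T f).
Proof.
move=> fL; have mf := L2fun_measurable fL; have mp := measurable_pullback mf.
have := L2norm_pullback mf; rewrite (L2norm_fin fL) => n.
rewrite /L2fun /= inE; apply/andP; split; rewrite inE//= /finite_norm.
by move: n; rewrite /L2norm => ->; rewrite ltry.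
Qed.

Lemma L2n_pullback (f : borel X -> R) : L2fun mu f -> L2n nu (pullback X0 T f) = L2n mu f.
Proof.
move=> fL; have := L2norm_pullback (L2fun_measurable fL).
by rewrite (L2norm_fin fL) (L2norm_fin (pullback_L2 fL)) => -[].
Qed.

Lemma pullback_lin a (f g : borel X -> R) :
  pullback X0 T (a *: f + g) = a *: pullback X0 T f + pullback X0 T g.
Proof.
apply/funext => x; rewrite -[RHS]/(a * pullback X0 T f x + pullback X0 T g x).
by rewrite /pullback /patch; case: ifP => _; rewrite ?mulr0 ?addr0.
Qed.

Lemma ae_eq_pullback (f g : borel X -> R) : f = g %[ae mu] -> pullback X0 T f = pullback X0 T g %[ae nu].
Proof.
move=> /ae_total_map fg; apply: (filterS2 _ _ fg ae_X0) => x fgx X0x _.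
by rewrite !pullbackE// fgx.
Qed.

(** Polarization: norms are preserved, and the product is read off from the norm of f + g. *)
Lemma L2dot_pullback (f g : borel X -> R) : L2fun mu f -> L2fun mu g ->
  L2dot nu (pullback X0 T f) (pullback X0 T g) = L2dot mu f g.
Proof.
move=> fL gL; have pf := pullback_L2 fL; have pg := pullback_L2 gL.
have n h : L2fun mu h ->
    L2dot nu (pullback X0 T h) (pullback X0 T h) = L2dot mu h h.
  move=> hL; rewrite -(sqr_semi_norm (L2_inner mu) hL).
  by rewrite -(sqr_semi_norm (L2_inner nu) (pullback_L2 hL)); congr (_ ^+ 2); exact: L2n_pullback.
have := n _ (L2fun_lin 1 fL gL); rewrite pullback_lin.
rewrite (semi_sqr_lin (L2_inner mu))// (semi_sqr_lin (L2_inner nu))// !n//.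
lra.
Qed.

Lemma pushforward_exists (f : borel X -> R) : measurable_fun setT f ->
  exists2 g : borel X -> R, measurable_fun setT g &
    {ae mu, forall y, exists x, [/\ X0 x, T x = y & g y = f x]}.
Proof.
move=> mf.
have /choice[K HK] : forall n : nat, exists K : set X, [/\ compact K, K `<=` X0,
    {within K, continuous (T : X -> X)} & (nu (X0 `\` K) <= (n.+1%:R^-1)%:E)%E].
  by move=> n; apply: lusin_compact => //; rewrite invr_gt0.
have mK n : measurable (K n : set (borel X)).
  by have [kK _ _ _] := HK n; apply: borel_closed; apply: compact_closed kK; exact: norm_hausdorff.
(* [Y] is a Borel set of full measure, and the inverse [S] of T is Borel on it. *)
pose Y : set (borel X) := \bigcup_n T @` (K n).
have mimage (A : set (borel X)) : measurable A -> measurable (\bigcup_n T @` (K n `&` A)).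
  move=> mA; apply: bigcup_measurable => n _; have [? ? ? _] := HK n.
  exact: image_compact_measurable.
have mY : measurable Y.
  have := mimage _ measurableT; congr measurable; apply: eq_bigcupr => n _; by rewrite setIT.
(* The preimage of the complement of Y misses every K j, so its [nu]-measure is at most 1 / (j + 1)
   for all j. *)
have muY : mu (~` Y) = 0%E.
  rewrite -nuT; last exact: measurableC.
  apply/eqP; rewrite eq_le measure_ge0 andbT; apply/lee_addgt0Pr => eps eps0; rewrite add0e.
  have [j _ /(_ j (leqnn j)) jr] := near_infty_natSinv_lt (PosNum eps0).
  have [_ _ _ le] := HK j; apply: (@le_trans _ _ (j.+1%:R^-1)%:E); last by rewrite lee_fin ltW.
  apply: le_trans le; apply: le_measure; rewrite ?inE.
  - by apply: mT => //; exact: measurableC.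
  - exact: measurableD.
  by move=> x [X0x nY]; split => // Kx; apply: nY; exists j => //; exists x.
have /choice[S HS] : forall y, exists x : borel X, Y y -> X0 x /\ T x = y.
  move=> y; have [Yy|nY] := pselect (Y y); last by exists (0 : X).
  have [n _ [x Kx Txy]] := Yy; exists x => _; split => //.
  by have [_ KX0 _ _] := HK n; exact: KX0.
have SE x n : K n x -> S (T x) = x.
  move=> Kx; have YT : Y (T x) by exists n => //; exists x.
  have [X0S TS] := HS _ YT; apply: injT => //.
  by have [_ KX0 _ _] := HK n; exact: KX0.
exists ((f \o S) \_ Y).
  apply/(measurable_restrictT _ mY) => _ B mB.
  (* On T (K n) the function is f after the inverse of T, so preimages of Borel sets are images
     under T of Borel parts of the K n. *)
  rewrite (_ : Y `&` _ = \bigcup_n T @` (K n `&` f @^-1` B)).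
    by apply: mimage; rewrite -[_ @^-1` _]setTI; exact: mf.
  apply/seteqP; split=> [y [[n _ [x Kx <-]]]|y [n _ [x [Kx fB] <-]]].
    by rewrite /= (SE _ _ Kx) => fB; exists n => //; exists x.
  split; first by exists n => //; exists x.
  by rewrite /= (SE _ _ Kx).
exists (~` Y); split; [exact: measurableC|exact: muY|].
move=> y ny Yy; apply: ny.
have [X0S TS] := HS y Yy; exists (S y); split => //.
by rewrite /patch mem_set.
Qed.

(** Almost everywhere the value of g at T x is that of f at some z in X0 with T z = T x, and
    injectivity gives z = x. *)
Lemma pullback_pushforward (f g : borel X -> R) :
  {ae mu, forall y, exists x, [/\ X0 x, T x = y & g y = f x]} ->
  pullback X0 T g = f %[ae nu].
Proof.
move=> /ae_total_map h; apply: (filterS2 _ _ h ae_X0) => x [z [X0z Tz gz]] X0x _.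
rewrite pullbackE// gz; congr f; apply: injT => //.
by rewrite Tz total_mapE.
Qed.

End InjectiveTransport.

Lemma L2fun_norm d (T : measurableType d) (R : realType) (mu : {measure set T -> \bar R})
  (f : T -> R) : measurable_fun setT f -> (L2norm mu f < +oo)%E -> L2fun mu f.
Proof. by move=> mf fin; rewrite /L2fun /= inE; apply/andP; split; rewrite inE. Qed.

(** * Closedness of the image of an isometry up to a factor *)

Section IsometricChaos.
Context d (T : measurableType d) (R : realType) (nu : {measure set T -> \bar R}).
Variables (H : completeNormedModType R) (ip : {dot H for idfun}) (E : set H).
Variable J : forall n : nat, (H ^ n -> R) -> T -> R.
Arguments J : clear implicits.
Hypothesis ipn : forall h, `|h| ^+ 2 = ip h h.
Hypothesis basisE : orthonormal_basis ip E.
Variables (e : nat -> H) (code : H -> nat).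
Hypothesis eE : enumerates E e code.
Variable n : nat.
Hypothesis linJ : HS_linear E nu (J n).
Hypothesis isoJ : forall A, HS_form E A -> L2n nu (J n A) = Num.sqrt n`!%:R * HSn e A.

Let FI := HS_form_inner basisE eE n.
Let SI := L2_inner nu.

Let JL A : HS_form E A -> L2fun nu (J n A).
Proof. by have [IL _] := linJ; exact: IL. Qed.

Let J_lin a A B : HS_form E A -> HS_form E B ->
  J n (a *: A + B) = a *: J n A + J n B %[ae nu].
Proof. by move=> FA FB; have [_ Ilin] := linJ; exact: Ilin. Qed.

Let J_dist A B : HS_form E A -> HS_form E B ->
  L2n nu (J n A - J n B) = Num.sqrt n`!%:R * HSn e (A - B).
Proof.
move=> FA FB; have FAB := semi_subspaceB FI FA FB; rewrite -isoJ//.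
have L1 := semi_subspaceB SI (JL FA) (JL FB); have L2 := JL FAB.
have h : J n A - J n B = J n (A - B) %[ae nu].
  have := J_lin (-1) FB FA; rewrite !scaleN1r ![- _ + _]addrC.
  by apply: filterS => x h xT; rewrite h.
exact: (L2n_ae_eq L1 L2 h).
Qed.

(** If integrals converge in L^2, then by the isometry their forms are Cauchy and have a limit,
    whose integral is the limit function. Only sqrt n! >= 1 is needed to transfer the Cauchy
    property. *)
Lemma isometric_chaos_closed : L2_closed_subspace nu (chaos E nu J n).
Proof.
have F0 := semi_space0 FI.
split.
- by move=> f [].
- split; first exact: (L2fun0 nu).
  exists 0 => //; have : J n 0 = 0 %[ae nu].
    apply: (L2n_eq0 (JL F0) (L2fun0 nu)).
    by rewrite subr0 isoJ// /HSn (semi_norm0 FI) mulr0.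
  by apply: filterS => x h xT; rewrite h.
- move=> a f g [fL [A FA fA]] [gL [B FB gB]]; split.
    exact: (L2fun_lin a fL gL).
  exists (a *: A + B); first exact: (semi_space_lin FI).
  apply: (filterS3 _ _ fA gB (J_lin a FA FB)) => x {}fA {}gB h xT.
  by rewrite h// fA// gB.
move=> u f uK fL; have uL N : L2fun nu (u N) by have [] := uK N.
move=> /(L2cvgP uL fL) uf; split => //.
have /choice[A HA] : forall N, exists A, HS_form E A /\ u N = J n A %[ae nu].
  by move=> N; have [_ [A FA uA]] := uK N; exists A.
have FA N : HS_form E (A N) by have [] := HA N.
have uA N g : L2fun nu g -> L2n nu (u N - g) = L2n nu (J n (A N) - g).
  move=> gL; have L1 := semi_subspaceB SI (uL N) gL; have L2 := semi_subspaceB SI (JL (FA N)) gL.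
  have h : u N - g = J n (A N) - g %[ae nu].
    by have [_] := HA N; apply: filterS => x h xT; rewrite -[LHS]/(u N x - g x) h.
  exact: (L2n_ae_eq L1 L2 h).
have s1 : 1 <= Num.sqrt n`!%:R :> R by rewrite -[leLHS]sqrtr1 ler_sqrt// ler1n fact_gt0.
have cA : semi_cauchy (HS_dot (n := n) e) A.
  move=> eps eps0; have [M HM] := semi_cvg_cauchy SI uL fL uf eps0.
  exists M => k m Mk Mm; apply: le_lt_trans (HM k m Mk Mm).
  rewrite [leRHS](uA k _ (uL m)) [leRHS](semi_normBC SI (JL (FA k)) (uL m)).
  rewrite [leRHS](uA m _ (JL (FA k))) [leRHS](J_dist (FA m) (FA k)).
  by rewrite (semi_normBC FI (FA k) (FA m)) ler_peMl// semi_norm_ge0.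
have [B FB AB] := HS_form_complete ipn basisE eE FA cA.
exists B => //; apply: (L2n_eq0 fL (JL FB)); apply/eqP.
rewrite eq_le semi_norm_ge0 andbT.
have c1 : L2n nu (u N - f) + Num.sqrt n`!%:R * HSn e (A N - B) @[N --> \oo] --> (0 : R).
  rewrite -[X in _ --> X]addr0; apply: cvgD => //.
  by rewrite -[X in _ --> X](mulr0 (Num.sqrt n`!%:R)); apply: cvgM => //; exact: cvg_cst.
apply: (cvgr_to_ge c1); near=> N.
apply: le_trans (ler_semi_normB SI fL (uL N) (JL FB)) _.
rewrite (semi_normBC SI fL (uL N)) lerD2l -J_dist//.
by rewrite [leLHS](uA N _ (JL FB)).
Unshelve. all: by end_near. Qed.

End IsometricChaos.

Theorem lemma3p1 (R : realType) (X H : completeNormedModType R)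
  (mu nu : probability (borel X) R)
  (ip : {dot H for idfun}) (iota : {linear H -> X}) (E : set H)
  (I : forall n : nat, (H ^ n -> R) -> borel X -> R)
  (X0 : set (borel X)) (T : borel X -> borel X)
  (sepX : separable X)
  (gauss_mu : centered_gaussian mu)
  (supp_mu : full_support mu)
  (CM : cameron_martin mu ip iota)
  (basisE : orthonormal_basis ip E)
  (intI : forall n, multiple_integral mu ip iota E (I n))
  (mX0 : measurable X0)
  (nuX0 : nu X0 = 1%E)
  (mT : measurable_fun X0 T)
  (injT : forall x y, X0 x -> X0 y -> T x = T y -> x = y)
  (nuT : forall B : set (borel X), measurable B ->
     nu (X0 `&` T @^-1` B) = mu B) :
  let That := pullback X0 T in
  let Inu := fun (n : nat) (A : H ^ n -> R) => That (I n A) in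
  L2_isometry_onto mu nu That /\
  (forall n, HS_isometric_embedding E nu
     (fun (A : H ^ n -> R) x => (Num.sqrt (n`!)%:R)^-1 * Inu n A x)) /\
  L2_mutually_orthogonal nu (chaos E nu Inu) /\
  L2_hilbert_sum nu (chaos E nu Inu) /\
  (forall f, f \in Lfun nu 2%:E ->
     exists! A : forall n : nat, H ^ n -> R,
       (forall n, HS_form E (A n)) /\ L2sum nu (fun n => Inu n (A n)) f) /\
  (forall f, f \in Lfun nu 2%:E ->
     (exists g, is_pushforward mu X0 T f g) /\
     forall g, is_pushforward mu X0 T f g ->
     forall A : forall n : nat, H ^ n -> R, (forall n, HS_form E (A n)) ->
       (L2sum nu (fun n => Inu n (A n)) f <->
        L2sum mu (fun n => I n (A n)) g)).
Proof.
move=> That Inu.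
have [[ipn sepH] _ _ _ _] := CM.
have [e [code eE]] := basis_enumeration ipn sepH basisE.
have FI n := HS_form_inner basisE eE n.
have SImu := L2_inner mu; have SInu := L2_inner nu.
have IL n A (FA : HS_form E A) : L2fun mu (I n A) by exact: (J_L2 intI).
have TL f : L2fun mu f -> L2fun nu (That f) by exact: pullback_L2.
have Tnorm f : L2fun mu f -> L2n nu (That f) = L2n mu f by exact: L2n_pullback.
have Tae f g : f = g %[ae mu] -> That f = That g %[ae nu] by exact: ae_eq_pullback.
have Tlin a f g : That (a *: f + g) = a *: That f + That g by exact: pullback_lin.
have linI n : HS_linear E nu (Inu n).
  split=> [A FA|a A B FA FB]; first exact/TL/IL.
  have := Tae _ _ (J_lin intI a FA FB); rewrite Tlin.
  by apply: filterS => x h xT; exact: (h xT).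
have isoI n A : HS_form E A -> L2n nu (Inu n A) = Num.sqrt n`!%:R * HSn e A.
  by move=> FA; rewrite [LHS](Tnorm _ (IL n A FA)); exact: (L2n_J gauss_mu CM basisE intI eE FA).
(* The representative of f o T^-1 obtained so far is only measurable. It is square integrable
   because its pullback is f almost everywhere and pullback preserves the norm, even when
   infinite. *)
have pull f : L2fun nu f -> exists2 g, L2fun mu g & is_pushforward mu X0 T f g.
  move=> fL.
  have [g mg gf] := pushforward_exists sepX mX0 mT injT nuT (L2fun_measurable fL).
  have Tg := pullback_pushforward mX0 mT injT nuX0 nuT gf.
  have gL : L2fun mu g.
    apply: L2fun_norm => //; rewrite -(L2norm_pullback mX0 mT nuX0 nuT mg).
    have mTg := measurable_pullback mX0 mT mg.
    by rewrite (L2norm_ae mTg (L2fun_measurable fL) Tg) (L2norm_fin fL) ltry.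
  by exists g.
have pushE f g : is_pushforward mu X0 T f g -> That g = f %[ae nu].
  by move=> [_ gf]; exact: (pullback_pushforward mX0 mT injT nuX0 nuT gf).
(* Distances to f in L^2(nu) are distances to its pushforward in L^2(mu); density, expansion,
   uniqueness and the final equivalence are all transferred through this identity. *)
have dist f g h : L2fun nu f -> L2fun mu g -> That g = f %[ae nu] -> L2fun mu h ->
    L2n nu (That h - f) = L2n mu (h - g).
  move=> fL gL gf hL; have hgL := semi_subspaceB SImu hL gL.
  rewrite -(Tnorm _ hgL).
  have L1 := semi_subspaceB SInu (TL _ hL) fL; have L2 := TL _ hgL.
  have Th : That (h - g) = That h - That g.
    by rewrite addrC -scaleN1r Tlin scaleN1r addrC.
  have ae : That h - f = That (h - g) %[ae nu].
    by rewrite Th; apply: filterS gf => x h' xT; rewrite -[LHS]/(That h x - f x) -h'.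
  exact: (L2n_ae_eq L1 L2 ae).
have sumE N (A : forall n, H ^ n -> R) : chaos_sum Inu N A = That (chaos_sum I N A).
  have T0 : That 0 = 0.
    by have := Tlin (-1) 0 0; rewrite scaler0 addr0 scaleN1r addNr.
  rewrite /chaos_sum; elim: N => [|N IH]; first by rewrite !big_ord0 T0.
  by rewrite !big_ord_recr/= IH -[X in That (X + _)]scale1r Tlin scale1r.
have sumLmu N (A : forall n, H ^ n -> R) : (forall n, HS_form E (A n)) ->
    L2fun mu (chaos_sum I N A) by move=> FA; exact: (L2fun_chaos_sum intI).
have L2sumE (m : {measure set (borel X) -> \bar R})
    (K : forall n, (H ^ n -> R) -> borel X -> R) (A : forall n, H ^ n -> R) f :
    (forall N, L2fun m (chaos_sum K N A)) -> L2fun m f ->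
    L2sum m (fun n => K n (A n)) f <-> L2n m (chaos_sum K N A - f) @[N --> \oo] --> 0.
  move=> KL fL; rewrite -L2cvgP// /L2sum.
  rewrite (_ : (fun N x => _) = fun N => chaos_sum K N A)//.
  by apply/funext => N; apply/funext => x; rewrite /chaos_sum fct_sumE.
have sums f g (A : forall n, H ^ n -> R) : L2fun nu f -> L2fun mu g ->
    That g = f %[ae nu] -> (forall n, HS_form E (A n)) ->
    L2sum nu (fun n => Inu n (A n)) f <-> L2sum mu (fun n => I n (A n)) g.
  move=> fL gL gf FA; rewrite !L2sumE//; last 2 first.
  - by move=> N; exact: sumLmu.
  - by move=> N; rewrite sumE; exact/TL/sumLmu.
  rewrite (_ : (fun N => L2n nu _) = fun N => L2n mu (chaos_sum I N A - g))//.
  by apply/funext => N; rewrite sumE (dist f g)//; exact: sumLmu.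
have orthoI : L2_mutually_orthogonal nu (chaos E nu Inu).
  move=> m n mn f g [fL [A FA fA]] [gL [B FB gB]].
  have AL := TL _ (IL _ _ FA); have BL := TL _ (IL _ _ FB).
  rewrite (L2dot_ae fL AL gL fA) (L2dotC AL gL) (L2dot_ae gL BL AL gB).
  rewrite [LHS](L2dot_pullback mX0 mT nuX0 nuT (IL _ _ FB) (IL _ _ FA)).
  by apply: (chaos_orthogonal gauss_mu CM basisE intI eE) => //; rewrite eq_sym.
split; [split|split; [|split; [|split; [|split]]]].
- exact: TL.
- by move=> f g _ _; exact: Tae.
- by move=> a f g _ _; rewrite [That _]Tlin; exact: aeW.
- by move=> f fL; rewrite (L2norm_fin (TL _ fL)) Tnorm// (L2norm_fin fL).
- by move=> f fL; have [g gL /pushE gf] := pull f fL; exists g.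
- move=> n; have s0 : 0 < Num.sqrt n`!%:R :> R by rewrite sqrtr_gt0 ltr0n fact_gt0.
  have cL A : HS_form E A -> L2fun nu ((Num.sqrt n`!%:R)^-1 *: Inu n A).
    by move=> FA; exact: (semi_subspaceZ SInu _ (TL _ (IL _ _ FA))).
  split; first split=> [A FA|a A B FA FB].
  - exact: cL.
  - have [_ /(_ a A B FA FB)] := linI n.
    by apply: filterS => x h xT; rewrite h//; ring.
  move=> A FA; have /HS_form_space[HA _] := FA.
  rewrite (HS_normE basisE eE HA) (L2norm_fin (cL A FA)); congr EFin.
  rewrite [LHS](semi_normZ SInu _ (TL _ (IL _ _ FA))) [X in _ * X](isoI n A FA).
  by rewrite ger0_norm ?invr_ge0 ?sqrtr_ge0// mulrA mulVf ?mul1r// gt_eqF.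
- exact: orthoI.
- split => //.
    by move=> n; apply: (isometric_chaos_closed ipn basisE eE (linI n)); exact: isoI.
  move=> f fL eps eps0; have [g gL /pushE gf] := pull f fL.
  have [N [A [FA lt]]] := chaos_dense sepX gauss_mu CM basisE intI eE gL eps0.
  exists N, (fun n => Inu n (A n)); split.
    by move=> n; split; [exact/TL/IL|exists (A n) => //; exact: aeW].
  rewrite (_ : (fun x => _) = f - chaos_sum Inu N A); last first.
    by apply/funext => x; rewrite -[RHS]/(f x - chaos_sum Inu N A x) /chaos_sum fct_sumE.
  have sL := sumLmu N A FA; have TsL := TL _ sL.
  rewrite sumE (L2norm_fin (semi_subspaceB SInu fL TsL)) lte_fin.
  rewrite [ltLHS](semi_normBC SInu fL TsL) [ltLHS](dist f g _ fL gL gf sL).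
  by rewrite [ltLHS](semi_normBC SImu sL gL).
- move=> f fL; have [g gL /pushE gf] := pull f fL.
  have [A FA cA] := chaos_expansion sepX gauss_mu CM basisE intI eE gL.
  have sumA B (FB : forall n, HS_form E (B n)) := sums f g B fL gL gf FB.
  have L2g B (FB : forall n, HS_form E (B n)) := L2sumE mu I B g (fun N => sumLmu N B FB) gL.
  exists A; split; first by split=> //; apply/(sumA A FA)/(L2g A FA).
  move=> B [FB /(sumA B FB)/(L2g B FB) cB].
  exact: (chaos_expansion_unique gauss_mu CM basisE intI eE gL FA FB cA cB).
move=> f fL; split; first by have [g _ pg] := pull f fL; exists g.
by move=> g pg A FA; apply: sums => //; [case: pg|exact: pushE].
Qed.
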